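(* Let $X$ and $Y$ be two centered $n$-dimensional normal random vectors with covariance matrices $\Sigma_X$ and $\Sigma_Y$ respectively, and let $a,b\in\mathbb{R}^n$. Let $\lambda_{1X}\ge\lambda_{2X}$ be the two largest eigenvalues (counting multiplicities) of $\Sigma_X$, and assume $\lambda_{2X}>0$. Then $$ d_{\rm TV}(|X-a|,|Y-b|)\le\frac{160}{\sqrt{\lambda_{1X}\cdot\lambda_{2X}}}\Bigl(\|\Sigma_X-\Sigma_Y\|_{HS}+|{\rm tr}\,\Sigma_X-{\rm tr}\,\Sigma_Y|+\bigl||a|^2-|b|^2\bigr|+\bigl|\Sigma_X^{1/2}a-\Sigma_Y^{1/2}b\bigr|\Bigr). $$
   Context: $|\cdot|$ is the Euclidean norm on $\mathbb{R}^n$ (and the absolute value on $\mathbb{R}$), $\|\cdot\|_{HS}$ is the Hilbert--Schmidt norm of a matrix, and $\Sigma^{1/2}$ is the positive semidefinite square root. The normal vectors may be degenerate. For real random variables $\xi,\eta$, $$d_{\rm TV}(\xi,\eta):=\sup\bigl\{\mathbb{E}[\varphi(\xi)]-\mathbb{E}[\varphi(\eta)]\colon \varphi\in C_0^\infty(\mathbb{R}),\ \|\varphi\|_\infty\le1\bigr\},$$ where $\|\varphi\|_\infty=\sup_{t\in\mathbb{R}}|\varphi(t)|$ and $C_0^\infty(\mathbb{R})$ is the space of smooth compactly supported functions. *)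

(* Defs.v *)
From HB Require Import structures.
From mathcomp Require Import all_boot all_order all_algebra.
From mathcomp Require Import all_classical all_reals all_analysis.

Set Implicit Arguments.
Unset Strict Implicit.
Unset Printing Implicit Defensive.

Import Order.TTheory GRing.Theory Num.Theory.
Import numFieldNormedType.Exports.

Local Open Scope classical_set_scope.
Local Open Scope ring_scope.

(* The library norm on matrices is the sup norm, so the Euclidean and
   Hilbert-Schmidt norms are spelled out. *)
Definition eucl_norm (R : realType) (n : nat) (v : 'cV[R]_n) : R :=
  Num.sqrt (\sum_(i < n) v i 0 ^+ 2).

Definition hs_norm (R : realType) (n : nat) (A : 'M[R]_n) : R :=
  Num.sqrt (\sum_(i < n) \sum_(j < n) A i j ^+ 2).

Definition psdmx (R : realType) (n : nat) (A : 'M[R]_n) : Prop :=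
  A^T = A /\ forall u : 'cV[R]_n, 0 <= (u^T *m A *m u) 0 0.

(* The positive semidefinite square root exists and is unique when A is
   positive semidefinite; otherwise the value is the junk value 0. *)
Definition psd_sqrt (R : realType) (n : nat) (A : 'M[R]_n) : 'M[R]_n :=
  xget 0 [set B : 'M[R]_n | psdmx B /\ B *m B = A].

(* All eigenvalues of A, with multiplicity, are real and, in nonincreasing
   order, start with l1, l2. In particular 2 <= n. *)
Definition two_largest_eigenvalues (R : realType) (n : nat) (A : 'M[R]_n)
    (l1 l2 : R) : Prop :=
  exists s : seq R,
    sorted (fun x y : R => y <= x) [:: l1, l2 & s] /\
    char_poly A = \prod_(x <- [:: l1, l2 & s]) ('X - x%:P).

(* The degenerate case s = 0 is treated separately because the library's
   normal_prob m 0 is the uniform law on [0, 1], not the Dirac mass at m. *)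
Definition normal_rv (R : realType) (d : measure_display)
    (T : measurableType d) (P : probability T R) (f : T -> R) : Prop :=
  measurable_fun setT f /\
  exists m s : R, forall A : set R, measurable A ->
    P (f @^-1` A) = if s == 0 then \d_m A else normal_prob m s A.

Definition normal_vector (R : realType) (d : measure_display)
    (T : measurableType d) (P : probability T R) (n : nat)
    (X : T -> 'cV[R]_n) : Prop :=
  forall u : 'cV[R]_n, normal_rv P (fun w => \sum_(i < n) u i 0 * X w i 0).

Definition centered_vector (R : realType) (d : measure_display)
    (T : measurableType d) (P : probability T R) (n : nat)
    (X : T -> 'cV[R]_n) : Prop :=
  forall i : 'I_n, ('E_P[(fun w => X w i 0)%R] = 0)%E.

Definition is_covariance_mx (R : realType) (d : measure_display)
    (T : measurableType d) (P : probability T R) (n : nat)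
    (X : T -> 'cV[R]_n) (S : 'M[R]_n) : Prop :=
  forall i j : 'I_n,
    covariance P (fun w => X w i 0) (fun w => X w j 0) = (S i j)%:E.

Definition test_function (R : realType) (phi : R -> R) : Prop :=
  (forall (k : nat) (t : R), derivable (derive1n k phi) t 1) /\
  compact (closure [set t : R | phi t != 0]).

Definition sup_norm (R : realType) (phi : R -> R) : \bar R :=
  ereal_sup [set `|phi t|%:E | t in [set: R]].

(* xi and eta may live on different probability spaces. *)
Definition dTV (R : realType) (d d' : measure_display)
    (T : measurableType d) (T' : measurableType d')
    (P : probability T R) (Q : probability T' R)
    (xi : T -> R) (eta : T' -> R) : \bar R :=
  ereal_sup [set ('E_P[phi \o xi] - 'E_Q[phi \o eta])%E |
    phi in [set phi : R -> R | test_function phi /\ (sup_norm phi <= 1)%E]].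

(* Main.v *)
Require Import Defs.
From HB Require Import structures.
From mathcomp Require Import all_boot all_order all_algebra.
From mathcomp Require complex.
From mathcomp Require Import all_classical all_reals all_analysis.
From mathcomp Require Import measurable_realfun.
From mathcomp Require Import ring lra.

(* The law of |X - a| is determined by the expectations of p(exp(-|X - a|^2)), p
   a polynomial: by Bernstein approximation these determine the expectation of
   every continuous bounded function, and they only depend on the covariance of
   X. One may thus replace X and Y by S Z and T Z, where S and T are the square
   roots of the covariance matrices and Z is a standard Gaussian vector, so that
   both squared distances become quadratic functions f, g of the same Z, with
   E|g - f| controlled by the right-hand side. Rotate Z so that the eigenvectors
   of l1, l2 are the first two coordinates, and freeze the others. For a planar
   quadratic function q >= 0 with Hessian determinant 4 det, and a smooth density
   rho, the integral of psi'(q) rho over the lines through the minimum of q can be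
   integrated by parts; it is bounded by sup|psi| times O(det^(-1/2)), uniformly
   in psi. Applied to the interpolations between f and g, and integrated along the
   path, this bounds E[psi(g) - psi(f)] by O((l1 l2)^(-1/2)) E|coefficients of g - f|. *)

Set Implicit Arguments.
Unset Strict Implicit.
Unset Printing Implicit Defensive.
Import Order.TTheory GRing.Theory Num.Theory.
Import numFieldNormedType.Exports.

Local Open Scope classical_set_scope.
Local Open Scope ring_scope.

(** * Symmetric matrices over a real closed field *)

(** Polynomials in exp(-t) serve because phi(sqrt t) may fail to be differentiable at t = 0, whereas
    p(exp(-t)) is smooth with bounded derivative on t >= 0. That bound only gives integrability and
    never reaches the estimate, so the limit over p costs nothing. The terms of the bound are read
    off |S z - a|^2, whose quadratic part is S S, linear part S a and constant |a|^2; the trace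
    enters because the mean of (z^T C z + v.z + k)^2 contains (k + tr C)^2. The obstacle is that no
    lower bound on the eigenvalues of Sigma_Y is given. If the right-hand side is at least 2,
    nothing is to be proved. Otherwise 80 |Sigma_X - Sigma_Y| < sqrt(l1 l2) <= l1; in the rotated
    frame this keeps the first diagonal entry of Sigma_Y comparable with l1, but does not compare
    the second one with l2. The planar determinant may thus vanish at the Y end of the path, where 1
    / sqrt det has an integrable singularity that the parametrization of the path absorbs. *)

Lemma mx11_dotE (R : comNzRingType) (n : nat) (u : 'rV[R]_n) :
  (u *m u^T) 0 0 = \sum_(i < n) u 0 i ^+ 2.
Proof. by rewrite mxE; apply: eq_bigr => i _; rewrite mxE expr2. Qed.

Lemma row_dot_ge0 (R : realDomainType) (n : nat) (u : 'rV[R]_n) :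
  0 <= (u *m u^T) 0 0.
Proof. by rewrite mx11_dotE sumr_ge0 // => i _; rewrite sqr_ge0. Qed.

Lemma row_dot_eq0 (R : realDomainType) (n : nat) (u : 'rV[R]_n) :
  ((u *m u^T) 0 0 == 0) = (u == 0).
Proof.
rewrite mx11_dotE psumr_eq0; last by move=> i _; rewrite sqr_ge0.
apply/allP/eqP => [h|-> i _]; last by rewrite mxE expr0n /=.
apply/rowP => i; rewrite mxE; apply/eqP.
by have := h i (mem_index_enum _); rewrite /= sqrf_eq0.
Qed.

Section SymmetricEigenvalue.
Import complex.

(** Over the complex numbers an eigenvector x + i y exists. By symmetry x A y^T = y A x^T, which
    reduces to im l * (|x|^2 + |y|^2) = 0. So [l] is real, and whichever of x, y is nonzero is a
    real eigenvector. *)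
Lemma symmetric_eigenvalue (R : rcfType) (n : nat) (A : 'M[R]_n.+1) :
  A^T = A -> exists l, eigenvalue A l.
Proof.
move=> symA.
pose toC : R -> R[i]%C := real_complex R.
pose AC := map_mx toC A.
have [l] : exists l, eigenvalue AC l.
  have /closed_rootP [l rl] : size (char_poly AC) != 1%N.
    by rewrite size_char_poly.
  by exists l; rewrite eigenvalue_root_char.
case/eigenvalueP => v vA v0.
pose re (z : R[i]%C) := complex.Re z.
pose im (z : R[i]%C) := complex.Im z.
pose x := map_mx re v; pose y := map_mx im v.
have reD z w : re (z + w) = re z + re w by case: z w => [? ?] [? ?].
have imD z w : im (z + w) = im z + im w by case: z w => [? ?] [? ?].
have xA : x *m A = re l *: x - im l *: y.
  apply/rowP => j; move/rowP/(_ j)/(congr1 re): vA.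
  rewrite !mxE (big_morph re reD (erefl 0 : re 0 = 0)) => h.
  transitivity (re (l * v 0 j)); last by case: (l) (v 0 j) => [? ?] [? ?].
  rewrite -h; apply: eq_bigr => i _; rewrite !mxE.
  by case: (v 0 i) => a b; rewrite /re /= mulr0 subr0.
have yA : y *m A = re l *: y + im l *: x.
  apply/rowP => j; move/rowP/(_ j)/(congr1 im): vA.
  rewrite !mxE (big_morph im imD (erefl 0 : im 0 = 0)) => h.
  transitivity (im (l * v 0 j)); last by case: (l) (v 0 j) => [? ?] [? ?].
  rewrite -h; apply: eq_bigr => i _; rewrite !mxE.
  by case: (v 0 i) => a b; rewrite /im /= mulr0 add0r mulrC.
have xy : (x *m y^T) 0 0 = (y *m x^T) 0 0.
  by rewrite !mxE; apply: eq_bigr => i _; rewrite !mxE mulrC.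
have iml : im l = 0.
  have sym : x *m A *m y^T = (y *m A *m x^T)^T.
    by rewrite !trmx_mul trmxK symA mulmxA.
  move/matrixP/(_ 0 0): sym; rewrite xA yA [RHS]mxE mulmxBl mulmxDl -!scalemxAl.
  rewrite 2!mxE [X in _ + X]mxE [in X in _ + X]mxE [RHS]mxE [X in _ = X + _]mxE [X in _ = _ + X]mxE xy.
  move=> h; have {h} : im l * ((x *m x^T) 0 0 + (y *m y^T) 0 0) = 0 by lra.
  move/eqP; rewrite mulf_eq0 => /orP[/eqP//|].
  rewrite paddr_eq0 ?row_dot_ge0 // !row_dot_eq0 => /andP[/eqP x0 /eqP y0].
  case/negP: v0; apply/eqP/rowP => i; rewrite mxE.
  move/rowP/(_ i): x0; move/rowP/(_ i): y0; rewrite !mxE /re /im.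
  by case: (v 0 i) => a b /= -> ->.
rewrite iml scale0r subr0 in xA; rewrite iml scale0r addr0 in yA.
exists (re l); apply/eigenvalueP.
have [x0|] := eqVneq x 0; last by exists x.
exists y => //; apply: contra v0 => /eqP y0; apply/eqP/rowP => i; rewrite mxE.
move/rowP/(_ i): x0; move/rowP/(_ i): y0; rewrite !mxE /re /im.
by case: (v 0 i) => a b /= -> ->.
Qed.

End SymmetricEigenvalue.

(* The Householder reflection exchanging [v] and the first basis vector. *)
Lemma orthogonal_completion (R : realFieldType) (n : nat) (v : 'rV[R]_n.+1) :
  v *m v^T = 1%:M -> exists U : 'M[R]_n.+1, U *m U^T = 1%:M /\ row 0 U = v.
Proof.
move=> vv; pose e : 'rV[R]_n.+1 := delta_mx 0 0.
have ee : e *m e^T = 1%:M.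
  by rewrite trmx_delta mul_delta_mx; apply/matrixP => i j; rewrite !mxE !ord1.
have ve : v *m e^T = (v 0 0)%:M.
  apply/matrixP => i j; rewrite !ord1 trmx_delta -colE !mxE eqxx mulr1n.
  by [].
have ev : e *m v^T = (v 0 0)%:M.
  by rewrite -[LHS]trmxK trmx_mul trmxK ve tr_scalar_mx.
pose w := v - e.
have [w0|w0] := eqVneq w 0.
  exists 1%:M; rewrite trmx1 mulmx1; split=> //.
  by rewrite row1; move/eqP: w0; rewrite subr_eq0 => /eqP.
have ww : w *m w^T = (2 - v 0 0 *+ 2)%:M.
  rewrite /w linearB /= mulmxBl !mulmxBr vv ee ve ev; apply/matrixP => i j.
  by rewrite !ord1 !mxE !eqxx !mulr1n; ring.
set k := 2 - v 0 0 *+ 2 in ww.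
have k0 : k != 0.
  by move: w0; rewrite -row_dot_eq0 ww !mxE eqxx mulr1n.
exists (1%:M - (2 / k) *: (w^T *m w)).
have tU : (1%:M - (2 / k) *: (w^T *m w))^T = 1%:M - (2 / k) *: (w^T *m w).
  by rewrite linearB linearZ /= trmx1 trmx_mul trmxK.
have sq : w^T *m w *m (w^T *m w) = k *: (w^T *m w).
  by rewrite mulmxA -(mulmxA w^T) ww mul_mx_scalar -scalemxAl.
split.
  rewrite tU; set P := w^T *m w in sq *; set c := 2 / k.
  rewrite mulmxBl mul1mx mulmxBr mulmx1 -scalemxAl -scalemxAr sq !scalerA.
  rewrite -addrA -[RHS]addr0; congr (_ + _).
  rewrite opprB addrC -scaleNr -!scalerDl -[RHS](scale0r P); congr (_ *: _).
  by rewrite /c; field.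
rewrite rowE mulmxBr mulmx1 -scalemxAr mulmxA -/e.
have -> : e *m w^T = (v 0 0 - 1)%:M.
  by rewrite /w linearB /= mulmxBr ev ee; apply/matrixP => i j; rewrite !ord1 !mxE eqxx.
rewrite mul_scalar_mx scalerA.
rewrite [X in X *: _](_ : _ = -1); last first.
  by rewrite mulrAC; apply: (canLR (mulfK k0)); rewrite /k; ring.
by rewrite scaleN1r opprK /w addrC subrK.
Qed.

(** The first row of [U] is the normalized eigenvector, which makes the first row of U A U^T equal
    to l times the first basis vector; symmetry then clears the first column. *)
Lemma symmetric_deflation (R : rcfType) (n : nat) (A : 'M[R]_n.+1) (l : R) :
  A^T = A -> eigenvalue A l -> exists U : 'M[R]_n.+1, exists A' : 'M[R]_n,
  [/\ U *m U^T = 1%:M, A'^T = A' &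
      U *m A *m U^T = block_mx (l%:M : 'M[R]_1) 0 0 A' :> 'M[R]_(1 + n)].
Proof.
move=> symA /eigenvalueP [v vA v0].
pose s := Num.sqrt ((v *m v^T) 0 0).
have s0 : s != 0.
  by rewrite gt_eqF // sqrtr_gt0 lt_neqAle eq_sym row_dot_eq0 v0 row_dot_ge0.
pose u := s^-1 *: v.
have uA : u *m A = l *: u by rewrite -scalemxAl vA !scalerA mulrC.
have uu : u *m u^T = 1%:M.
  rewrite linearZ /= -scalemxAl -scalemxAr scalerA; apply/matrixP => i j.
  rewrite !ord1 mxE -[X in _ * X]sqr_sqrtr ?row_dot_ge0 // -/s !mxE eqxx mulr1n.
  by field.
have [U [UU rU]] := orthogonal_completion uu.
have [B BE] : exists B : 'M[R]_(1 + n), B = U *m A *m U^T by exists (U *m A *m U^T).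
have symB : B^T = B by rewrite BE !trmx_mul trmxK symA mulmxA.
have rB : row 0 B = l *: delta_mx 0 0.
  by rewrite BE !row_mul rU uA -scalemxAl -rU -row_mul UU row1.
have B0 j : B 0 j = l *+ (j == 0).
  by move/rowP/(_ j): rB; rewrite !mxE eqxx => ->; rewrite mulr_natr.
have Bj j : B j 0 = l *+ (j == 0) by rewrite -B0 -{1}symB mxE.
exists U, (drsubmx B); split => //.
  by rewrite -{2}symB trmx_drsub.
rewrite -BE -[LHS](@submxK _ 1 n 1 n B); congr block_mx.
- by apply/matrixP => i j; rewrite !ord1 !mxE lshift0 B0 eqxx.
- apply/matrixP => i j; rewrite !ord1 !mxE lshift0 B0.
  by rewrite (_ : (_ == _) = false).
- apply/matrixP => i j; rewrite !ord1 !mxE lshift0 Bj.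
  by rewrite (_ : (_ == _) = false).
Qed.

(** Induction on the dimension by deflation: nonnegativity of the form passes to the corner [l] and
    to the block [A'], whose roots are put together and rotated back. *)
Lemma psd_sqrt_exists (R : rcfType) (n : nat) (A : 'M[R]_n) :
  A^T = A -> (forall u : 'cV[R]_n, 0 <= (u^T *m A *m u) 0 0) ->
  exists B : 'M[R]_n, [/\ B^T = B,
    forall u : 'cV[R]_n, 0 <= (u^T *m B *m u) 0 0 & B *m B = A].
Proof.
elim: n A => [|n IHn] A symA posA.
  exists 0; split; [by rewrite trmx0| |by rewrite mul0mx [A]flatmx0].
  by move=> u; rewrite mulmx0 mul0mx mxE.
have [l /(symmetric_deflation symA) [U [A' [UU symA' UAU]]]] :=
  symmetric_eigenvalue symA.
have UtU : U^T *m U = 1%:M by apply: mulmx1C.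
have quad (M : 'M[R]_1) (M' : 'M[R]_n) (x : 'cV_1) (y : 'cV_n) :
    (col_mx x y)^T *m block_mx M 0 0 M' *m col_mx x y =
    x^T *m M *m x + y^T *m M' *m y.
  by rewrite tr_col_mx mul_row_block !mulmx0 addr0 add0r mul_row_col.
have posb (x : 'cV_1) (y : 'cV_n) :
    0 <= ((col_mx x y)^T *m (block_mx (l%:M : 'M[R]_1) 0 0 A' : 'M[R]_(1 + n)) *m col_mx x y) 0 0.
  rewrite -UAU; have := posA (U^T *m col_mx x y).
  by rewrite trmx_mul trmxK !mulmxA.
have l0 : 0 <= l.
  have := posb 1%:M 0.
  by rewrite quad trmx1 mul1mx mulmx1 mulmx0 addr0 mxE eqxx mulr1n.
have [u|B' [symB' posB' BB']] := IHn A' symA'.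
  by have := posb 0 u; rewrite quad trmx0 !mul0mx add0r.
pose B : 'M[R]_(1 + n) := block_mx (Num.sqrt l)%:M 0 0 B'.
have symB : B^T = B by rewrite /B tr_block_mx !trmx0 tr_scalar_mx symB'.
exists (U^T *m B *m U); split.
- by rewrite !trmx_mul trmxK symB mulmxA.
- move=> u; rewrite !mulmxA -trmx_mul -mulmxA -(mulmxA _ B).
  rewrite mulmxA -[U *m u](@vsubmxK _ 1 n 1) /B quad mxE addr_ge0 //.
  rewrite mul_mx_scalar -scalemxAl mxE mulr_ge0 ?sqrtr_ge0 //.
  by have := row_dot_ge0 (usubmx (U *m u : 'cV_(1 + n)))^T; rewrite trmxK.
- rewrite !mulmxA -(mulmxA _ U) UU mulmx1 -(mulmxA _ B B).
  rewrite /B mulmx_block !mulmx0 !mul0mx !addr0 add0r -scalar_mxM -expr2.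
  rewrite sqr_sqrtr // BB' -UAU !mulmxA UtU mul1mx -mulmxA UtU mulmx1.
  by [].
Qed.

Lemma char_poly_orthogonal (R : comUnitRingType) (n : nat) (U A : 'M[R]_n) :
  U *m U^T = 1%:M -> char_poly (U *m A *m U^T) = char_poly A.
Proof.
move=> UU; rewrite /char_poly /char_poly_mx !map_mxM.
set V := map_mx _ U; set V' := map_mx _ U^T.
have VV : V *m V' = 1%:M by rewrite -map_mxM UU map_mx1.
have -> : 'X%:M - V *m map_mx polyC A *m V' = V *m ('X%:M - map_mx polyC A) *m V'.
  by rewrite mulmxBr mulmxBl mul_mx_scalar -scalemxAl VV scalemx1.
by rewrite !det_mulmx mulrAC -det_mulmx VV det1 mul1r.
Qed.

Lemma char_poly_diag_block (R : comUnitRingType) (n : nat) (l : R) (A : 'M[R]_n) :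
  char_poly (block_mx (l%:M : 'M[R]_1) 0 0 A : 'M[R]_(1 + n)) = ('X - l%:P) * char_poly A.
Proof.
rewrite /char_poly /char_poly_mx map_block_mx !map_mx0 map_scalar_mx scalar_mx_block.
by rewrite opp_block_mx add_block_mx !oppr0 !addr0 det_ublock -raddfB /= det_scalar1.
Qed.

Lemma block_entry00 (R : nmodType) (p : nat) (a : 'M[R]_1) b c (d : 'M[R]_p) :
  (block_mx a b c d : 'M[R]_p.+1) 0 0 = a 0 0.
Proof.
by rewrite -(block_mxEul a b c d); congr (block_mx _ _ _ _ _ _); exact: val_inj.
Qed.

Lemma block_entry01 (R : nmodType) (p : nat) (a : 'M[R]_1) b c (d : 'M[R]_p.+1) :
  (block_mx a b c d : 'M[R]_p.+2) 0 1 = b 0 0.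
Proof.
by rewrite -(block_mxEur a b c d); congr (block_mx _ _ _ _ _ _); exact: val_inj.
Qed.

Lemma block_entry11 (R : nmodType) (p : nat) (a : 'M[R]_1) b c (d : 'M[R]_p.+1) :
  (block_mx a b c d : 'M[R]_p.+2) 1 1 = d 0 0.
Proof.
by rewrite -(block_mxEdr a b c d); congr (block_mx _ _ _ _ _ _); exact: val_inj.
Qed.

(** Two deflations suffice, since only the top corner has to be diagonal. The factor X - l1 is
    cancelled from the characteristic polynomial before [l2] is looked for in the remaining block,
    so multiplicities are respected and l1 = l2 is allowed. *)
Lemma top_corner_diag (R : rcfType) (m : nat) (A : 'M[R]_m.+2) (l1 l2 : R) (s : seq R) :
  A^T = A -> char_poly A = \prod_(x <- [:: l1, l2 & s]) ('X - x%:P) ->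
  exists U : 'M[R]_m.+2, [/\ U *m U^T = 1%:M,
    (U *m A *m U^T) 0 0 = l1, (U *m A *m U^T) 0 1 = 0 & (U *m A *m U^T) 1 1 = l2].
Proof.
move=> symA charA.
have [|U1 [A' [UU1 symA' UAU1]]] := @symmetric_deflation R m.+1 A l1 symA.
  by rewrite eigenvalue_root_char charA big_cons rootM root_XsubC eqxx.
have charA' : char_poly A' = \prod_(x <- l2 :: s) ('X - x%:P).
  apply: (mulfI (negbT (polyXsubC_eq0 l1))).
  by rewrite -char_poly_diag_block -UAU1 char_poly_orthogonal // charA big_cons.
have [|U2 [A'' [UU2 symA'' UAU2]]] := @symmetric_deflation R m A' l2 symA'.
  by rewrite eigenvalue_root_char charA' big_cons rootM root_XsubC eqxx.
pose V : 'M[R]_(1 + m.+1) := block_mx 1%:M 0 0 U2.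
have VV : V *m V^T = 1%:M.
  rewrite /V tr_block_mx !trmx0 mulmx_block !mulmx0 !mul0mx !addr0 add0r UU2.
  by rewrite trmx1 mulmx1 -scalar_mx_block.
have E : (V *m U1) *m A *m (V *m U1)^T =
    block_mx (l1%:M : 'M[R]_1) 0 0 (block_mx (l2%:M : 'M[R]_1) 0 0 A'' : 'M[R]_(1 + m)).
  rewrite trmx_mul !mulmxA -(mulmxA V) -(mulmxA V) UAU1 /V tr_block_mx !trmx0 trmx1.
  by rewrite !(mulmx_block, mulmx0, mul0mx, addr0, add0r, mul1mx, mulmx1) UAU2.
exists (V *m U1); split.
- by rewrite trmx_mul mulmxA -(mulmxA V) UU1 mulmx1.
- by rewrite E block_entry00 mxE eqxx mulr1n.
- by rewrite E block_entry01 mxE.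
- by rewrite E block_entry11 block_entry00 mxE eqxx mulr1n.
Qed.

(** * Bernstein polynomials *)

(* Bernstein polynomials by recursion: evaluated at [x], [bernstein_rec n phi]
   is the mean of [phi] at the number of successes in [n] Bernoulli trials of
   parameter [x]. *)
Fixpoint bernstein_rec (R : comNzRingType) (n : nat) (phi : nat -> R) : {poly R} :=
  if n is m.+1 then
    'X * bernstein_rec m (phi \o S) + (1 - 'X) * bernstein_rec m phi
  else (phi 0)%:P.

(** The right-hand side is the mean of a + b (K - c)^2 for K binomial, of mean n x and variance n x
    (1 - x). The centre [c] is arbitrary so that the induction goes through: a first success shifts
    it to c - 1. *)
Lemma bernstein_rec_dist (R : realDomainType) (n : nat) (phi : nat -> R)
    (v c a b x : R) : 0 <= x <= 1 ->
  (forall k, `|phi k - v| <= a + b * (k%:R - c) ^+ 2) ->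
  `|(bernstein_rec n phi).[x] - v|
    <= a + b * ((n%:R * x - c) ^+ 2 + n%:R * x * (1 - x)).
Proof.
move=> /andP[x0 x1]; elim: n phi c => [|n IHn] phi c hphi.
  by rewrite hornerC; have := hphi 0%N; rewrite !mul0r addr0.
have h1 := IHn (phi \o S) (c - 1).
have {h1} h1 : `|(bernstein_rec n (phi \o S)).[x] - v| <=
    a + b * ((n%:R * x - (c - 1)) ^+ 2 + n%:R * x * (1 - x)).
  apply: h1 => k; apply: le_trans (hphi k.+1) _.
  by rewrite -natr1 opprB addrA.
have h2 := IHn phi c hphi.
rewrite /= !(hornerE).
have -> : x * (bernstein_rec n (phi \o S)).[x] + (1 - x) * (bernstein_rec n phi).[x] - v
  = x * ((bernstein_rec n (phi \o S)).[x] - v) + (1 - x) * ((bernstein_rec n phi).[x] - v).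
  by ring.
apply: le_trans (ler_normD _ _) _.
rewrite !normrM (ger0_norm x0) (@ger0_norm _ (1 - x)) ?subr_ge0 //.
apply: le_trans (lerD (ler_wpM2l x0 h1) (ler_wpM2l _ h2)) _; first by rewrite subr_ge0.
rewrite le_eqVlt; apply/orP; left; apply/eqP; rewrite -natr1; ring.
Qed.

Definition bernstein (R : fieldType) (g : R -> R) (n : nat) : {poly R} :=
  bernstein_rec n (fun k => g (k%:R / n%:R)).

Lemma bernstein_le1 (R : realFieldType) (g : R -> R) (n : nat) (x : R) :
  0 <= x <= 1 -> (forall t, `|g t| <= 1) -> `|(bernstein g n).[x]| <= 1.
Proof.
move=> x01 g1; have := @bernstein_rec_dist _ n (fun k => g (k%:R / n%:R)) 0 0 1 0 x x01.
by rewrite !mul0r addr0 subr0; apply => k; rewrite mul0r addr0 subr0.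
Qed.

Lemma bernstein_cvg (R : realType) (g : R -> R) (x : R) :
  0 <= x <= 1 -> (forall t, `|g t| <= 1) -> {for x, continuous g} ->
  (bernstein g n).[x] @[n --> \oo] --> g x.
Proof.
move=> x01 g1 gx; apply/cvgrPdist_le => e e0.
have e2 : 0 < e / 2 by rewrite divr_gt0.
move/cvgrPdist_lt : gx => /(_ _ e2) [d /= d0 gd].
have [N hN] : exists N, 2 / d ^+ 2 / (e / 2) < N%:R.
  exists (Num.bound (2 / d ^+ 2 / (e / 2))); apply: archi_boundP.
  by rewrite ?(divr_ge0, sqr_ge0, ler0n, ltW e0).
exists N.+1 => // n /= Nn.
have n0 : 0 < n%:R :> R by rewrite ltr0n (leq_trans _ Nn).
rewrite distrC.
(* Within [d] of [x] the error is at most e / 2; farther away it is at most 2, hence at most 2 (k /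
   n - x)^2 / d^2. Centring at n x leaves the variance term, of order 1 / n. *)
apply: le_trans (@bernstein_rec_dist _ n _ (g x) (n%:R * x) (e / 2)
   (2 / d ^+ 2 / n%:R ^+ 2) x x01 _) _.
  move=> k; have [kx|kx] := ltP `|x - k%:R / n%:R| d.
    have := gd _ kx; rewrite /= distrC => /ltW/le_trans; apply.
    by rewrite lerDl mulr_ge0 ?sqr_ge0 // !divr_ge0 // ?sqr_ge0.
  have dk : d ^+ 2 <= (k%:R / n%:R - x) ^+ 2.
    by rewrite -(real_normK (num_real (_ - x))) distrC ler_sqr ?nnegrE ?normr_ge0 ?(ltW d0).
  apply: (@le_trans _ _ 2).
    by apply: le_trans (ler_normB _ _) _; rewrite -[2]/(1 + 1) lerD.
  have -> : 2 / d ^+ 2 / n%:R ^+ 2 * (k%:R - n%:R * x) ^+ 2 =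
      2 * ((k%:R / n%:R - x) ^+ 2 / d ^+ 2).
    by field; rewrite (gt_eqF n0) (gt_eqF d0).
  rewrite -[leLHS]add0r lerD ?(ltW e2) // ler_peMr // ler_pdivlMr ?exprn_gt0 //.
  by rewrite mul1r.
rewrite subrr expr0n add0r [leRHS]splitr lerD2l.
have -> : 2 / d ^+ 2 / n%:R ^+ 2 * (n%:R * x * (1 - x)) =
  2 / d ^+ 2 * (x * (1 - x)) / n%:R.
  by field; rewrite (gt_eqF n0) (gt_eqF d0).
rewrite ler_pdivrMr //.
have h1 : 2 / d ^+ 2 * (x * (1 - x)) <= 2 / d ^+ 2.
  case/andP: x01 => x0 x1; rewrite ler_piMr ?divr_ge0 ?sqr_ge0 //.
  by rewrite mulr_ile1 ?subr_ge0 // lerBlDr lerDl.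
apply: le_trans h1 _; rewrite -ler_pdivrMl // mulrC.
by apply: le_trans (ltW hN) _; rewrite ler_nat ltnW.
Qed.

(** * Integration *)

Section Affine.
Context {R : realType}.
Local Notation mu := (@lebesgue_measure R).
Local Open Scope ereal_scope.

Let aff (c k : R) : measurableTypeR R -> measurableTypeR R := fun x => (c + k * x)%R.

Let maff c k : measurable_fun setT (aff c k).
Proof. by apply: measurable_funD => //; apply: measurable_funM. Qed.

Let aff_measure c k : {measure set (measurableTypeR R) -> \bar R} :=
  measure_function_pushforward__canonical__measure_function_Measure mu (maff c k).

(** Lebesgue measure is characterized by its values on half-open intervals, so the scaled image
    measure only has to be computed there. *)
Let affine_measure_gt0 (c k : R) (k0 : (0 < k)%R) (A : set R) : measurable A ->
  mu A = mscale (NngNum (ltW k0)) (aff_measure c k) A.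
Proof.
move=> mA; apply: lebesgue_measure_unique => //= _ [[a b]] _ <-.
rewrite /mscale /= /pushforward.
have -> : aff c k @^-1` `]a, b]%classic = `]((a - c) / k)%R, ((b - c) / k)%R]%classic.
  by apply/seteqP; split=> x /=; rewrite !in_itv /= ltr_pdivrMr // ler_pdivlMr // ltrBlDl lerBrDl mulrC.
rewrite !lebesgue_measure_itv /= !lte_fin ltr_pM2r ?invr_gt0 // ltrD2r.
by case: ifP; rewrite ?mule0 // -!EFinD -EFinM => _; congr EFin; field; rewrite gt_eqF.
Qed.

Lemma ge0_integral_affine (c k : R) (f : R -> \bar R) : k != 0%R ->
  measurable_fun setT f -> (forall x, 0 <= f x) ->
  \int[mu]_x f x = \int[mu]_x (f (c + k * x)%R * `|k|%:E).
Proof.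
move=> k0 mf f0.
have pos (c' k' : R) (g : R -> \bar R) : (0 < k')%R -> measurable_fun setT g ->
    (forall x, 0 <= g x) -> \int[mu]_x g x = k'%:E * \int[mu]_x g (c' + k' * x)%R.
  move=> k'0 mg g0.
  rewrite (eq_measure_integral (mscale (NngNum (ltW k'0)) (aff_measure c' k'))); last first.
    by move=> A mA _; exact: affine_measure_gt0.
  rewrite ge0_integral_mscale //; congr *%E.
  by rewrite (ge0_integral_pushforward (maff c' k')).
have mfa (c' k' : R) : measurable_fun setT (fun x => f (c' + k' * x)%R).
  by apply: (measurableT_comp mf); exact: maff.
rewrite ge0_integralZr //=; last exact: mfa.
case: (ltgtP 0%R k) k0 => // [k_gt0|k_lt0] _; first by rewrite muleC gtr0_norm // -pos.
rewrite ltr0_norm // muleC (pos c (- k)%R) ?oppr_gt0 //; congr *%E.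
have -> : \int[mu]_x f (c + - k * x)%R = \int[pushforward mu (-%R : R -> measurableTypeR R)]_x f (c + - k * x)%R.
  by apply: eq_measure_integral => A mA _; exact/esym/lebesgue_measureN.
rewrite ge0_integral_pushforward //=; last exact: mfa.
by apply: eq_integral => x _ /=; rewrite mulNr mulrN opprK.
Qed.
End Affine.

Section IntegralEpsilon.
Local Open Scope ereal_scope.

Lemma funeposMr (R : realType) (T : Type) (f : T -> \bar R) (g : T -> R) :
  (forall x, 0 <= g x)%R ->
  (fun x => f x * (g x)%:E)^\+ = (fun x => f^\+ x * (g x)%:E).
Proof.
by move=> g0; apply/funext => x; rewrite !funeposE muleC [RHS]muleC maxe_pMr ?mule0 ?lee_fin.
Qed.

Lemma funenegMr (R : realType) (T : Type) (f : T -> \bar R) (g : T -> R) :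
  (forall x, 0 <= g x)%R ->
  (fun x => f x * (g x)%:E)^\- = (fun x => f^\- x * (g x)%:E).
Proof.
by move=> g0; apply/funext => x; rewrite !funenegE -mulNe muleC [RHS]muleC maxe_pMr ?mule0 ?lee_fin.
Qed.

(** The Radon-Nikodym derivative and the explicit density have the same integral over every
    measurable set, hence agree almost everywhere. *)
Lemma ge0_integral_normal_prob (R : realType) (m s : R) (f : R -> \bar R) :
  measurable_fun setT f -> (forall x, 0 <= f x) ->
  \int[normal_prob m s]_x f x =
  \int[@lebesgue_measure R]_x (f x * (normal_pdf m s x)%:E).
Proof.
move=> mf f0; have dom := normal_prob_dominates m s.
rewrite -(Radon_Nikodym_SigmaFinite.change_of_variables dom) //.
apply: ae_eq_integral => //.
- apply: emeasurable_funM => //; apply: measurable_int.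
  exact: (Radon_Nikodym_SigmaFinite.f_integrable dom).
- apply: emeasurable_funM => //; apply/measurable_EFinP.
  exact: measurable_normal_pdf.
apply: ae_eqe_mul2l; apply: integral_ae_eq => //.
- exact: (Radon_Nikodym_SigmaFinite.f_integrable dom).
- by apply/measurable_EFinP; exact: measurable_normal_pdf.
- by move=> A AT mA; rewrite -(Radon_Nikodym_SigmaFinite.f_integral dom).
Qed.

Lemma integral_normal_prob (R : realType) (m s : R) (f : R -> \bar R) :
  measurable_fun setT f ->
  \int[normal_prob m s]_x f x =
  \int[@lebesgue_measure R]_x (f x * (normal_pdf m s x)%:E).
Proof.
move=> mf; rewrite integralE [RHS]integralE funeposMr ?funenegMr; last 2 first.
- by move=> x; exact: normal_pdf_ge0.
- by move=> x; exact: normal_pdf_ge0.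
by rewrite !ge0_integral_normal_prob //;
  first [exact: measurable_funepos | exact: measurable_funeneg].
Qed.

Lemma integrable_normal_prob (R : realType) (m s : R) (f : R -> \bar R) :
  measurable_fun setT f ->
  (@lebesgue_measure R).-integrable setT (fun x => f x * (normal_pdf m s x)%:E) ->
  (normal_prob m s).-integrable setT f.
Proof.
move=> mf /integrableP[_ h]; apply/integrableP; split => //.
rewrite ge0_integral_normal_prob //; last exact: measurableT_comp.
under eq_integral => x _ do rewrite -[(normal_pdf _ _ _)%:E]gee0_abs ?lee_fin ?normal_pdf_ge0 // -abseM.
by [].
Qed.

End IntegralEpsilon.

Section RealIntegrable.
Context {R : realType} {d : measure_display} {T : measurableType d}.
Variable mu : {measure set T -> \bar R}.
Implicit Types f g : T -> R.

Lemma integrable_mulrl (k : R) f : mu.-integrable setT (EFin \o f) ->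
  mu.-integrable setT (EFin \o (fun x => k * f x)).
Proof. exact: (@integrableZl _ _ _ mu setT measurableT k (EFin \o f)). Qed.

Lemma integrable_addr f g : mu.-integrable setT (EFin \o f) ->
  mu.-integrable setT (EFin \o g) ->
  mu.-integrable setT (EFin \o (fun x => f x + g x)).
Proof. exact: (@integrableD _ _ _ mu setT measurableT (EFin \o f) (EFin \o g)). Qed.

Lemma integrable_subr f g : mu.-integrable setT (EFin \o f) ->
  mu.-integrable setT (EFin \o g) ->
  mu.-integrable setT (EFin \o (fun x => f x - g x)).
Proof. exact: (@integrableB _ _ _ mu setT measurableT (EFin \o f) (EFin \o g)). Qed.

Lemma le_integrable_real f g : measurable_fun setT f ->
  (forall x, `|f x| <= g x) -> mu.-integrable setT (EFin \o g) ->
  mu.-integrable setT (EFin \o f).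
Proof.
move=> mf fg; apply: le_integrable => //; first exact/measurable_EFinP.
by move=> x _; rewrite lee_fin (le_trans (fg x)) // ler_norm.
Qed.

Lemma integrable_real_measurable f : mu.-integrable setT (EFin \o f) ->
  measurable_fun setT f.
Proof. by move=> /measurable_int/measurable_EFinP. Qed.

Lemma integrable_sum_real (I : Type) (s : seq I) (f : I -> T -> R) :
  (forall i, mu.-integrable setT (EFin \o f i)) ->
  mu.-integrable setT (EFin \o (fun x => \sum_(i <- s) f i x)).
Proof.
move=> intf; elim: s => [|i s IHs].
  by under [X in EFin \o X]eq_fun do rewrite big_nil; exact: integrable0.
by under [X in EFin \o X]eq_fun do rewrite big_cons; exact: integrable_addr.
Qed.

Lemma Rintegral_sum (I : Type) (s : seq I) (f : I -> T -> R) :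
  (forall i, mu.-integrable setT (EFin \o f i)) ->
  \int[mu]_x (\sum_(i <- s) f i x) = \sum_(i <- s) \int[mu]_x f i x.
Proof.
move=> intf; elim: s => [|i s IHs].
  by rewrite big_nil /Rintegral; under eq_integral do rewrite big_nil; rewrite integral0.
rewrite big_cons -IHs -RintegralD //; last exact: integrable_sum_real.
by apply: eq_Rintegral => x _; rewrite big_cons.
Qed.

End RealIntegrable.

Lemma Rintegral_dominated_cvg (R : realType) (d : measure_display) (T : measurableType d)
    (mu : {measure set T -> \bar R}) (f_ : nat -> T -> R) (f g : T -> R) :
  (forall n, measurable_fun setT (f_ n)) ->
  (forall x, f_ n x @[n --> \oo] --> f x) ->
  mu.-integrable setT (EFin \o g) -> (forall n x, `|f_ n x| <= g x) ->
  \int[mu]_x f_ n x @[n --> \oo] --> \int[mu]_x f x.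
Proof.
move=> mf_ cf intg fg.
have mf : measurable_fun setT (EFin \o f).
  apply: (@emeasurable_fun_cvg _ _ _ setT (fun n x => (f_ n x)%:E)).
    by move=> n; apply/measurable_EFinP; exact: mf_.
  by move=> x _; apply: cvg_EFin; [exact: nearW|exact: cf].
have intf : mu.-integrable setT (EFin \o f).
  apply: le_integrable intg => //= x _; rewrite lee_fin.
  have fgx : `|f x| <= g x.
    by apply: (cvgr_to_le (cvg_norm (cf x))); apply: nearW => n; exact: fg.
  by rewrite (le_trans fgx) // ler_norm.
have H := @dominated_cvg _ _ _ mu setT measurableT (fun n x => (f_ n x)%:E) (EFin \o f) (EFin \o g).
apply: (@fine_cvg R _ _ _ (fun n => \int[mu]_x (f_ n x)%:E)%E).
rewrite /Rintegral fineK; last exact: (integrable_fin_num measurableT intf).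
apply: H => //.
- by move=> n; apply/measurable_EFinP; exact: mf_.
- by move=> x _; apply: cvg_EFin; [exact: nearW|exact: cf].
- by move=> n x _; rewrite lee_fin fg.
Qed.

(** * Integration by parts and improper integrals on the real line *)

Section RealLineCalculus.
Context {R : realType}.
Local Notation mu := (@lebesgue_measure R).
Implicit Types f g F G h H : R -> R.

Lemma Rintegral_itv_FTC (G g : R -> R) (a b : R) : a <= b ->
  (forall x, is_derive x (1 : R) G (g x)) -> continuous g ->
  \int[mu]_(x in `[a, b]) g x = G b - G a.
Proof.
rewrite le_eqVlt => /predU1P[<-|ab] dG cg.
  by rewrite set_itv1 Rintegral_set1 subrr.
have cG : continuous G.
  move=> x; apply: differentiable_continuous; apply/derivable1_diffP.
  by have [] := dG x.
rewrite /Rintegral (@continuous_FTC2 _ g G) //.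
- by move=> x; apply: continuous_subspaceT.
- split; first by move=> x _; have [] := dG x.
  - by apply: cvg_at_right_filter; exact: cG.
  - by apply: cvg_at_left_filter; exact: cG.
- by move=> x _; rewrite derive1E; have [] := dG x.
Qed.

Lemma continuous_itv_integrable (f : R -> R) (a b : R) : continuous f ->
  mu.-integrable `[a, b] (EFin \o f).
Proof.
move=> cf; apply: continuous_compact_integrable; first exact: segment_compact.
exact: continuous_subspaceT.
Qed.

Lemma Rintegral_parts_le (F f H h : R -> R) (a b : R) : a <= b ->
  (forall x, is_derive x (1 : R) F (f x)) -> continuous f ->
  (forall x, is_derive x (1 : R) H (h x)) -> continuous h ->
  `|\int[mu]_(x in `[a, b]) (f x * H x)| <=
    `|F b * H b - F a * H a| + \int[mu]_(x in `[a, b]) `|F x * h x|.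
Proof.
move=> ab dF cf dH ch.
have cF : continuous F.
  by move=> x; apply: differentiable_continuous; apply/derivable1_diffP; have [] := dF x.
have cH : continuous H.
  by move=> x; apply: differentiable_continuous; apply/derivable1_diffP; have [] := dH x.
have cfH : continuous (fun x => f x * H x) by move=> x; apply: cvgM; [exact: cf|exact: cH].
have cFh : continuous (fun x => F x * h x) by move=> x; apply: cvgM; [exact: cF|exact: ch].
have dFH x : is_derive x (1 : R) (F * H) (f x * H x + F x * h x).
  by apply: is_derive_eq; rewrite /GRing.scale /=; ring.
have := @Rintegral_itv_FTC (F * H) (fun x => f x * H x + F x * h x) a b ab dFH.
rewrite RintegralD //; try exact: continuous_itv_integrable.
move=> E; have {E} E : \int[mu]_(x in `[a, b]) (f x * H x) =
    (F b * H b - F a * H a) - \int[mu]_(x in `[a, b]) (F x * h x).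
  apply/eqP; rewrite -subr_eq opprK; apply/eqP; apply: E.
  by move=> x; apply: cvgD; [exact: cfH|exact: cFh].
rewrite E (le_trans (ler_normB _ _)) // lerD2l le_normr_Rintegral //.
exact: continuous_itv_integrable.
Qed.

Lemma cvg_Rintegral_itv (f : R -> R) : mu.-integrable setT (EFin \o f) ->
  \int[mu]_(x in `[- n%:R, n%:R]) f x @[n --> \oo] --> \int[mu]_x f x.
Proof.
move=> intf; have mf : measurable_fun setT f by apply/measurable_EFinP; exact: measurable_int intf.
under eq_fun do rewrite Rintegral_mkcond.
have H := (@Rintegral_dominated_cvg _ _ _ mu (fun n : nat => f \_ `[- n%:R, n%:R]) f (fun x => `|f x|)). apply: H => //.
- by move=> n; apply/(measurable_restrictT _ _).1 => //; apply: measurable_funTS; exact: mf.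
- move=> x; apply: cvg_near_cst.
  exists (Num.bound `|x|) => // n /= hn; rewrite patchE mem_set //=.
  rewrite in_itv /= -ler_norml.
  by apply: le_trans (ltW (archi_boundP (normr_ge0 x))) _; rewrite ler_nat.
- exact: integrable_norm.
- move=> n x; rewrite patchE; case: ifP => // _.
  by rewrite normr0.
Qed.

Lemma Rintegral_norm_le_itv (f : R -> R) (B : R) : mu.-integrable setT (EFin \o f) ->
  (forall n, `|\int[mu]_(x in `[- n%:R, n%:R]) f x| <= B) ->
  `|\int[mu]_x f x| <= B.
Proof.
move=> intf hB; apply: (cvgr_to_le (cvg_norm (cvg_Rintegral_itv intf))).
exact: nearW.
Qed.

(** The integral over [-n, n] is G n - G (-n), of size at most 2 C / n. *)
Lemma Rintegral_derive_eq0 (G g : R -> R) (C : R) :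
  (forall x, is_derive x (1 : R) G (g x)) -> continuous g ->
  mu.-integrable setT (EFin \o g) ->
  (forall x, `|x| * `|G x| <= C) ->
  \int[mu]_x g x = 0.
Proof.
move=> dG cg intg hC.
apply: (cvg_unique _ (cvg_Rintegral_itv intg)) => //.
apply/cvgrPdist_le => e e0.
have C0 : 0 <= C by apply: le_trans (hC 0); rewrite normr0 mul0r.
exists (Num.bound (2 * C / e)).+1 => // n /= hn.
have n0 : 0 < n%:R :> R by rewrite ltr0n (leq_trans _ hn).
rewrite (Rintegral_itv_FTC _ dG cg); last by rewrite lerNl (le_trans _ (ltW n0)) // oppr_le0 ltW.
rewrite sub0r normrN (le_trans (ler_normB _ _)) //.
have b1 := hC n%:R; have b2 := hC (- n%:R).
rewrite normrN (gtr0_norm n0) in b1 b2.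
rewrite -(ler_pM2l n0) mulrDr (le_trans (lerD b1 b2)) //.
rewrite -mulr2n -[C *+ 2]mulr_natl -ler_pdivrMr //.
have Ce0 : 0 <= 2 * C / e by rewrite divr_ge0 ?mulr_ge0 ?(ltW e0).
apply: le_trans (ltW (archi_boundP Ce0)) _.
by rewrite ler_nat ltnW.
Qed.

End RealLineCalculus.

(** * Gaussian vectors *)

Lemma is_derive_continuous (R : realType) (f g : R -> R) :
  (forall x, is_derive x (1 : R) f (g x)) -> continuous f.
Proof.
move=> df x; apply: differentiable_continuous; apply/derivable1_diffP.
by have [] := df x.
Qed.

(** * The one-dimensional standard normal law: density bounds, moments, characteristic function *)

Section StandardNormal.
Context {R : realType}.
Local Notation mu := (@lebesgue_measure R).
Local Notation rho := (@normal_pdf R 0 1).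
Local Notation peak := (@normal_peak R 1).
Implicit Types x u c : R.

Lemma std_normal_pdfE x : rho x = peak * expR (- (x ^+ 2 / 2)).
Proof. by rewrite normal_pdfE ?oner_neq0 // /normal_fun subr0 expr1n mulNr. Qed.

Lemma std_peak_gt0 : 0 < peak. Proof. by rewrite normal_peak_gt0 ?oner_neq0. Qed.

Lemma std_peak_sqr : pi * peak ^+ 2 = 2^-1.
Proof.
have p0 : 0 < (pi : R) by exact: pi_gt0.
have p2 : 0 <= (pi : R) *+ 2 by rewrite mulrn_wge0 // ltW.
rewrite /normal_peak expr1n mul1r exprVn (sqr_sqrtr p2).
by rewrite -[pi *+ 2]mulr_natr invfM mulrA divff ?mul1r ?gt_eqF.
Qed.

Lemma std_normal_pdf_ge0 x : 0 <= rho x. Proof. exact: normal_pdf_ge0. Qed.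

Lemma std_normal_pdf_le x : rho x <= peak.
Proof. by apply: normal_pdf_ub; rewrite oner_neq0. Qed.

Lemma mulx_std_normal_pdf_le x : `|x| * rho x <= peak.
Proof.
rewrite std_normal_pdfE mulrCA ler_piMr ?(ltW std_peak_gt0) // expRN.
rewrite ler_pdivrMr ?expR_gt0 // mul1r.
apply: le_trans (expR_ge1Dx _); rewrite -subr_ge0.
rewrite -[x ^+ 2]real_normK ?num_real //.
have := sqr_ge0 (`|x| - 1); nra.
Qed.

Lemma mulx4_std_normal_pdf_le x : x ^+ 4 * rho x <= 8 * peak.
Proof.
rewrite std_normal_pdfE mulrCA [leRHS]mulrC ler_wpM2l ?(ltW std_peak_gt0) // expRN.
rewrite ler_pdivrMr ?expR_gt0 //.
have y0 : 0 <= x ^+ 2 / 2 by rewrite divr_ge0 ?sqr_ge0.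
have := expR_ge1Dxn 1 y0; rewrite /=; set e := expR _.
rewrite (_ : 2`! = 2)%N // => h; have : x ^+ 4 = 4 * (x ^+ 2 / 2) ^+ 2 by field.
nra.
Qed.

(** The constant is the same as for the powers 0 and 1, because exp(x^2 / 2) = exp(x^2 / 4)^2 >= (1
    + x^2 / 4)^2 >= x^2. *)
Lemma mulx2_std_normal_pdf_le x : x ^+ 2 * rho x <= peak.
Proof.
rewrite std_normal_pdfE mulrCA ler_piMr ?(ltW std_peak_gt0) // expRN.
rewrite ler_pdivrMr ?expR_gt0 // mul1r.
have -> : x ^+ 2 / 2 = 2%:R * (x ^+ 2 / 4) by field.
rewrite expRM_natl.
have y0 : 0 <= x ^+ 2 / 4 by rewrite divr_ge0 ?sqr_ge0.
have := expR_ge1Dx (x ^+ 2 / 4); set e := expR _ => h.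
have := sqr_ge0 (1 - x ^+ 2 / 4); nra.
Qed.

Lemma is_derive_std_normal_pdf x : is_derive x (1 : R) rho (- (x * rho x)).
Proof.
have -> : rho = cst peak * (expR \o (- (id ^+ 2 * cst (2^-1)))).
  by apply/funext => y; rewrite std_normal_pdfE.
apply: is_derive_eq; rewrite /GRing.scale /= /cst !fctE /=.
by field.
Qed.

Lemma continuous_std_normal_pdf : continuous rho.
Proof. by apply: continuous_normal_pdf; rewrite oner_neq0. Qed.

(** Completing the square: the tilted density is exp(1/2) times the normal density centred at s,
    where s is 1 or -1. *)
Lemma integrable_std_normal_pdf_exp (s : R) : s ^+ 2 = 1 ->
  mu.-integrable setT (EFin \o (fun x => expR (s * x) * rho x)).
Proof.
move=> s1.
have -> : (fun x => expR (s * x) * rho x) = (fun x => expR (2^-1) * normal_pdf s 1 x).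
  apply/funext => x; rewrite std_normal_pdfE normal_pdfE ?oner_neq0 // /normal_fun expr1n.
  rewrite mulrCA [RHS]mulrCA; congr (_ * _); rewrite -!expRD; congr expR.
  by rewrite sqrrB s1 -mulr_natl; field.
by apply: integrable_mulrl; exact: integrable_normal_pdf.
Qed.

(** Since x^4 / 24 + 1 <= exp(x) + exp(-x), quartic growth is dominated by the two exponential
    tilts; the factor 25 turns this into a bound of 1 + x^4. *)
Lemma integrable_std_normal_pdf_poly (f : R -> R) (C : R) :
  measurable_fun setT f -> (forall x, `|f x| <= C * (1 + x ^+ 4)) ->
  mu.-integrable setT (EFin \o (fun x => f x * rho x)).
Proof.
move=> mf hf.
have C0 : 0 <= C by have := hf 0; rewrite expr0n addr0 mulr1; exact: le_trans.
apply: (@le_integrable_real _ _ _ mu _ (fun x =>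
    (C * 25) * (expR (1 * x) * rho x) + (C * 25) * (expR (-1 * x) * rho x))).
- by apply: measurable_funM => //; exact: measurable_normal_pdf.
- move=> x; rewrite normrM (ger0_norm (std_normal_pdf_ge0 x)).
  rewrite !mulrA -mulrDl ler_wpM2r ?std_normal_pdf_ge0 //.
  apply: le_trans (hf x) _; rewrite -mulrDr -mulrA ler_wpM2l // mul1r mulN1r.
  have h4 : x ^+ 4 / 24 + 1 <= expR x + expR (- x).
    have [x0|x0] := leP 0 x.
      have := expR_ge1Dxn 3 x0; rewrite (_ : 4`! = 24)%N //; have := expR_ge0 (- x); lra.
    have x0' : 0 <= - x by rewrite oppr_ge0 ltW.
    have := expR_ge1Dxn 3 x0'; rewrite (_ : 4`! = 24)%N //; have := expR_ge0 x.
    have -> : (- x) ^+ 4 = x ^+ 4 by ring.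
    lra.
  have := expR_ge0 x; have := expR_ge0 (- x); have : 0 <= x ^+ 4 by rewrite exprn_even_ge0.
  lra.
- have h s : s ^+ 2 = 1 -> mu.-integrable setT (EFin \o (fun x => (C * 25) * (expR (s * x) * rho x))).
    by move=> s1; apply: integrable_mulrl; exact: integrable_std_normal_pdf_exp.
  by apply: integrable_addr; apply: h; rewrite ?sqrrN expr1n.
Qed.

(** Stein's identity: the integrand is the derivative of g * rho. The cubic growth of [g] is what
    keeps x * g * rho bounded, so that the boundary terms vanish. *)
Lemma stein (g g' : R -> R) (C : R) :
  (forall x, is_derive x (1 : R) g (g' x)) -> continuous g' ->
  (forall x, `|g x| <= C * (1 + `|x| ^+ 3)) ->
  (forall x, `|g' x - x * g x| <= C * (1 + x ^+ 4)) ->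
  \int[mu]_x ((g' x - x * g x) * rho x) = 0.
Proof.
move=> dg cg' hg hg'.
have cg := is_derive_continuous dg.
have cr := continuous_std_normal_pdf.
have ch : continuous (fun x => g' x - x * g x).
  by move=> x; apply: cvgB; [exact: cg'|apply: cvgM; [exact: cvg_id|exact: cg]].
have C0 : 0 <= C by have := hg 0; rewrite normr0 expr0n addr0 mulr1; exact: le_trans.
(* The constant is 18 = 2 (1 + 8): |x| (1 + |x|^3) <= 2 (1 + x^4), while rho <= peak and x^4 rho <=
   8 peak. *)
apply: (@Rintegral_derive_eq0 _ (g * rho) _ (C * (18 * peak))).
- move=> x; have := is_derive_std_normal_pdf x; have := dg x => dgx drx.
  by apply: is_derive_eq; rewrite /GRing.scale /=; ring.
- by move=> x; apply: cvgM; [exact: ch|exact: cr].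
- apply: integrable_std_normal_pdf_poly hg'.
  by apply: continuous_measurable_fun.
- move=> x; rewrite (_ : (g * rho) x = g x * rho x) // normrM (ger0_norm (std_normal_pdf_ge0 x)).
  have r0 := std_normal_pdf_ge0 x.
  rewrite mulrA (le_trans (ler_wpM2r r0 (ler_wpM2l (normr_ge0 x) (hg x)))) //.
  rewrite mulrCA -mulrA ler_wpM2l //.
  have h1 := std_normal_pdf_le x; have h4 := mulx4_std_normal_pdf_le x.
  have : `|x| * (1 + `|x| ^+ 3) <= 2 * (1 + x ^+ 4).
    rewrite -[x ^+ 4]ger0_norm ?exprn_even_ge0 // normrX.
    have := normr_ge0 x; move: (`|x|) => t t0.
    have : 0 <= (t ^+ 2 - 1) ^+ 2 by rewrite sqr_ge0.
    have : 0 <= (t - 1) ^+ 2 by rewrite sqr_ge0.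
    nra.
  move=> /(ler_wpM2r r0)/le_trans; apply.
  rewrite -mulrA mulrDl mul1r; lra.
Qed.

Let measurable_poly (a0 a1 a2 a3 a4 : R) :
  measurable_fun setT (fun x : R => a0 + a1 * x + a2 * x ^+ 2 + a3 * x ^+ 3 + a4 * x ^+ 4).
Proof. by do ![apply: measurable_funD => //|apply: measurable_funM => //]. Qed.

Lemma integrable_std_normal_poly4 (a0 a1 a2 a3 a4 : R) :
  mu.-integrable setT (EFin \o (fun x =>
    (a0 + a1 * x + a2 * x ^+ 2 + a3 * x ^+ 3 + a4 * x ^+ 4) * rho x)).
Proof.
apply: (@integrable_std_normal_pdf_poly _ (`|a0| + `|a1| + `|a2| + `|a3| + `|a4|)).
  exact: measurable_poly.
move=> x; rewrite !mulrDl.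
have b (i : nat) (a : R) : (i <= 4)%N -> `|a * x ^+ i| <= `|a| * (1 + x ^+ 4).
  move=> i4; rewrite normrM normrX ler_wpM2l //.
  rewrite -[x ^+ 4]ger0_norm ?exprn_even_ge0 // normrX.
  have := normr_ge0 x; move: (`|x|) => t t0.
  have : 0 <= (t ^+ 2 - 1) ^+ 2 by rewrite sqr_ge0.
  have : 0 <= (t - 1) ^+ 2 by rewrite sqr_ge0.
  have : 0 <= t ^+ 2 by rewrite sqr_ge0.
  have : 0 <= t ^+ 4 by rewrite exprn_ge0.
  by case: i i4 => [|[|[|[|[|//]]]]] _; rewrite ?expr0 ?expr1; nra.
rewrite (le_trans (ler_normD _ _)) // lerD ?b //.
rewrite (le_trans (ler_normD _ _)) // lerD ?b //.
rewrite (le_trans (ler_normD _ _)) // lerD ?b //.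
rewrite (le_trans (ler_normD _ _)) // lerD ?b ?(b 1%N) //.
by have := b 0%N a0 isT; rewrite expr0 mulr1.
Qed.

Let mom (k : nat) : R := \int[mu]_x (x ^+ k * rho x).

Let mom0 : mom 0 = 1.
Proof.
rewrite /mom /Rintegral; under eq_integral do rewrite expr0 mul1r.
by rewrite integral_normal_pdf.
Qed.

Let int_mom (k : nat) : (k <= 4)%N -> mu.-integrable setT (EFin \o (fun x => x ^+ k * rho x)).
Proof.
move=> k4.
have := integrable_std_normal_poly4 (k == 0)%:R (k == 1)%:R (k == 2)%:R (k == 3)%:R (k == 4)%:R.
apply: eq_integrable => // x _ /=; congr (_ * _)%:E.
by case: k k4 => [|[|[|[|[|//]]]]] _ /=; rewrite ?expr0 ?expr1; ring.
Qed.

(** Stein's identity for the monomial x^k. At k = 0 the meaningless predecessor is multiplied by 0,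
    and the identity says that the mean vanishes. *)
Let stein_mom (k : nat) : (k <= 3)%N ->
  k%:R * mom k.-1 = mom k.+1.
Proof.
move=> k3; apply/eqP; rewrite -subr_eq0; apply/eqP.
transitivity (\int[mu]_x ((k%:R * x ^+ k.-1 - x * x ^+ k) * rho x)).
  rewrite -RintegralZl ?int_mom //; last by rewrite (leq_trans (leq_pred _)) // (leq_trans k3).
  rewrite -RintegralB //=; last 2 first.
  + by apply: integrable_mulrl; apply: int_mom; rewrite (leq_trans (leq_pred _)) // (leq_trans k3).
  + exact: int_mom.
  by apply: eq_Rintegral => x _; rewrite mulrBl mulrA -exprS.
apply: (@stein (fun x => x ^+ k) (fun x => k%:R * x ^+ k.-1) 4).
- move=> x; have -> : (fun x => x ^+ k) = (id : R -> R) ^+ k by apply/funext => y; rewrite fctE.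
  apply: (is_derive_eq (@is_deriveX _ _ (id : R -> R) k x 1 1 (is_derive_id _ _))).
  by rewrite /GRing.scale /= mulr1.
- move=> x; apply: cvgM; [exact: cvg_cst|exact: exprn_continuous].
- move=> x; rewrite normrX; have := normr_ge0 x; move: (`|x|) => t t0.
  have : 0 <= (t - 1) ^+ 2 by rewrite sqr_ge0.
  have : 0 <= t * (t - 1) ^+ 2 by rewrite mulr_ge0 ?sqr_ge0.
  have : 0 <= t ^+ 3 by rewrite exprn_ge0.
  by case: k k3 => [|[|[|[|//]]]] _; rewrite ?expr0 ?expr1; nra.
- move=> x; rewrite (le_trans (ler_normB _ _)) // !normrM !normrX normr_nat.
  rewrite -[x ^+ 4]ger0_norm ?exprn_even_ge0 // normrX.
  have := normr_ge0 x; move: (`|x|) => t t0.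
  have : 0 <= (t ^+ 2 - 1) ^+ 2 by rewrite sqr_ge0.
  have : 0 <= (t - 1) ^+ 2 by rewrite sqr_ge0.
  have : 0 <= t ^+ 2 by rewrite sqr_ge0.
  case: k k3 => [|[|[|[|//]]]] _ /=; rewrite ?expr0 ?expr1; nra.
Qed.

Lemma std_normal_poly4 (a0 a1 a2 a3 a4 : R) :
  \int[mu]_x ((a0 + a1 * x + a2 * x ^+ 2 + a3 * x ^+ 3 + a4 * x ^+ 4) * rho x) =
  a0 + a2 + 3 * a4.
Proof.
have m1 : mom 1 = 0 by rewrite -stein_mom // mul0r.
have m2 : mom 2 = 1 by rewrite -stein_mom // mom0 mulr1.
have m3 : mom 3 = 0 by rewrite -stein_mom // m1 mulr0.
have m4 : mom 4 = 3 by rewrite -stein_mom // m2 mulr1.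
have -> : a0 + a2 + 3 * a4 = a0 * mom 0 + a1 * mom 1 + a2 * mom 2 + a3 * mom 3 + a4 * mom 4.
  by rewrite mom0 m1 m2 m3 m4; ring.
have im a k : (k <= 4)%N -> mu.-integrable setT (EFin \o (fun x => a * (x ^+ k * rho x))).
  by move=> k4; apply: integrable_mulrl; exact: int_mom.
rewrite /mom -!RintegralZl ?int_mom // -!RintegralD //=; try by do ?apply: integrable_addr; exact: im.
by apply: eq_Rintegral => x _; rewrite expr0 expr1; ring.
Qed.

Lemma integrable_std_normal_bounded (f : R -> R) : measurable_fun setT f ->
  (forall x, `|f x| <= 1) -> mu.-integrable setT (EFin \o (fun x => f x * rho x)).
Proof.
move=> mf f1; apply: (@integrable_std_normal_pdf_poly _ 1) => // x.
by rewrite mul1r (le_trans (f1 x)) // lerDl exprn_even_ge0.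
Qed.

Lemma normr_cos_le1 (t : R) : `|cos t| <= 1.
Proof. by rewrite ler_norml cos_geN1 cos_le1. Qed.

Lemma normr_sin_le1 (t : R) : `|sin t| <= 1.
Proof. by rewrite ler_norml sin_geN1 sin_le1. Qed.

Let continuous_affine (u c : R) : continuous (fun x : R => u * x + c).
Proof.
by move=> x; apply: cvgD; [apply: cvgM; [exact: cvg_cst|exact: cvg_id]|exact: cvg_cst].
Qed.

Let cosint (c u : R) : R := \int[mu]_x (cos (u * x + c) * rho x).

Let int_xsin (c u : R) : mu.-integrable setT (EFin \o (fun x => x * sin (u * x + c) * rho x)).
Proof.
have csin : continuous (fun x => sin (u * x + c)).
  by move=> x; apply: (continuous_comp (@continuous_affine u c x)); exact: continuous_sin.
apply: (@integrable_std_normal_pdf_poly _ 2).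
  by apply: measurable_funM => //; exact: continuous_measurable_fun.
move=> x; rewrite normrM.
have := normr_sin_le1 (u * x + c); have := normr_ge0 (sin (u * x + c)).
move: (`|sin _|) => s s0 s1.
rewrite -[x ^+ 4]ger0_norm ?exprn_even_ge0 // normrX.
have := normr_ge0 x; move: (`|x|) => t t0.
have : 0 <= (t ^+ 2 - 1) ^+ 2 by rewrite sqr_ge0.
have : 0 <= (t - 1) ^+ 2 by rewrite sqr_ge0.
have : t * s <= t by rewrite ler_piMr.
have : 0 <= t ^+ 2 by rewrite sqr_ge0.
nra.
Qed.

Let stein_sin (c u : R) :
  \int[mu]_x (x * sin (u * x + c) * rho x) = u * cosint c u.
Proof.
have ccos : continuous (fun x => cos (u * x + c)).
  by move=> x; apply: (continuous_comp (@continuous_affine u c x)); exact: continuous_cos.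
have csin : continuous (fun x => sin (u * x + c)).
  by move=> x; apply: (continuous_comp (@continuous_affine u c x)); exact: continuous_sin.
apply/eqP; rewrite eq_sym -subr_eq0; apply/eqP.
have ic : mu.-integrable setT (EFin \o (fun x => cos (u * x + c) * rho x)).
  apply: integrable_std_normal_bounded; last by move=> x; exact: normr_cos_le1.
  exact: continuous_measurable_fun.
have isin := int_xsin c u.
rewrite /cosint -RintegralZl // -RintegralB //=; last exact: integrable_mulrl.
transitivity (\int[mu]_x ((u * cos (u * x + c) - x * sin (u * x + c)) * rho x)).
  by apply: eq_Rintegral => x _; rewrite mulrBl mulrA.
apply: (@stein (fun x => sin (u * x + c)) (fun x => u * cos (u * x + c)) (`|u| + 1)).
- move=> x; have -> : (fun x => sin (u * x + c)) = sin \o (cst u * id + cst c) by [].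
  by apply: is_derive_eq; rewrite /GRing.scale /= /cst !fctE /=; ring.
- by move=> x; apply: cvgM; [exact: cvg_cst|exact: ccos].
- move=> x; rewrite (le_trans (normr_sin_le1 _)) // mulrDr mulr1.
  have : 0 <= `|x| ^+ 3 by rewrite exprn_ge0.
  have := normr_ge0 u; nra.
- move=> x; rewrite (le_trans (ler_normB _ _)) // !normrM.
  have := normr_sin_le1 (u * x + c); have := normr_ge0 (sin (u * x + c)).
  have := normr_cos_le1 (u * x + c); have := normr_ge0 (cos (u * x + c)).
  move: (`|sin _|) (`|cos _|) => s k k0 k1 s0 s1.
  rewrite -[x ^+ 4]ger0_norm ?exprn_even_ge0 // normrX.
  have := normr_ge0 x; move: (`|x|) => t t0.
  have : t * s <= t by rewrite ler_piMr.
  have : `|u| * k <= `|u| by rewrite ler_piMr.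
  have : t <= 1 + t ^+ 4.
    have : 0 <= (t ^+ 2 - 1) ^+ 2 by rewrite sqr_ge0.
    have : 0 <= (t - 1) ^+ 2 by rewrite sqr_ge0.
    nra.
  have : 0 <= `|u| * t ^+ 4 by rewrite mulr_ge0 ?exprn_ge0.
  lra.
Qed.

(** Differentiation under the integral, dominated by (1 + x^2) rho, produces the integral of -x
    sin(u x + c) rho, which Stein's identity turns back into [cosint]. *)
Let is_derive_cosint (c u : R) : is_derive u (1 : R) (cosint c) (- (u * cosint c u)).
Proof.
pose f := fun (v x : R) => cos (v * x + c) * rho x.
have df v x : is_derive v (1 : R) (f ^~ x) (- (x * sin (v * x + c) * rho x)).
  have -> : f ^~ x = (cos \o (id * cst x + cst c)) * cst (rho x) by [].
  by apply: is_derive_eq; rewrite /GRing.scale /= /cst !fctE /=; ring.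
have intf v : mu.-integrable setT (EFin \o f v).
  apply: integrable_std_normal_bounded; last by move=> x; exact: normr_cos_le1.
  apply: continuous_measurable_fun => x.
  by apply: (continuous_comp (@continuous_affine v c x)); exact: continuous_cos.
have Iu : `]u - 1, u + 1[%classic u by rewrite /= in_itv /= ltrBlDr ltrDl ltr01.
pose G := fun x => (1 + x ^+ 2) * rho x.
have intG : mu.-integrable setT (EFin \o G).
  have := integrable_std_normal_poly4 1 0 1 0 0.
  by apply: eq_integrable => // x _ /=; rewrite /G !mul0r !addr0 mul1r.
have G0 x : 0 <= G x by rewrite mulr_ge0 ?std_normal_pdf_ge0 // addr_ge0 ?sqr_ge0.
have pE v x : partial1of2 f v x = - (x * sin (v * x + c) * rho x).
  by rewrite partial1of2E; have [] := df v x.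
have GE v x : `|partial1of2 f v x| <= G x.
  rewrite pE normrN !normrM (ger0_norm (std_normal_pdf_ge0 x)) ler_wpM2r ?std_normal_pdf_ge0 //.
  have := normr_sin_le1 (v * x + c); have := normr_ge0 (sin (v * x + c)).
  move: (`|sin _|) => s s0 s1.
  rewrite -[x ^+ 2]real_normK ?num_real //.
  have := normr_ge0 x; move: (`|x|) => t t0.
  have : 0 <= (t - 1) ^+ 2 by rewrite sqr_ge0.
  have : t * s <= t by rewrite ler_piMr.
  have : 0 <= t ^+ 2 by rewrite sqr_ge0.
  nra.
have h1 := @derivable_under_integral _ _ _ mu f setT measurableT u _ _ Iu
  (fun x _ => intf x) (fun x y _ _ => (let: DeriveDef d _ := df x y in d)) G G0 intG (fun x y _ _ => GE x y).
have h2 := @differentiation_under_integral _ _ _ mu f setT measurableT u _ _ Iu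
  (fun x _ => intf x) (fun x y _ _ => (let: DeriveDef d _ := df x y in d)) G G0 intG (fun x y _ _ => GE x y).
apply: DeriveDef; first exact: h1.
rewrite -derive1E [LHS]h2 -stein_sin -mulN1r -RintegralZl //=.
  by apply: eq_Rintegral => x _; rewrite pE mulN1r.
Qed.

(** By the differential equation y' = -u y for [cosint c], the product with exp(u^2 / 2) is constant
    in [u]; at u = 0 it is cos c. *)
Lemma std_normal_cos (u c : R) :
  \int[mu]_x (cos (u * x + c) * rho x) = expR (- (u ^+ 2 / 2)) * cos c.
Proof.
pose K := fun v => cosint c v * expR (v ^+ 2 / 2).
have dK v : is_derive v (1 : R) K 0.
  have -> : K = cosint c * (expR \o (id ^+ 2 * cst (2^-1))) by [].
  have dc := is_derive_cosint c v.
  by apply: is_derive_eq; rewrite /GRing.scale /= /cst !fctE /=; field.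
have := is_derive_0_is_cst u 0 dK.
rewrite /K expr0n mul0r expR0 mulr1.
have -> : cosint c 0 = cos c.
  rewrite /cosint; transitivity (\int[mu]_x (cos c * rho x)).
    by apply: eq_Rintegral => x _; rewrite mul0r add0r.
  rewrite RintegralZl //; last exact: integrable_normal_pdf.
  by rewrite /Rintegral integral_normal_pdf mulr1.
by move=> <-; rewrite expRN mulrCA mulVf ?mulr1 // gt_eqF ?expR_gt0.
Qed.

End StandardNormal.

Lemma Rintegral_prod1 (R : realType) (d1 d2 : measure_display)
    (T1 : measurableType d1) (T2 : measurableType d2)
    (m1 : {sigma_finite_measure set T1 -> \bar R})
    (m2 : {sigma_finite_measure set T2 -> \bar R}) (f : T1 * T2 -> R) :
  (m1 \x m2)%E.-integrable setT (EFin \o f) ->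
  (forall x, m2.-integrable setT (EFin \o (fun y => f (x, y)))) ->
  \int[(m1 \x m2)%E]_z f z = \int[m1]_x \int[m2]_y f (x, y).
Proof.
move=> intf intf2; rewrite [LHS]/Rintegral -(integral12_prod_meas1 intf).
rewrite [RHS]/Rintegral; congr fine; apply: eq_integral => x _.
by rewrite /Rintegral fineK //; exact: (integrable_fin_num measurableT (intf2 x)).
Qed.

Lemma Rintegral_prod2 (R : realType) (d1 d2 : measure_display)
    (T1 : measurableType d1) (T2 : measurableType d2)
    (m1 : {sigma_finite_measure set T1 -> \bar R})
    (m2 : {sigma_finite_measure set T2 -> \bar R}) (f : T1 * T2 -> R) :
  (m1 \x m2)%E.-integrable setT (EFin \o f) ->
  (forall y, m1.-integrable setT (EFin \o (fun x => f (x, y)))) ->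
  \int[(m1 \x m2)%E]_z f z = \int[m2]_y \int[m1]_x f (x, y).
Proof.
move=> intf intf2; rewrite [LHS]/Rintegral -(integral21_prod_meas1 intf).
rewrite [RHS]/Rintegral; congr fine; apply: eq_integral => y _.
by rewrite /Rintegral fineK //; exact: (integrable_fin_num measurableT (intf2 y)).
Qed.

Lemma bounded_integrable (R : realType) (d : measure_display) (T : measurableType d)
    (P : probability T R) (f : T -> R) (M : R) :
  measurable_fun setT f -> (forall x, `|f x| <= M) -> P.-integrable setT (EFin \o f).
Proof.
move=> mf fM; apply: (@le_integrable_real _ _ _ P f (cst M)) => //.
exact: finite_measure_integrable_cst.
Qed.

Lemma measurable_cos_comp (R : realType) (d : measure_display) (T : measurableType d)
    (g : T -> R) (c : R) : measurable_fun setT g -> measurable_fun setT (fun x => cos (g x + c)).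
Proof.
move=> mg; apply: (@measurableT_comp _ _ _ _ _ _ (@cos R) _ (fun x => g x + c)).
  by apply: continuous_measurable_fun; exact: continuous_cos.
exact: measurable_funD.
Qed.

(** * Characteristic functions and quadratic moments of Gaussian vectors *)

Definition dotv (R : pzRingType) (n : nat) (u v : 'cV[R]_n) : R :=
  \sum_(i < n) u i 0 * v i 0.

Definition quadf (R : pzRingType) (n : nat) (C : 'M[R]_n) (z : 'cV[R]_n) : R :=
  \sum_(i < n) \sum_(j < n) C i j * z i 0 * z j 0.

Lemma measurable_dotv (R : realType) (d : measure_display) (T : measurableType d)
    (n : nat) (u : 'cV[R]_n) (W : T -> 'cV[R]_n) :
  (forall i, measurable_fun setT (fun w => W w i 0)) ->
  measurable_fun setT (fun w => dotv u (W w)).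
Proof. by move=> mW; apply: measurable_sum => i; apply: measurable_funM. Qed.

Lemma measurable_quadf (R : realType) (d : measure_display) (T : measurableType d)
    (n : nat) (C : 'M[R]_n) (W : T -> 'cV[R]_n) :
  (forall i, measurable_fun setT (fun w => W w i 0)) ->
  measurable_fun setT (fun w => quadf C (W w)).
Proof.
move=> mW; apply: measurable_sum => i; apply: measurable_sum => j.
by do ![apply: measurable_funM => //].
Qed.

(** The characteristic function exp(-V u / 2), in real form: the free phase [c] covers both the
    cosine and the sine part. In inductions on the dimension it also absorbs the coordinates that
    are held fixed. *)
Definition cos_law (R : realType) (d : measure_display) (T : measurableType d)
    (P : probability T R) (n : nat) (W : T -> 'cV[R]_n) (V : 'cV[R]_n -> R) : Prop :=
  forall (u : 'cV[R]_n) (c : R),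
    \int[P]_w cos (dotv u (W w) + c) = expR (- (V u / 2)) * cos c.

(** The definition records exactly what is used later and is stable under adjoining an independent
    normal coordinate. The second moment is an extended integral, so that Tonelli's theorem applies
    without an integrability condition. *)
Definition std_gaussian_vector (R : realType) (d : measure_display)
    (T : measurableType d) (P : probability T R) (n : nat) (W : T -> 'cV[R]_n) : Prop :=
  [/\ forall i, measurable_fun setT (fun w => W w i 0),
      cos_law P W (fun u => dotv u u) &
      forall (C : 'M[R]_n) (v : 'cV[R]_n) (k : R), C^T = C ->
        (\int[P]_w ((quadf C (W w) + dotv v (W w) + k) ^+ 2)%:E =
        (2 * (\sum_(i < n) \sum_(j < n) C i j ^+ 2) + dotv v v + (k + \tr C) ^+ 2)%:E)%E].

Definition cons_col (R : Type) (n : nat) (x : R) (v : 'cV[R]_n) : 'cV[R]_n.+1 :=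
  \col_i (if unlift ord0 i is Some j then v j 0 else x).

Lemma cons_col0 (R : Type) (n : nat) (x : R) (v : 'cV[R]_n) : cons_col x v ord0 0 = x.
Proof. by rewrite mxE unlift_none. Qed.

Lemma cons_colS (R : Type) (n : nat) (x : R) (v : 'cV[R]_n) j :
  cons_col x v (lift ord0 j) 0 = v j 0.
Proof. by rewrite mxE liftK. Qed.

Definition tail_col (R : Type) (n : nat) (v : 'cV[R]_n.+1) : 'cV[R]_n :=
  \col_j v (lift ord0 j) 0.

Definition tail_mx (R : Type) (n : nat) (C : 'M[R]_n.+1) : 'M[R]_n :=
  \matrix_(i, j) C (lift ord0 i) (lift ord0 j).

Lemma dotv_cons (R : pzRingType) (n : nat) (u : 'cV[R]_n.+1) x (v : 'cV[R]_n) :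
  dotv u (cons_col x v) = u ord0 0 * x + dotv (tail_col u) v.
Proof.
rewrite /dotv big_ord_recl cons_col0; congr (_ + _).
by apply: eq_bigr => i _; rewrite cons_colS mxE.
Qed.

Lemma dotv_recl (R : pzRingType) (n : nat) (u v : 'cV[R]_n.+1) :
  dotv u v = u ord0 0 * v ord0 0 + dotv (tail_col u) (tail_col v).
Proof.
by rewrite /dotv big_ord_recl; congr (_ + _); apply: eq_bigr => i _; rewrite !mxE.
Qed.

Lemma quadf_cons (R : comPzRingType) (n : nat) (C : 'M[R]_n.+1) x (v : 'cV[R]_n) :
  C^T = C ->
  quadf C (cons_col x v) = C ord0 ord0 * x ^+ 2
    + dotv ((2 * x) *: \col_j C ord0 (lift ord0 j)) v + quadf (tail_mx C) v.
Proof.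
move=> symC; rewrite /quadf big_ord_recl.
have -> : \sum_j C ord0 j * cons_col x v ord0 0 * cons_col x v j 0 =
    C ord0 ord0 * x ^+ 2 + \sum_j C ord0 (lift ord0 j) * x * v j 0.
  rewrite big_ord_recl !cons_col0 expr2 mulrA; congr (_ + _).
  by apply: eq_bigr => j _; rewrite cons_colS.
have -> : \sum_i \sum_j C (lift ord0 i) j * cons_col x v (lift ord0 i) 0 * cons_col x v j 0 =
    \sum_i C (lift ord0 i) ord0 * v i 0 * x + \sum_i \sum_j tail_mx C i j * v i 0 * v j 0.
  rewrite -big_split /=; apply: eq_bigr => i _.
  rewrite big_ord_recl !cons_col0 cons_colS; congr (_ + _).
  by apply: eq_bigr => j _; rewrite cons_colS mxE.
rewrite -!addrA; congr (_ + _); rewrite !addrA; congr (_ + _).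
rewrite /dotv -big_split /=; apply: eq_bigr => i _.
have -> : C (lift ord0 i) ord0 = C ord0 (lift ord0 i) by rewrite -[in LHS]symC mxE.
by rewrite !mxE; ring.
Qed.

Lemma sum_sqr_recl (R : comPzRingType) (n : nat) (C : 'M[R]_n.+1) : C^T = C ->
  \sum_i \sum_j C i j ^+ 2 = C ord0 ord0 ^+ 2
    + 2 * dotv (\col_j C ord0 (lift ord0 j)) (\col_j C ord0 (lift ord0 j))
    + \sum_i \sum_j tail_mx C i j ^+ 2.
Proof.
move=> symC; rewrite big_ord_recl big_ord_recl.
have -> : \sum_i \sum_j C (lift ord0 i) j ^+ 2 =
    \sum_i C (lift ord0 i) ord0 ^+ 2 + \sum_i \sum_j tail_mx C i j ^+ 2.
  rewrite -big_split /=; apply: eq_bigr => i _; rewrite big_ord_recl; congr (_ + _).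
  by apply: eq_bigr => j _; rewrite mxE.
rewrite -!addrA; congr (_ + _); rewrite !addrA; congr (_ + _).
rewrite /dotv mulr_sumr -big_split /=; apply: eq_bigr => i _.
have -> : C (lift ord0 i) ord0 = C ord0 (lift ord0 i) by rewrite -[in LHS]symC mxE.
by rewrite !mxE; ring.
Qed.

Lemma dotvDl (R : pzRingType) (n : nat) (u u' v : 'cV[R]_n) :
  dotv (u + u') v = dotv u v + dotv u' v.
Proof. by rewrite /dotv -big_split; apply: eq_bigr => i _; rewrite mxE mulrDl. Qed.

Lemma dotvZl (R : pzRingType) (n : nat) k (u v : 'cV[R]_n) :
  dotv (k *: u) v = k * dotv u v.
Proof. by rewrite /dotv mulr_sumr; apply: eq_bigr => i _; rewrite mxE mulrA. Qed.

Lemma dotvC (R : comPzRingType) (n : nat) (u v : 'cV[R]_n) : dotv u v = dotv v u.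
Proof. by apply: eq_bigr => i _; rewrite mulrC. Qed.

Lemma tr_recl (R : pzRingType) (n : nat) (C : 'M[R]_n.+1) :
  \tr C = C ord0 ord0 + \tr (tail_mx C).
Proof.
by rewrite /mxtrace big_ord_recl; congr (_ + _); apply: eq_bigr => i _; rewrite mxE.
Qed.

Lemma measurable_cons_col (R : realType) (d : measure_display) (T : measurableType d)
  (n : nat) (x : T -> R) (W : T -> 'cV[R]_n) :
  measurable_fun setT x -> (forall i, measurable_fun setT (fun w => W w i 0)) ->
  forall i, measurable_fun setT (fun w => cons_col (x w) (W w) i 0).
Proof.
move=> mx mW i; case: (unliftP ord0 i) => [j|] ->.
  by under eq_fun do rewrite cons_colS; exact: mW.
by under eq_fun do rewrite cons_col0.
Qed.

Section GaussianStep.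
Context {R : realType} {d : measure_display} {T : measurableType d}.
Variables (P : probability T R) (n : nat) (W : T -> 'cV[R]_n).
Hypothesis gW : std_gaussian_vector P W.
Local Notation gam := (normal_prob (0 : R) 1).
Local Notation P' := (P \x gam)%E.
Let W' (z : T * R) := cons_col z.2 (W z.1).

Let mW i : measurable_fun setT (fun w => W w i 0).
Proof. by case: gW. Qed.

Let mW' i : measurable_fun setT (fun z => W' z i 0).
Proof.
apply: measurable_cons_col; first exact: measurable_snd.
by move=> j; exact: (measurableT_comp (mW j)).
Qed.

Lemma Rintegral_std_normal (f : R -> R) : measurable_fun setT f ->
  \int[gam]_x f x = \int[@lebesgue_measure R]_x (f x * normal_pdf 0 1 x).
Proof.
move=> mf; rewrite /Rintegral integral_normal_prob; last exact/measurable_EFinP.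
by congr fine; apply: eq_integral => x _; rewrite EFinM.
Qed.

(** For fixed old coordinates, their contribution to the scalar product is just a phase in the
    integral over the new one. *)
Let cos_step : cos_law P' W' (fun u => dotv u u).
Proof.
move=> u c; have [_ cosW _] := gW.
have mcos : measurable_fun setT (fun z => cos (dotv u (W' z) + c)).
  by apply: measurable_cos_comp; exact: measurable_dotv.
rewrite Rintegral_prod1 /=; last 2 first.
- by apply: (@bounded_integrable _ _ _ (P \x gam)%E _ 1 mcos) => z; exact: normr_cos_le1.
- move=> x; apply: bounded_integrable => [|z]; last exact: normr_cos_le1.
  exact: (measurableT_comp mcos).
transitivity (\int[P]_w (expR (- (u ord0 0 ^+ 2 / 2)) * cos (dotv (tail_col u) (W w) + c))).
  apply: eq_Rintegral => w _; rewrite -std_normal_cos -Rintegral_std_normal.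
    by apply: eq_Rintegral => x _; rewrite /W' /= dotv_cons addrA.
  by apply: measurable_cos_comp; exact: measurable_funM.
rewrite RintegralZl //; last first.
  apply: bounded_integrable => [|z]; last exact: normr_cos_le1.
  by apply: measurable_cos_comp; exact: measurable_dotv.
rewrite cosW mulrA -expRD; congr (expR _ * _).
by rewrite dotv_recl; field.
Qed.

(** With the new coordinate x frozen there remains a quadratic function of [W] with the same
    quadratic part [C'] and linear part v' + 2 x b. The hypothesis on [W] turns its second moment
    into a quartic polynomial in x, integrated by the normal moments 1, 0, 1, 0, 3. *)
Let sqr_step (C : 'M[R]_n.+1) (v : 'cV[R]_n.+1) (k : R) : C^T = C ->
  (\int[P']_w ((quadf C (W' w) + dotv v (W' w) + k) ^+ 2)%:E =
  (2 * (\sum_i \sum_j C i j ^+ 2) + dotv v v + (k + \tr C) ^+ 2)%:E)%E.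
Proof.
move=> symC; have [_ _ sqrW] := gW.
rewrite fubini_tonelli2 /=; last 2 first.
- apply/measurable_EFinP; apply: measurable_funX; do ![apply: measurable_funD => //].
  + exact: measurable_quadf.
  + exact: measurable_dotv.
- by move=> z; rewrite lee_fin sqr_ge0.
pose C' := tail_mx C; pose b := \col_j C ord0 (lift ord0 j).
pose v' := tail_col v; pose K := k + \tr C'.
have symC' : C'^T = C' by apply/matrixP => i j; rewrite !mxE -[in LHS]symC mxE.
pose S' := \sum_i \sum_j C' i j ^+ 2.
transitivity (\int[gam]_x ((2 * S' + dotv v' v' + K ^+ 2)
   + (4 * dotv v' b + 2 * K * v ord0 0) * x
   + (4 * dotv b b + v ord0 0 ^+ 2 + 2 * K * C ord0 ord0) * x ^+ 2
   + (2 * v ord0 0 * C ord0 ord0) * x ^+ 3 + (C ord0 ord0 ^+ 2) * x ^+ 4)%:E)%E.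
  apply: eq_integral => x _; rewrite /fubini_G.
  transitivity (\int[P]_w ((quadf C' (W w) + dotv (v' + (2 * x) *: b) (W w)
     + (k + v ord0 0 * x + C ord0 ord0 * x ^+ 2)) ^+ 2)%:E)%E.
    apply: eq_integral => w _; congr (_%:E); congr (_ ^+ 2).
    by rewrite /W' /= quadf_cons // dotv_cons dotvDl; ring.
  rewrite sqrW // -/S'; congr (_%:E).
  rewrite dotvDl dotvZl (dotvC v') (dotvC b) dotvDl dotvZl dotvDl dotvZl (dotvC b v').
  by rewrite /K; ring.
rewrite integral_normal_prob; last first.
  by apply/measurable_EFinP; do ![apply: measurable_funD => //|apply: measurable_funM => //].
under eq_integral do rewrite -EFinM.
rewrite -(@fineK _ (\int[_]_x _)%E); last first.
  by apply: integrable_fin_num => //; exact: integrable_std_normal_poly4.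
congr (_%:E); rewrite [LHS]std_normal_poly4 sum_sqr_recl // tr_recl dotv_recl -/v' -/b -/C' -/S' /K.
ring.
Qed.

Lemma std_gaussian_cons : std_gaussian_vector P' W'.
Proof. by split; [exact: mW'|exact: cos_step|exact: sqr_step]. Qed.

End GaussianStep.

Lemma std_gaussian_vector_exists (R : realType) (n : nat) :
  exists (d : measure_display) (T : measurableType d) (P : probability T R)
    (W : T -> 'cV[R]_n), std_gaussian_vector P W.
Proof.
elim: n => [|n [d [T [P [W gW]]]]]; last first.
  exists _, _, (P \x normal_prob (0 : R) 1)%E, (fun z => cons_col z.2 (W z.1)).
  exact: std_gaussian_cons gW.
have P1 : normal_prob (0 : R) 1 setT = 1%E by exact: integral_normal_pdf.
exists _, _, (normal_prob (0 : R) 1), (fun=> 0); split.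
- by case.
- move=> u c; rewrite Rintegral_cst // (_ : fine _ = 1) ?mulr1 /dotv; last exact: (congr1 fine P1).
  rewrite !big_ord0.
  by rewrite mul0r oppr0 expR0 mul1r add0r.
- move=> C v k _; rewrite integral_cst // [X in (_ * X)%E](_ : _ = 1%E) ?mule1; last exact: P1.
  by rewrite /quadf /dotv /mxtrace !big_ord0 !(mulr0, add0r, addr0).
Qed.

(** * Laplace transforms of squared distances *)

Section Laplace.
Context {R : realType}.

Lemma expR_cos_std_gaussian (d : measure_display) (T : measurableType d)
    (Q : probability T R) (n : nat) (G : T -> 'cV[R]_n) (k : R) (v : 'cV[R]_n) :
  std_gaussian_vector Q G -> 0 <= k ->
  \int[Q]_w cos (dotv (Num.sqrt (2 * k) *: v) (G w)) = expR (- (k * dotv v v)).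
Proof.
move=> [_ cosG _] k0; have := cosG (Num.sqrt (2 * k) *: v) 0.
rewrite cos0 mulr1; under eq_Rintegral do rewrite addr0.
move=> ->; congr expR; rewrite dotvZl dotvC dotvZl mulrA -expr2 sqr_sqrtr ?mulr_ge0 //.
by field.
Qed.

(* A Hubbard-Stratonovich transform: the Laplace transform of [|W - a|^2] is a
   Gaussian average of characteristic functions of [W]. *)
Lemma laplace_cos_law (d d' : measure_display) (T : measurableType d)
    (T' : measurableType d') (P : probability T R) (Q : probability T' R) (n : nat)
    (W : T -> 'cV[R]_n) (G : T' -> 'cV[R]_n) (V : 'cV[R]_n -> R) (a : 'cV[R]_n) (k : R) :
  (forall i, measurable_fun setT (fun w => W w i 0)) -> cos_law P W V ->
  std_gaussian_vector Q G -> 0 <= k ->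
  \int[P]_w expR (- (k * dotv (W w - a) (W w - a))) =
  \int[Q]_g (expR (- (V (Num.sqrt (2 * k) *: G g) / 2))
             * cos (- dotv (Num.sqrt (2 * k) *: a) (G g))).
Proof.
move=> mW cosW gG k0; have [mG _ _] := gG.
pose f (z : T * T') := cos (dotv (Num.sqrt (2 * k) *: (W z.1 - a)) (G z.2)).
have mf : measurable_fun setT f.
  apply: (@measurableT_comp _ _ _ _ _ _ (@cos R)).
    by apply: continuous_measurable_fun; exact: continuous_cos.
  apply: measurable_sum => i; apply: measurable_funM; last first.
    by apply: (measurableT_comp (mG i)).
  under eq_fun do rewrite !mxE.
  apply: measurable_funM => //; apply: measurable_funB => //.
  exact: (measurableT_comp (mW i)).
have intf : (P \x Q)%E.-integrable setT (EFin \o f).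
  by apply: (@bounded_integrable _ _ _ (P \x Q)%E _ 1 mf) => z; exact: normr_cos_le1.
transitivity (\int[P]_w \int[Q]_g f (w, g)).
  by apply: eq_Rintegral => w _; rewrite -(expR_cos_std_gaussian _ gG).
rewrite -Rintegral_prod1 //; last first.
  move=> x; apply: (@bounded_integrable _ _ _ _ _ 1) => [|z]; last exact: normr_cos_le1.
  exact: (measurableT_comp mf).
rewrite Rintegral_prod2 //; last first.
  move=> x; apply: (@bounded_integrable _ _ _ _ _ 1) => [|z]; last exact: normr_cos_le1.
  exact: (measurableT_comp mf).
apply: eq_Rintegral => g _; rewrite -cosW; apply: eq_Rintegral => w _.
rewrite /f /=; congr cos; rewrite !dotvZl -mulrBr; congr (_ * _).
by rewrite dotvC /dotv -sumrB; apply: eq_bigr => i _; rewrite !mxE; ring.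
Qed.

(** Expanding [p] gives Laplace transforms of |W - a|^2 at the integers 0, ..., deg p. Each of them
    is an average over an auxiliary Gaussian vector that involves the law of [W] only through
    [V]. *)
Lemma cos_law_poly (d d' : measure_display) (T : measurableType d)
    (T' : measurableType d') (P : probability T R) (P' : probability T' R) (n : nat)
    (W : T -> 'cV[R]_n) (W' : T' -> 'cV[R]_n) (V : 'cV[R]_n -> R) (a : 'cV[R]_n)
    (p : {poly R}) :
  (forall i, measurable_fun setT (fun w => W w i 0)) ->
  (forall i, measurable_fun setT (fun w => W' w i 0)) ->
  cos_law P W V -> cos_law P' W' V ->
  \int[P]_w p.[expR (- dotv (W w - a) (W w - a))] =
  \int[P']_w p.[expR (- dotv (W' w - a) (W' w - a))].
Proof.
move=> mW mW' cosW cosW'.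
have [d0 [T0 [Q [G gG]]]] := std_gaussian_vector_exists R n.
have dot0 (v : 'cV[R]_n) : 0 <= dotv v v.
  by apply: sumr_ge0 => i _; rewrite -expr2 sqr_ge0.
have expand (d1 : measure_display) (T1 : measurableType d1) (P1 : probability T1 R)
    (W1 : T1 -> 'cV[R]_n) : (forall i, measurable_fun setT (fun w => W1 w i 0)) ->
    cos_law P1 W1 V ->
    \int[P1]_w p.[expR (- dotv (W1 w - a) (W1 w - a))] =
    \sum_(i < size p) p`_i * \int[Q]_g (expR (- (V (Num.sqrt (2 * i%:R) *: G g) / 2))
             * cos (- dotv (Num.sqrt (2 * i%:R) *: a) (G g))).
  move=> mW1 cosW1.
  have inte (i : nat) : P1.-integrable setT
      (EFin \o (fun w => expR (- (i%:R * dotv (W1 w - a) (W1 w - a))))).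
    apply: (@bounded_integrable _ _ _ _ _ 1) => [|w].
      apply: measurableT_comp => //; apply: measurableT_comp => //.
      apply: measurable_funM => //; apply: measurable_sum => j.
      under eq_fun do rewrite !mxE.
      by apply: measurable_funM; apply: measurable_funB.
    by rewrite ger0_norm ?expR_ge0 // expR_le1 oppr_le0 mulr_ge0.
  under eq_bigr => i _ do rewrite -(laplace_cos_law a mW1 cosW1 gG (ler0n _ i)).
  under eq_bigr => i _ do rewrite -RintegralZl //.
  transitivity (\int[P1]_w \sum_(i < size p) p`_i * expR (- (i%:R * dotv (W1 w - a) (W1 w - a)))).
    apply: eq_Rintegral => w _; rewrite horner_coef; apply: eq_bigr => i _.
    by rewrite -expRM_natl mulrN.
  by rewrite Rintegral_sum // => i; exact: integrable_mulrl.
by rewrite !expand.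
Qed.

End Laplace.

(** * Normal random variables and vectors, possibly degenerate *)

Section NormalRv.
Context {R : realType} {d : measure_display} {T : measurableType d}.
Variable P : probability T R.
Local Notation gam := (normal_prob (0 : R) 1).

Lemma normal_prob_setT : gam setT = 1%E.
Proof. exact: integral_normal_pdf. Qed.

Lemma normal_pdf_affine (m s x : R) : s != 0 ->
  normal_pdf m s (m + s * x) * `|s| = normal_pdf 0 1 x.
Proof.
move=> s0; rewrite !normal_pdfE ?oner_neq0 // /normal_fun /normal_peak expr1n mul1r subr0.
rewrite -mulrnAr sqrtrM ?sqr_ge0 // sqrtr_sqr invfM -!mulrA mulrCA; congr (_ * _).
rewrite mulrCA mulVf ?normr_eq0 // mulr1; congr expR.
by rewrite -mulr_natl; field.
Qed.

(** Writing the law as that of m + s x with x standard normal treats both cases at once: for s = 0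
    it is the constant [m], in accordance with the Dirac mass. *)
Lemma ge0_integral_normal_rv (Y : T -> R) : normal_rv P Y ->
  exists m s : R, forall f : R -> \bar R, measurable_fun setT f ->
    (forall y, 0 <= f y)%E ->
    (\int[P]_w f (Y w) = \int[gam]_x f (m + s * x)%R)%E.
Proof.
move=> [mY [m [s lawY]]]; exists m, s => f mf f0.
have maff : measurable_fun setT (fun x : R => m + s * x).
  by apply: measurable_funD => //; apply: measurable_funM.
pose Y' : T -> measurableTypeR R := Y.
have mY' : measurable_fun setT Y' by exact: mY.
pose law : {measure set (measurableTypeR R) -> \bar R} :=
  measure_function_pushforward__canonical__measure_function_Measure P mY'.
transitivity (\int[law]_y f y)%E.
  by rewrite /law (ge0_integral_pushforward mY').
have [s0|s0] := eqVneq s 0.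
  transitivity (\int[gam]_x cst (f m) x)%E; last first.
    by apply: eq_integral => x _; rewrite s0 mul0r addr0.
  rewrite integral_cst // [X in (_ * X)%E](_ : _ = 1%E) ?mule1; last exact: normal_prob_setT.
  rewrite (@eq_measure_integral _ _ _ setT (dirac (m : measurableTypeR R)) law); last first.
    by move=> A mA _; apply: etrans (lawY A mA) _; rewrite s0 eqxx.
  by rewrite integral_dirac // diracT mul1e.
rewrite (@eq_measure_integral _ _ _ setT (normal_prob m s) law); last first.
  by move=> A mA _; apply: etrans (lawY A mA) _; rewrite (negbTE s0).
rewrite [RHS]ge0_integral_normal_prob //; last exact: (measurableT_comp mf).
apply: etrans (ge0_integral_normal_prob m s mf f0) _.
rewrite (ge0_integral_affine m s0); last 2 first.
- apply: emeasurable_funM => //; apply/measurable_EFinP; exact: measurable_normal_pdf.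
- by move=> x; rewrite mule_ge0 // lee_fin normal_pdf_ge0.
by apply: eq_integral => x _; rewrite -muleA -EFinM normal_pdf_affine.
Qed.
Lemma integral_normal_rv (Y : T -> R) : normal_rv P Y ->
  exists m s : R, forall f : R -> R, measurable_fun setT f ->
    (\int[P]_w (f (Y w))%:E = \int[gam]_x (f (m + s * x)%R)%:E)%E.
Proof.
move=> nY; have [m [s h]] := ge0_integral_normal_rv nY; exists m, s => f mf.
have mEf : measurable_fun setT (EFin \o f) by exact/measurable_EFinP.
rewrite integralE [RHS]integralE; congr (_ - _)%E.
- transitivity (\int[P]_w (EFin \o f)^\+ (Y w))%E.
    by apply: eq_integral => w _; rewrite !funeposE.
  rewrite (h _ (measurable_funepos mEf) (funepos_ge0 _)).
  by apply: eq_integral => x _; rewrite !funeposE.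
- transitivity (\int[P]_w (EFin \o f)^\- (Y w))%E.
    by apply: eq_integral => w _; rewrite !funenegE.
  rewrite (h _ (measurable_funeneg mEf) (funeneg_ge0 _)).
  by apply: eq_integral => x _; rewrite !funenegE.
Qed.

Lemma Rintegral_std_normal_poly2 (a b c : R) :
  \int[gam]_x (a + b * x + c * x ^+ 2) = a + c.
Proof.
have mf : measurable_fun setT (fun x : R => a + b * x + c * x ^+ 2).
  by do ![apply: measurable_funD => //|apply: measurable_funM => //].
rewrite Rintegral_std_normal //.
have := std_normal_poly4 a b c 0 0; rewrite mulr0 addr0 => <-.
by apply: eq_Rintegral => x _; rewrite !mul0r !addr0.
Qed.

Lemma integrable_std_normal_poly2 (a b c : R) :
  gam.-integrable setT (EFin \o (fun x => a + b * x + c * x ^+ 2)).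
Proof.
have mf : measurable_fun setT (fun x : R => a + b * x + c * x ^+ 2).
  by do ![apply: measurable_funD => //|apply: measurable_funM => //].
apply: integrable_normal_prob; first exact/measurable_EFinP.
have := integrable_std_normal_poly4 a b c 0 0.
by apply: eq_integrable => // x _ /=; rewrite !mul0r !addr0 EFinM.
Qed.

Lemma normal_rv_moments (Y : T -> R) : normal_rv P Y ->
  exists m s : R, [/\ P.-integrable setT (EFin \o Y),
    P.-integrable setT (EFin \o (fun w => Y w ^+ 2)),
    \int[P]_w Y w = m, \int[P]_w (Y w ^+ 2) = m ^+ 2 + s ^+ 2 &
    forall c, \int[P]_w cos (Y w + c) = expR (- (s ^+ 2 / 2)) * cos (m + c)].
Proof.
move=> nY; have [m [s h]] := integral_normal_rv nY; have [mY _] := nY.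
exists m, s.
have h2 : (\int[P]_w (Y w ^+ 2)%:E = (m ^+ 2 + s ^+ 2)%:E)%E.
  rewrite (h (fun y => y ^+ 2)); last exact: measurable_funX.
  rewrite -(Rintegral_std_normal_poly2 _ (2 * m * s)).
  rewrite /Rintegral fineK; last exact: (integrable_fin_num measurableT (integrable_std_normal_poly2 _ _ _)).
  by apply: eq_integral => x _; congr (_%:E); ring.
have i2 : P.-integrable setT (EFin \o (fun w => Y w ^+ 2)).
  apply/integrableP; split; first by apply/measurable_EFinP; exact: measurable_funX.
  under eq_integral do rewrite gee0_abs ?lee_fin ?sqr_ge0 //.
  by rewrite h2 ltry.
have i1 : P.-integrable setT (EFin \o Y).
  apply: (@le_integrable_real _ _ _ P _ (fun w => 1 + Y w ^+ 2)) => //.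
    move=> w; rewrite -[Y w ^+ 2]real_normK ?num_real //.
    by have := sqr_ge0 (`|Y w| - 1); have := normr_ge0 (Y w); nra.
  by apply: integrable_addr => //; exact: finite_measure_integrable_cst.
split => //.
- rewrite /Rintegral (h id) // -[RHS](addr0 m) -(Rintegral_std_normal_poly2 m s 0).
  by congr fine; apply: eq_integral => x _; rewrite mul0r addr0.
- by rewrite /Rintegral h2.
- move=> c; rewrite /Rintegral (h (fun y => cos (y + c))); last first.
    exact: (@measurable_cos_comp _ _ _ id).
  rewrite -std_normal_cos -Rintegral_std_normal; last first.
    by apply: measurable_cos_comp; exact: measurable_funM.
  by congr fine; apply: eq_integral => x _; congr (cos _)%:E; ring.
Qed.

End NormalRv.

(** Each linear functional of [X] is normal, with mean 0 by linearity and variance [quadf S u] by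
    expanding the square. Its one-dimensional cosine integral is then the required value; the joint
    law is not examined further. *)
Lemma normal_vector_cos_law (R : realType) (d : measure_display) (T : measurableType d)
    (P : probability T R) (n : nat) (X : T -> 'cV[R]_n) (S : 'M[R]_n) :
  normal_vector P X -> centered_vector P X -> is_covariance_mx P X S ->
  [/\ forall i, measurable_fun setT (fun w => X w i 0), S^T = S,
      forall u, 0 <= quadf S u & cos_law P X (quadf S)].
Proof.
move=> nX cX covX.
have coord i : normal_rv P (fun w => X w i 0).
  have := nX (delta_mx i 0); congr (normal_rv P _); apply/funext => w.
  rewrite (bigD1 i) //= mxE !eqxx mul1r big1 ?addr0 // => j ji.
  by rewrite mxE (negbTE ji) mul0r.
have mX i : measurable_fun setT (fun w => X w i 0) by have [] := coord i.
have iX i : P.-integrable setT (EFin \o (fun w => X w i 0)).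
  by have [m [s []]] := normal_rv_moments (coord i).
have iX2 i : P.-integrable setT (EFin \o (fun w => X w i 0 ^+ 2)).
  by have [m [s []]] := normal_rv_moments (coord i).
have EX i : \int[P]_w X w i 0 = 0.
  by have := cX i; rewrite unlock /Rintegral => ->.
have iXX i j : P.-integrable setT (EFin \o (fun w => X w i 0 * X w j 0)).
  apply: (@le_integrable_real _ _ _ P _ (fun w => X w i 0 ^+ 2 + X w j 0 ^+ 2)).
  - exact: measurable_funM.
  - move=> w; rewrite normrM -[X w i 0 ^+ 2]real_normK ?num_real //.
    rewrite -[X w j 0 ^+ 2]real_normK ?num_real //.
    have := sqr_ge0 (`|X w i 0| - `|X w j 0|).
    by have := sqr_ge0 `|X w i 0|; have := sqr_ge0 `|X w j 0|; nra.
  - exact: integrable_addr.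
have EXX i j : \int[P]_w (X w i 0 * X w j 0) = S i j.
  have := covX i j; rewrite covariance.unlock !cX /=.
  rewrite unlock => E; rewrite /Rintegral; rewrite -[RHS]/(fine (S i j)%:E) -E; congr fine.
  by apply: eq_integral => w _; congr (_%:E); rewrite !fctE /= !subr0.
have moments u : exists s : R, quadf S u = s ^+ 2 /\
    forall c, \int[P]_w cos (dotv u (X w) + c) = expR (- (s ^+ 2 / 2)) * cos c.
  have [m [s [i1 i2 E1 E2 Ecos]]] := normal_rv_moments (nX u).
  have m0 : m = 0.
    rewrite -E1 Rintegral_sum; last by move=> i; exact: integrable_mulrl.
    by rewrite big1 // => i _; rewrite RintegralZl // EX mulr0.
  exists s; split; last first.
    by move=> c; have := Ecos c; rewrite m0 add0r.
  rewrite m0 expr0n add0r in E2; rewrite -E2.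
  transitivity (\int[P]_w (\sum_i \sum_j (u i 0 * u j 0) * (X w i 0 * X w j 0))); last first.
    apply: eq_Rintegral => w _; rewrite expr2 mulr_suml; apply: eq_bigr => i _.
    by rewrite mulr_sumr; apply: eq_bigr => j _; ring.
  rewrite Rintegral_sum; last first.
    by move=> i; apply: integrable_sum_real => j; exact: integrable_mulrl.
  apply: eq_bigr => i _; rewrite Rintegral_sum; last by move=> j; exact: integrable_mulrl.
  by apply: eq_bigr => j _; rewrite RintegralZl // EXX; ring.
split => //.
- by apply/matrixP => i j; rewrite mxE -!EXX; apply: eq_Rintegral => w _; rewrite mulrC.
- by move=> u; have [s [-> _]] := moments u; exact: sqr_ge0.
- by move=> u c; have [s [-> h]] := moments u; exact: h.
Qed.

(** * Quadratic functions of a planar Gaussian vector *)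

Section InverseQuadratic.
Context {R : realType}.
Local Notation mu := (@lebesgue_measure R).

Lemma integral_oneDsqrV : (\int[mu]_x (1 + x ^+ 2)^-1%:E = (pi : R)%:E)%E.
Proof.
have c : continuous (fun x : R => (1 + x ^+ 2)^-1).
  by move=> x; exact: continuous_oneDsqrV.
rewrite (ge0_symfun_integralT _ c); last 2 first.
- by move=> x; rewrite invr_ge0 addr_ge0 ?sqr_ge0.
- by move=> x /=; rewrite sqrrN.
have -> : [set x : R | 0 <= x] = `[0, +oo[%classic.
  by apply/seteqP; split=> x /=; rewrite in_itv /= andbT.
by rewrite [X in (_ * X)%E]integral0y_oneDsqr -EFinM; congr EFin; field.
Qed.

(** Completing the square, the affine substitution x = b / D + (c / D) t reduces the integrand to a
    multiple of 1 / (1 + x^2). *)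
Lemma integral_quadraticV (a b c : R) : 0 < c -> 0 < a * c - b ^+ 2 ->
  (\int[mu]_t (a + 2 * b * t + c * t ^+ 2)^-1%:E = (pi / Num.sqrt (a * c - b ^+ 2))%:E)%E.
Proof.
move=> c0 det0; set D := Num.sqrt _.
have D0 : 0 < D by rewrite sqrtr_gt0.
have DD : D ^+ 2 = a * c - b ^+ 2 by rewrite sqr_sqrtr // ltW.
have k0 : c / D != 0 by rewrite gt_eqF ?divr_gt0.
have mf : measurable_fun setT (fun x : R => ((1 + x ^+ 2)^-1)%:E).
  apply/measurable_EFinP; apply: continuous_measurable_fun => x.
  exact: continuous_oneDsqrV.
have f0 (x : R) : (0 <= ((1 + x ^+ 2)^-1)%:E)%E.
  by rewrite lee_fin invr_ge0 addr_ge0 ?sqr_ge0.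
have := ge0_integral_affine (b / D) k0 mf f0; rewrite integral_oneDsqrV => E.
rewrite [in RHS]mulrC EFinM E -ge0_integralZl ?lee_fin ?invr_ge0 ?(ltW D0) //=; last 2 first.
- apply: emeasurable_funM => //; apply: (measurableT_comp mf).
  by apply: measurable_funD => //; apply: measurable_funM.
- by move=> x _; rewrite mule_ge0 // f0.
apply: eq_integral => t _; rewrite -!EFinM; congr EFin.
rewrite (gtr0_norm (divr_gt0 c0 D0)).
have h : a + 2 * b * t + c * t ^+ 2 = (D ^+ 2 / c) * (1 + (b / D + c / D * t) ^+ 2).
  rewrite DD; have -> : (b / D + c / D * t) ^+ 2 = (b + c * t) ^+ 2 / (a * c - b ^+ 2).
    by rewrite -DD; field; rewrite gt_eqF.
  by field; rewrite !gt_eqF.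
rewrite h; have p : 0 < 1 + (b / D + c / D * t) ^+ 2 by rewrite ltr_pwDl ?sqr_ge0.
move: p; set w := 1 + _ => w0; by field; rewrite !gt_eqF.
Qed.

End InverseQuadratic.

Section SlopeBound.
Context {R : realType}.
Local Notation mu := (@lebesgue_measure R).
Variables (psi psi' : R -> R).
Hypothesis dpsi : forall t, is_derive t (1 : R) psi (psi' t).
Hypothesis cpsi' : continuous psi'.
Hypothesis psi_le1 : forall t, 0 <= t -> `|psi t| <= 1.

Let continuous_quad (k c : R) : continuous (fun s : R => k * s ^+ 2 + c).
Proof.
move=> s; apply: cvgD; last exact: cvg_cst.
by apply: cvgM; [exact: cvg_cst|exact: exprn_continuous].
Qed.

(** [eps] is the sign of s on the half line, so eps * s is |s|. The antiderivative [F] is normalized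
    to vanish at 0, which leaves a boundary term at one end only, and |F| <= 1 / k follows from
    |psi| <= 1 without any bound on [psi']. *)
Let half_line_bound (k c B eps a b : R) (H h : R -> R) :
  0 < k -> 0 <= c -> `|eps| = 1 -> a <= b -> (a == 0) || (b == 0) ->
  (forall x, is_derive x (1 : R) H (h x)) -> continuous h ->
  (forall x, `|H x| <= B) ->
  `|\int[mu]_(s in `[a, b]) (eps * s * psi' (k * s ^+ 2 + c) * H s)|
    <= k^-1 * (B + \int[mu]_(s in `[a, b]) `|h s|).
Proof.
move=> k0 c0 eps1 ab ab0 dH ch HB.
have cq := @continuous_quad k c.
pose F s := eps * (psi (k * s ^+ 2 + c) - psi c) / (2 * k).
have q0 s : 0 <= k * s ^+ 2 + c by rewrite addr_ge0 // mulr_ge0 ?sqr_ge0 // ltW.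
have F_le s : `|F s| <= k^-1.
  rewrite /F normrM normrM eps1 mul1r normfV (gtr0_norm (mulr_gt0 _ k0)) //.
  rewrite invfM mulrA ler_piMl ?invr_ge0 ?(ltW k0) // ler_pdivrMr // mul1r.
  by rewrite (le_trans (ler_normB _ _)) // -[2]/(1 + 1) lerD ?psi_le1.
have dF s : is_derive s (1 : R) F (eps * s * psi' (k * s ^+ 2 + c)).
  have -> : F = cst eps * (psi \o (cst k * id ^+ 2 + cst c) - cst (psi c)) * cst ((2 * k)^-1) by [].
  have dp := dpsi ((cst k * id ^+ 2 + cst c) s).
  apply: is_derive_eq; rewrite /GRing.scale /= /cst !fctE /=.
  by field; rewrite gt_eqF.
have cf : continuous (fun s => eps * s * psi' (k * s ^+ 2 + c)).
  move=> s; apply: cvgM; first by apply: cvgM; [exact: cvg_cst|exact: cvg_id].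
  by apply: (continuous_comp (cq s)); exact: cpsi'.
have := Rintegral_parts_le ab dF cf dH ch => /le_trans; apply.
have F0 : F 0 = 0 by rewrite /F expr0n mulr0 add0r subrr mulr0 mul0r.
have cF := is_derive_continuous dF; have cH := is_derive_continuous dH.
rewrite mulrDr lerD //.
  have b1 s : `|F s * H s| <= k^-1 * B by rewrite normrM ler_pM.
  case/orP: ab0 => /eqP ->; first by rewrite F0 mul0r subr0.
  by rewrite F0 mul0r sub0r normrN.
have cnh : continuous (fun s => `|h s|) by move=> s; apply: cvg_norm; exact: ch.
rewrite -RintegralZl //; last exact: continuous_itv_integrable.
apply: le_Rintegral => //.
- apply: continuous_itv_integrable => s; apply: cvg_norm; apply: cvgM; [exact: cF|exact: ch].
- by apply: continuous_itv_integrable => s; apply: cvgM; [exact: cvg_cst|exact: cnh].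
- by move=> s _; rewrite normrM ler_wpM2r.
Qed.

(** The weight |s|, a Jacobian in the application, makes |s| psi'(k s^2 + c) an exact derivative on
    each half line. The two outer boundary terms account for 2 B. *)
Lemma line_bound (k c B V : R) (H h : R -> R) :
  0 < k -> 0 <= c ->
  (forall x, is_derive x (1 : R) H (h x)) -> continuous h ->
  (forall x, `|H x| <= B) -> (\int[mu]_x `|h x|%:E <= V%:E)%E ->
  mu.-integrable setT (EFin \o (fun s => `|s| * psi' (k * s ^+ 2 + c) * H s)) ->
  `|\int[mu]_s (`|s| * psi' (k * s ^+ 2 + c) * H s)| <= k^-1 * (2 * B + V).
Proof.
move=> k0 c0 dH ch HB hV intL; apply: Rintegral_norm_le_itv => // n.
pose f s := `|s| * psi' (k * s ^+ 2 + c) * H s.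
have cH := is_derive_continuous dH.
have cf : continuous f.
  move=> s; apply: cvgM; last exact: cH.
  apply: cvgM; first by apply: cvg_norm; exact: cvg_id.
  by apply: (continuous_comp (@continuous_quad k c s)); exact: cpsi'.
have cnh : continuous (fun s => `|h s|) by move=> s; apply: cvg_norm; exact: ch.
have n0 : 0 <= n%:R :> R by [].
have split (g : R -> R) : continuous g ->
    \int[mu]_(s in `[- n%:R, n%:R]) g s =
    \int[mu]_(s in `[- n%:R, 0]) g s + \int[mu]_(s in `[0, n%:R]) g s.
  move=> cg; rewrite -[X in _ + X]Rintegral_itv_obnd_cbnd; last first.
    by apply: integrableS (continuous_itv_integrable 0 n%:R cg) => //; exact: subset_itv_oc_cc.
  rewrite -(@Rintegral_itvB _ g (BLeft (- n%:R)) (BRight n%:R) 0).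
  - by rewrite addrC subrK.
  - exact: continuous_itv_integrable.
  - by rewrite bnd_simp oppr_le0.
  - by rewrite bnd_simp.
have Vn : \int[mu]_(s in `[- n%:R, n%:R]) `|h s| <= V.
  rewrite -lee_fin; apply: le_trans hV; rewrite /Rintegral fineK; last first.
    exact: (integrable_fin_num _ (continuous_itv_integrable _ _ cnh)).
  apply: ge0_subset_integral => //.
  by apply/measurable_EFinP; exact: continuous_measurable_fun.
rewrite [X in `|X|](split f cf) (le_trans (ler_normD _ _)) //.
apply: (@le_trans _ _ (k^-1 * (B + \int[mu]_(s in `[- n%:R, 0]) `|h s|) +
                       k^-1 * (B + \int[mu]_(s in `[0, n%:R]) `|h s|))); last first.
  rewrite -mulrDr ler_wpM2l ?invr_ge0 ?(ltW k0) //.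
  by rewrite addrACA -split // (_ : B + B = 2 * B) ?lerD2l //; ring.
apply: lerD.
- have := @half_line_bound k c B (-1) (- n%:R) 0 H h k0 c0.
  rewrite normrN1 oppr_le0 eqxx orbT => /(_ erefl n0 isT dH ch HB); apply: le_trans.
  rewrite le_eqVlt; apply/orP; left; apply/eqP; congr (`| _ |).
  apply: eq_Rintegral => s; rewrite inE /= in_itv /= => /andP[_ s0].
  by rewrite /f ler0_norm // mulN1r.
- have := @half_line_bound k c B 1 0 n%:R H h k0 c0.
  rewrite normr1 eqxx => /(_ erefl n0 isT dH ch HB); apply: le_trans.
  rewrite le_eqVlt; apply/orP; left; apply/eqP; congr (`| _ |).
  apply: eq_Rintegral => s; rewrite inE /= in_itv /= => /andP[s0 _].
  by rewrite /f ger0_norm // mul1r.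
Qed.

End SlopeBound.

Lemma integrable_prodM (R : realType) (d1 d2 : measure_display)
    (T1 : measurableType d1) (T2 : measurableType d2)
    (m1 : {sigma_finite_measure set T1 -> \bar R})
    (m2 : {sigma_finite_measure set T2 -> \bar R}) (f : T1 -> R) (g : T2 -> R) :
  m1.-integrable setT (EFin \o f) -> m2.-integrable setT (EFin \o g) ->
  (m1 \x m2)%E.-integrable setT (EFin \o (fun z => f z.1 * g z.2)%R).
Proof.
move=> intf intg.
have mf := integrable_real_measurable intf; have mg := integrable_real_measurable intg.
have mfg : measurable_fun setT (EFin \o (fun z : T1 * T2 => f z.1 * g z.2)%R).
  apply/measurable_EFinP; apply: measurable_funM.
    by apply: (measurableT_comp mf).
  by apply: (measurableT_comp mg).
apply: (@integrable12ltyP _ _ _ _ R m1 m2 _ mfg).2.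
under eq_integral => x _.
  under eq_integral => y _ do rewrite /= normrM EFinM.
  rewrite ge0_integralZl //=; last first.
    by apply/measurable_EFinP; apply: measurableT_comp.
  over.
rewrite ge0_integralZr //=; last 2 first.
- by apply/measurable_EFinP; apply: measurableT_comp.
- exact: integral_ge0.
case/integrableP: intf => _ f1; case/integrableP: intg => _ g1.
by rewrite lte_mul_pinfty ?integral_ge0 // ge0_fin_numE // integral_ge0.
Qed.

(** * Integration over the lines through a point of the plane *)

Section SlopeChange.
Context {R : realType}.
Local Notation mu := (@lebesgue_measure R).
Local Open Scope ereal_scope.

Lemma measurable_slope_map (x0 y0 : R) :
  measurable_fun setT (fun z : R * R => (x0 + z.1, y0 + z.1 * z.2)%R).
Proof.
by apply: measurable_fun_pair; apply: measurable_funD => //; apply: measurable_funM.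
Qed.

(* The substitution [x = x0 + s, y = y0 + s t], with Jacobian [|s|], parametrizes
   the lines through [(x0, y0)] by their slope [t]. *)
Lemma ge0_integral_slope (K : R * R -> \bar R) (x0 y0 : R) :
  measurable_fun setT K -> (forall z, 0 <= K z) ->
  \int[mu \x mu]_z K z =
  \int[mu \x mu]_z (K (x0 + z.1, y0 + z.1 * z.2)%R * `|z.1|%:E).
Proof.
move=> mK K0; have mS := measurable_slope_map x0 y0.
have mL : measurable_fun setT (fun z : R * R => K (x0 + z.1, y0 + z.1 * z.2)%R * `|z.1|%:E).
  apply: emeasurable_funM; first exact: (measurableT_comp mK mS).
  by apply/measurable_EFinP; apply: measurableT_comp => //; exact: measurable_fst.
have L0 z : 0 <= K (x0 + z.1, y0 + z.1 * z.2)%R * `|z.1|%:E by rewrite mule_ge0.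
rewrite !fubini_tonelli1 //.
have mF := measurable_fun_fubini_tonelli_F K mK K0 (m2 := mu).
rewrite (ge0_integral_affine x0 (oner_neq0 R) mF); last first.
  by move=> x; exact: integral_ge0.
apply: ae_eq_integral => //.
- apply: emeasurable_funM => //; apply: (measurableT_comp mF).
  by apply: measurable_funD => //; apply: measurable_funM.
- exact: (measurable_fun_fubini_tonelli_F _ mL L0 (m2 := mu)).
(* The substitution y = y0 + s t degenerates at s = 0 only, a null set. *)
exists [set 0%R]; split => //; first exact: lebesgue_measure_set1.
move=> s /= h; apply: contrapT => s0; apply: h => _.
rewrite normr1 mule1 mul1r /fubini_F.
rewrite (ge0_integral_affine y0 (k := s)) //; first by apply/eqP.
exact: measurable_fun_pair2.
Qed.

Lemma integral_slope (K : R * R -> \bar R) (x0 y0 : R) : measurable_fun setT K ->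
  \int[mu \x mu]_z K z =
  \int[mu \x mu]_z (K (x0 + z.1, y0 + z.1 * z.2)%R * `|z.1|%:E).
Proof.
move=> mK; rewrite integralE [RHS]integralE.
rewrite (@funeposMr R _ (fun z : R * R => K (x0 + z.1, y0 + z.1 * z.2)%R) (fun z => `|z.1|%R)) //.
rewrite (@funenegMr R _ (fun z : R * R => K (x0 + z.1, y0 + z.1 * z.2)%R) (fun z => `|z.1|%R)) //.
rewrite (ge0_integral_slope x0 y0 (measurable_funepos mK) (funepos_ge0 _)).
rewrite (ge0_integral_slope x0 y0 (measurable_funeneg mK) (funeneg_ge0 _)).
by congr (_ - _); apply: eq_integral => z _; rewrite ?funeposE ?funenegE.
Qed.

Lemma integrable_slope (K : R * R -> R) (x0 y0 : R) :
  (mu \x mu).-integrable setT (EFin \o K) ->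
  (mu \x mu).-integrable setT
    (EFin \o (fun z => K (x0 + z.1, y0 + z.1 * z.2)%R * `|z.1|)%R).
Proof.
move=> /integrableP[/measurable_EFinP mK intK]; apply/integrableP; split.
  apply/measurable_EFinP; apply: measurable_funM.
    exact: (measurableT_comp mK (measurable_slope_map x0 y0)).
  by apply: measurableT_comp => //; exact: measurable_fst.
apply: le_lt_trans intK.
rewrite [leRHS](ge0_integral_slope x0 y0) //; last first.
  by apply: measurableT_comp => //; apply/measurable_EFinP.
rewrite le_eqVlt; apply/orP; left; apply/eqP; apply: eq_integral => z _.
by rewrite /= -EFinM normrM normr_id.
Qed.

Lemma integrable_shift (f : R -> R) (x0 : R) : mu.-integrable setT (EFin \o f) ->
  mu.-integrable setT (EFin \o (fun s => f (x0 + s)%R)).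
Proof.
move=> /integrableP[/measurable_EFinP mf intf]; apply/integrableP; split.
  by apply/measurable_EFinP; apply: (measurableT_comp mf); exact: measurable_funD.
apply: le_lt_trans intf; rewrite [leRHS](ge0_integral_affine x0 (oner_neq0 R)) //; last first.
  by apply/measurable_EFinP; apply: measurableT_comp.
rewrite le_eqVlt; apply/orP; left; apply/eqP; apply: eq_integral => s _.
by rewrite /= normr1 mule1 mul1r.
Qed.

End SlopeChange.

Section QuadraticSlope.
Context {R : realType}.
Local Notation mu := (@lebesgue_measure R).

Definition quad2 (a b c p q r : R) (x y : R) : R :=
  a * x ^+ 2 + 2 * b * x * y + c * y ^+ 2 + 2 * p * x + 2 * q * y + r.

(** (x0, y0) is the critical point, so on every line through it the linear term in s disappears. *)
Lemma quad2_center (a b c p q r s t : R) : a * c - b ^+ 2 != 0 ->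
  let x0 := (b * q - c * p) / (a * c - b ^+ 2) in
  let y0 := (b * p - a * q) / (a * c - b ^+ 2) in
  quad2 a b c p q r (x0 + s) (y0 + s * t) =
  (a + 2 * b * t + c * t ^+ 2) * s ^+ 2 + quad2 a b c p q r x0 y0.
Proof. by move=> det0 x0 y0; rewrite /quad2 /x0 /y0; field. Qed.

Lemma measurable_quad2 (a b c p q r : R) :
  measurable_fun setT (fun z : R * R => quad2 a b c p q r z.1 z.2).
Proof.
by rewrite /quad2; repeat (apply: measurable_funD || apply: measurable_funM || apply: measurable_funX) => //.
Qed.

(** Product rule along the line. The factor t of the inner derivative is the Jacobian of y = y0 + s
    t, so the variation of [v] along the line does not depend on the slope; this makes the bound
    uniform in t. *)
Lemma line_variation (u u' v v' : R -> R) (Su Sv Vu Vv x0 y0 t : R) :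
  continuous u -> continuous v -> continuous u' -> continuous v' ->
  (forall x, `|u x| <= Su) -> (forall x, `|v x| <= Sv) ->
  (\int[mu]_x `|u' x|%:E <= Vu%:E)%E -> (\int[mu]_x `|v' x|%:E <= Vv%:E)%E ->
  (\int[mu]_s `|u' (x0 + s) * v (y0 + s * t) + u (x0 + s) * (v' (y0 + s * t) * t)|%:E
    <= (Su * Vv + Sv * Vu)%:E)%E.
Proof.
move=> cu cv cu' cv' uS vS uV vV.
have Su0 : 0 <= Su by apply: le_trans (uS 0).
have Sv0 : 0 <= Sv by apply: le_trans (vS 0).
have mu' : measurable_fun setT (fun x => `|u' x|%:E).
  apply/measurable_EFinP; apply: continuous_measurable_fun => x; apply: cvg_norm; exact: cu'.
have mv' : measurable_fun setT (fun x => `|v' x|%:E).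
  apply/measurable_EFinP; apply: continuous_measurable_fun => x; apply: cvg_norm; exact: cv'.
have mu'0 : measurable_fun setT (fun s : R => `|u' (x0 + s)|%:E).
  by apply: (measurableT_comp mu'); exact: measurable_funD.
have mv't : measurable_fun setT (fun s : R => (`|v' (y0 + s * t)| * `|t|)%:E).
  under eq_fun do rewrite EFinM.
  apply: emeasurable_funM => //; apply: (measurableT_comp mv').
  by apply: measurable_funD => //; apply: measurable_funM.
have Eu : (\int[mu]_s `|u' (x0 + s)|%:E = \int[mu]_x `|u' x|%:E)%E.
  rewrite [RHS](ge0_integral_affine x0 (oner_neq0 R)) //.
  by apply: eq_integral => s _; rewrite normr1 mule1 mul1r.
have Ev : (\int[mu]_s (`|v' (y0 + s * t)| * `|t|)%:E <= \int[mu]_x `|v' x|%:E)%E.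
  have [->|t0] := eqVneq t 0.
    under eq_integral do rewrite normr0 mulr0.
    by rewrite integral0; apply: integral_ge0.
  rewrite [leRHS](ge0_integral_affine y0 t0) //.
  rewrite le_eqVlt; apply/orP; left; apply/eqP; apply: eq_integral => s _.
  by rewrite EFinM (mulrC s).
apply: (@le_trans _ _ (\int[mu]_s (Sv%:E * `|u' (x0 + s)|%:E + Su%:E * (`|v' (y0 + s * t)| * `|t|)%:E))%E).
  apply: ge0_le_integral => //.
  - apply/measurable_EFinP; apply: measurableT_comp => //; apply: measurable_funD.
      by apply: measurable_funM; [apply: (measurableT_comp (continuous_measurable_fun cu'))
        |apply: (measurableT_comp (continuous_measurable_fun cv))]; do ![apply: measurable_funD => //|apply: measurable_funM => //].
    apply: measurable_funM; first by apply: (measurableT_comp (continuous_measurable_fun cu)); exact: measurable_funD.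
    apply: measurable_funM => //; apply: (measurableT_comp (continuous_measurable_fun cv')).
    by apply: measurable_funD => //; exact: measurable_funM.
  - by apply: emeasurable_funD; apply: emeasurable_funM.
  - move=> s _; rewrite -!EFinM -EFinD lee_fin (le_trans (ler_normD _ _)) // !normrM.
    rewrite lerD //; first by rewrite mulrC ler_wpM2r.
    by rewrite ler_wpM2r ?mulr_ge0.
rewrite ge0_integralD //; last 4 first.
- by move=> s _; rewrite mule_ge0.
- exact: emeasurable_funM.
- by move=> s _; rewrite mule_ge0 // lee_fin mulr_ge0.
- exact: emeasurable_funM.
rewrite !ge0_integralZl ?lee_fin //=.
rewrite Eu addrC EFinD !EFinM leeD //; apply: lee_wpmul2l; rewrite ?lee_fin //.
exact: le_trans Ev vV.
Qed.

(** The factor |s| <= |x + s| + |x| is traded for translates of integrable functions. *)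
Lemma line_integrand_le (s t w z x m S : R) : `|t| <= m -> `|z| <= S ->
  `| `|s| * t * (w * z)| <= (m * S) * (`|(x + s) * w| + `|x| * `|w|).
Proof.
move=> tm zS; have m0 := le_trans (normr_ge0 t) tm.
have S0 := le_trans (normr_ge0 z) zS.
rewrite !normrM normr_id.
have h2 : `|s| * `|w| <= `|x + s| * `|w| + `|x| * `|w|.
  rewrite -mulrDl ler_wpM2r //; have := ler_normB (x + s) x.
  by rewrite addrAC subrr add0r.
apply: (@le_trans _ _ (m * S * (`|s| * `|w|))); last by rewrite ler_wpM2l ?mulr_ge0.
have -> : `|s| * `|t| * (`|w| * `|z|) = (`|t| * `|z|) * (`|s| * `|w|) by ring.
by rewrite ler_wpM2r ?mulr_ge0 // ler_pM.
Qed.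

Section Bound.
Variables (psi psi' : R -> R) (M : R).
Hypothesis dpsi : forall t, is_derive t (1 : R) psi (psi' t).
Hypothesis cpsi' : continuous psi'.
Hypothesis psi_le1 : forall t, 0 <= t -> `|psi t| <= 1.
Hypothesis psi'_leM : forall t, 0 <= t -> `|psi' t| <= M.

(** On the line of slope t, [line_bound] gives B / k t, where k t = a + 2 b t + c t^2 is the
    curvature of the quadratic function there; integrating 1 / k over the slopes gives pi / sqrt(a c
    - b^2). The bound [M] on [psi'] serves integrability and does not enter the estimate. *)
Lemma slope_bound (a b c p q r : R) (u u' v v' : R -> R) (Su Sv Vu Vv : R) :
  0 < c -> 0 < a * c - b ^+ 2 -> (forall x y, 0 <= quad2 a b c p q r x y) ->
  (forall x, is_derive x (1 : R) u (u' x)) -> continuous u' ->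
  (forall x, is_derive x (1 : R) v (v' x)) -> continuous v' ->
  (forall x, `|u x| <= Su) -> (forall x, `|v x| <= Sv) ->
  (\int[mu]_x `|u' x|%:E <= Vu%:E)%E -> (\int[mu]_x `|v' x|%:E <= Vv%:E)%E ->
  mu.-integrable setT (EFin \o u) -> mu.-integrable setT (EFin \o v) ->
  mu.-integrable setT (EFin \o (fun x => x * u x)) ->
  `|\int[(mu \x mu)%E]_z (psi' (quad2 a b c p q r z.1 z.2) * (u z.1 * v z.2))|
    <= pi / Num.sqrt (a * c - b ^+ 2) * (2 * (Su * Sv) + (Su * Vv + Sv * Vu)).
Proof.
move=> c0 det0 f0 du cu' dv cv' uS vS uV vV intu intv intxu.
have cu := is_derive_continuous du; have cv := is_derive_continuous dv.
have Su0 : 0 <= Su by apply: le_trans (uS 0).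
have Sv0 : 0 <= Sv by apply: le_trans (vS 0).
have M0 : 0 <= M by apply: le_trans (psi'_leM (lexx 0)).
pose K (z : R * R) := psi' (quad2 a b c p q r z.1 z.2) * (u z.1 * v z.2).
have mK : measurable_fun setT K.
  apply: measurable_funM; first exact: (measurableT_comp (continuous_measurable_fun cpsi') (measurable_quad2 _ _ _ _ _ _)).
  by apply: measurable_funM; [apply: (measurableT_comp (continuous_measurable_fun cu))
    |apply: (measurableT_comp (continuous_measurable_fun cv))].
have intK : (mu \x mu)%E.-integrable setT (EFin \o K).
  apply: (@le_integrable_real _ _ _ (mu \x mu)%E _ (fun z => M * (`|u z.1| * `|v z.2|))) => //.
    by move=> z; rewrite /K !normrM ler_wpM2r ?mulr_ge0 ?psi'_leM.
  apply: integrable_mulrl.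
  by apply: (@integrable_prodM _ _ _ _ _ mu mu (fun x => `|u x|) (fun x => `|v x|)); exact: integrable_norm.
pose x0 := (b * q - c * p) / (a * c - b ^+ 2).
pose y0 := (b * p - a * q) / (a * c - b ^+ 2).
pose c1 := quad2 a b c p q r x0 y0.
pose k t := a + 2 * b * t + c * t ^+ 2.
have k0 t : 0 < k t.
  have : 0 < c * k t.
    have -> : c * k t = (c * t + b) ^+ 2 + (a * c - b ^+ 2) by rewrite /k; ring.
    by rewrite ltr_wpDl ?sqr_ge0.
  by rewrite pmulr_rgt0.
pose B := 2 * (Su * Sv) + (Su * Vv + Sv * Vu).
have intL := integrable_slope x0 y0 intK.
set L := (fun z : R * R => _ * `|z.1|) in intL.
have LE s t : L (s, t) = `|s| * psi' (k t * s ^+ 2 + c1) * (u (x0 + s) * v (y0 + s * t)).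
  by rewrite /L /K /= quad2_center ?gt_eqF // -/(k t) -/c1; ring.
have intLs t : mu.-integrable setT (EFin \o (fun s => `|s| * psi' (k t * s ^+ 2 + c1) * (u (x0 + s) * v (y0 + s * t)))).
  apply: (@le_integrable_real _ _ _ mu _ (fun s => (M * Sv) * (`|(x0 + s) * u (x0 + s)| + `|x0| * `|u (x0 + s)|))).
  - under eq_fun do rewrite -LE.
    exact: (measurableT_comp (integrable_real_measurable intL)).
  - move=> s; apply: line_integrand_le => //.
    by apply: psi'_leM; rewrite -quad2_center ?gt_eqF.
  - apply: integrable_mulrl; apply: integrable_addr.
      exact: (integrable_shift x0 (integrable_norm intxu)).
    apply: integrable_mulrl; exact: (integrable_shift x0 (integrable_norm intu)).
have inner t : (`|\int[mu]_s (L (s, t))%:E| <= (B * (k t)^-1)%:E)%E.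
  under eq_integral do rewrite LE.
  rewrite -(EFin_normr_Rintegral _ (intLs t)) // lee_fin mulrC.
  apply: (@line_bound _ psi psi' dpsi cpsi' psi_le1 (k t) c1 (Su * Sv) (Su * Vv + Sv * Vu)
    (fun s => u (x0 + s) * v (y0 + s * t))
    (fun s => u' (x0 + s) * v (y0 + s * t) + u (x0 + s) * (v' (y0 + s * t) * t))) => //.
  - exact: f0.
  - move=> s.
    have -> : (fun s => u (x0 + s) * v (y0 + s * t)) =
      (u \o (cst x0 + id)) * (v \o (cst y0 + id * cst t)) by [].
    have dus := du ((cst x0 + id) s); have dvs := dv ((cst y0 + id * cst t) s).
    by apply: is_derive_eq; rewrite /GRing.scale /= /cst !fctE /=; ring.
  - have cx : continuous (fun s : R => x0 + s) by move=> s; apply: cvgD; [exact: cvg_cst|exact: cvg_id].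
    have cy : continuous (fun s : R => y0 + s * t).
      by move=> s; apply: cvgD; [exact: cvg_cst|apply: cvgM; [exact: cvg_id|exact: cvg_cst]].
    move=> s; apply: cvgD; apply: cvgM.
    + by apply: (continuous_comp (cx s)); exact: cu'.
    + by apply: (continuous_comp (cy s)); exact: cv.
    + by apply: (continuous_comp (cx s)); exact: cu.
    + by apply: cvgM; [apply: (continuous_comp (cy s)); exact: cv'|exact: cvg_cst].
  - by move=> s; rewrite normrM ler_pM.
  - exact: line_variation.
have mk : measurable_fun setT (fun t => (k t)^-1).
  apply: continuous_measurable_fun => t; apply: cvgV; first by rewrite gt_eqF.
  apply: cvgD; last by apply: cvgM; [exact: cvg_cst|exact: exprn_continuous].
  by apply: cvgD; [exact: cvg_cst|apply: cvgM; [exact: cvg_cst|exact: cvg_id]].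
have B0 : 0 <= B.
  have := inner 0; move=> /(le_trans (abse_ge0 _)); rewrite lee_fin => h.
  by move: h; rewrite pmulr_lge0 // invr_gt0.
rewrite -lee_fin (EFin_normr_Rintegral measurableT intK).
rewrite [X in `|X|%E](integral_slope x0 y0); last exact/measurable_EFinP.
rewrite -[X in `|X|%E](integral21_prod_meas1 (m1 := mu) (m2 := mu) intL).
apply: le_trans (le_abse_integral _ _ _) _ => //.
  exact: (measurable_fubini_G intL).
apply: (@le_trans _ _ (\int[mu]_t (B%:E * (k t)^-1%:E))%E).
  apply: ge0_le_integral => //.
  - by apply: measurableT_comp => //; exact: (measurable_fubini_G intL).
  - apply: emeasurable_funM => //; exact/measurable_EFinP.
  - by move=> t _; rewrite -EFinM; exact: inner.
rewrite ge0_integralZl ?lee_fin //; last 2 first.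
- exact/measurable_EFinP.
- by move=> t _; rewrite lee_fin invr_ge0 ltW.
by rewrite /k integral_quadraticV // -EFinM mulrC.
Qed.

End Bound.

End QuadraticSlope.

Section GaussianPlane.
Context {R : realType}.
Local Notation mu := (@lebesgue_measure R).
Local Notation rho := (@normal_pdf R 0 1).
Local Notation gam := (normal_prob (0 : R) 1).
Local Notation gam2 := (gam \x gam)%E.

Lemma ge0_integral_normal_prod (K : R * R -> \bar R) :
  measurable_fun setT K -> (forall z, 0 <= K z)%E ->
  (\int[gam2]_z K z = \int[mu \x mu]_z (K z * (rho z.1 * rho z.2)%:E))%E.
Proof.
move=> mK K0.
have mK2 : measurable_fun setT (fun z => K z * (rho z.1 * rho z.2)%:E)%E.
  apply: emeasurable_funM => //; apply/measurable_EFinP; apply: measurable_funM.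
    by apply: (measurableT_comp (measurable_normal_pdf 0 1)).
  by apply: (measurableT_comp (measurable_normal_pdf 0 1)).
have K20 z : (0 <= K z * (rho z.1 * rho z.2)%:E)%E.
  by rewrite mule_ge0 // lee_fin mulr_ge0 // normal_pdf_ge0.
rewrite !fubini_tonelli1 // ge0_integral_normal_prob //; last 2 first.
- exact: (measurable_fun_fubini_tonelli_F _ mK K0 (m2 := gam)).
- by move=> x; exact: integral_ge0.
apply: eq_integral => x _; rewrite /fubini_F.
rewrite ge0_integral_normal_prob //; last exact: (measurableT_comp mK).
rewrite -ge0_integralZr //=; last 3 first.
- apply: emeasurable_funM; first exact: (measurableT_comp mK).
  by apply/measurable_EFinP; exact: measurable_normal_pdf.
- by move=> y _; rewrite mule_ge0 // lee_fin normal_pdf_ge0.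
- by rewrite lee_fin normal_pdf_ge0.
by apply: eq_integral => y _; rewrite -muleA -EFinM mulrC.
Qed.

Lemma integral_normal_prod (K : R * R -> \bar R) : measurable_fun setT K ->
  (\int[gam2]_z K z = \int[mu \x mu]_z (K z * (rho z.1 * rho z.2)%:E))%E.
Proof.
move=> mK; rewrite integralE [RHS]integralE.
have r0 (z : R * R) : 0 <= rho z.1 * rho z.2 by rewrite mulr_ge0 // normal_pdf_ge0.
rewrite (funeposMr K r0) (funenegMr K r0); congr (_ - _)%E.
  by apply: ge0_integral_normal_prod => //; exact: measurable_funepos.
by apply: ge0_integral_normal_prod => //; exact: measurable_funeneg.
Qed.

Definition gauss_mono (i : nat) (x : R) : R := x ^+ i * rho x.
Definition gauss_mono' (i : nat) (x : R) : R := (i%:R * x ^+ i.-1 - x ^+ i.+1) * rho x.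
(* A bound for the total variation of [gauss_mono i], meaningful for [i <= 2] only. *)
Definition gauss_var (i : nat) : R := [:: 1; 2; 4]`_i.

Lemma is_derive_gauss_mono (i : nat) (x : R) :
  is_derive x (1 : R) (gauss_mono i) (gauss_mono' i x).
Proof.
have -> : gauss_mono i = (id ^+ i) * rho by apply/funext => y; rewrite /gauss_mono !fctE.
have dr := is_derive_std_normal_pdf x.
apply: is_derive_eq; rewrite /GRing.scale /= /gauss_mono' mulr1 exprS !fctE.
ring.
Qed.

Lemma continuous_gauss_mono' (i : nat) : continuous (gauss_mono' i).
Proof.
move=> x; apply: cvgM; last exact: continuous_std_normal_pdf.
apply: cvgB; last exact: exprn_continuous.
by apply: cvgM; [exact: cvg_cst|exact: exprn_continuous].
Qed.

Lemma gauss_mono_le (i : nat) (x : R) : (i <= 2)%N -> `|gauss_mono i x| <= normal_peak 1.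
Proof.
rewrite /gauss_mono normrM normrX (ger0_norm (normal_pdf_ge0 _ _ _)).
case: i => [|[|[|//]]] _.
- by rewrite expr0 mul1r; exact: std_normal_pdf_le.
- by rewrite expr1; exact: mulx_std_normal_pdf_le.
- by rewrite real_normK ?num_real //; exact: mulx2_std_normal_pdf_le.
Qed.

Lemma gauss_mono_var (i : nat) : (i <= 2)%N ->
  (\int[mu]_x `|gauss_mono' i x|%:E <= (gauss_var i)%:E)%E.
Proof.
move=> i2.
(* Coefficients of 1, x^2, x^4 in even polynomials dominating |x|, |1 - x^2| and |2 x - x^3|, by 2
   |x| <= 1 + x^2 and 2 |x|^3 <= x^2 + x^4. Their normal means are 1, 2 and 4. *)
pose e (k : nat) : R :=
  nth 0 (nth [::] [:: [:: 2^-1; 2^-1; 0]; [:: 1; 1; 0]; [:: 1; 3 / 2; 2^-1]] i) k.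
have := std_normal_poly4 (e 0%N) 0 (e 1%N) 0 (e 2%N).
have intp := integrable_std_normal_poly4 (e 0%N) 0 (e 1%N) 0 (e 2%N).
rewrite /Rintegral => E.
have -> : gauss_var i = e 0%N + e 1%N + 3 * e 2%N.
  by rewrite /e /gauss_var; case: i i2 {e intp E} => [|[|[|//]]] _ /=; field.
rewrite -E fineK; last exact: (integrable_fin_num measurableT intp).
apply: ge0_le_integral => //.
- apply/measurable_EFinP; apply: continuous_measurable_fun => x; apply: cvg_norm.
  exact: continuous_gauss_mono'.
- exact: measurable_int intp.
- move=> x _; rewrite lee_fin normrM (ger0_norm (normal_pdf_ge0 _ _ _)).
  rewrite ler_wpM2r ?normal_pdf_ge0 // !mul0r !addr0 (le_trans (ler_normB _ _)) //.
  rewrite !normrM !normrX normr_nat.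
  rewrite -[x ^+ 2]real_normK ?num_real // -[x ^+ 4]ger0_norm ?exprn_even_ge0 // normrX.
  have := normr_ge0 x; move: (`|x|) => t t0.
  have : 0 <= (t - 1) ^+ 2 by rewrite sqr_ge0.
  have : 0 <= t ^+ 2 * (t - 1) ^+ 2 by rewrite mulr_ge0 ?sqr_ge0.
  rewrite /e; case: i i2 {e intp E} => [|[|[|//]]] _ /=; rewrite ?expr0 ?expr1; nra.
Qed.

Lemma integrable_gauss_mono (i : nat) : (i <= 4)%N ->
  mu.-integrable setT (EFin \o gauss_mono i).
Proof.
move=> i4.
have -> : gauss_mono i = (fun x => ((i == 0)%:R + (i == 1)%:R * x + (i == 2)%:R * x ^+ 2
    + (i == 3)%:R * x ^+ 3 + (i == 4)%:R * x ^+ 4) * rho x).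
  apply/funext => x; rewrite /gauss_mono; congr (_ * _).
  by case: i i4 => [|[|[|[|[|//]]]]] _ /=; rewrite ?expr0 ?expr1; ring.
exact: integrable_std_normal_poly4.
Qed.

Lemma integrable_normal_prod_mono (i j : nat) : (i <= 4)%N -> (j <= 4)%N ->
  gam2.-integrable setT (EFin \o (fun z => z.1 ^+ i * z.2 ^+ j)).
Proof.
move=> i4 j4.
have h k : (k <= 4)%N -> gam.-integrable setT (EFin \o (fun x : R => x ^+ k)).
  move=> k4; apply: integrable_normal_prob; last exact: integrable_gauss_mono.
  by apply/measurable_EFinP; exact: measurable_funX.
exact: (integrable_prodM (h i i4) (h j j4)).
Qed.

Section Bound.
Variables (psi psi' : R -> R) (M : R).
Hypothesis dpsi : forall t, is_derive t (1 : R) psi (psi' t).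
Hypothesis cpsi' : continuous psi'.
Hypothesis psi_le1 : forall t, 0 <= t -> `|psi t| <= 1.
Hypothesis psi'_leM : forall t, 0 <= t -> `|psi' t| <= M.

(** The monomials are absorbed into the density, where [slope_bound] applies with both suprema equal
    to P = 1 / sqrt(2 pi). The constants come from 2 pi P^2 = 1 and pi P = sqrt(pi / 2) <= 3 / 2. *)
Lemma mono_bound (a b c p q r : R) (i j : nat) : (i <= 2)%N -> (j <= 2)%N ->
  0 < c -> 0 < a * c - b ^+ 2 -> (forall x y, 0 <= quad2 a b c p q r x y) ->
  `|\int[gam2]_z (psi' (quad2 a b c p q r z.1 z.2) * (z.1 ^+ i * z.2 ^+ j))|
    <= (1 + 3 / 2 * (gauss_var i + gauss_var j)) / Num.sqrt (a * c - b ^+ 2).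
Proof.
move=> i2 j2 c0 det0 f0.
have mK : measurable_fun setT (fun z : R * R => psi' (quad2 a b c p q r z.1 z.2) * (z.1 ^+ i * z.2 ^+ j)).
  apply: measurable_funM; first exact: (measurableT_comp (continuous_measurable_fun cpsi') (measurable_quad2 _ _ _ _ _ _)).
  by apply: measurable_funM; apply: measurable_funX.
have -> : \int[gam2]_z (psi' (quad2 a b c p q r z.1 z.2) * (z.1 ^+ i * z.2 ^+ j)) =
   \int[(mu \x mu)%E]_z (psi' (quad2 a b c p q r z.1 z.2) * (gauss_mono i z.1 * gauss_mono j z.2)).
  rewrite /Rintegral integral_normal_prod; last exact/measurable_EFinP.
  congr fine; apply: eq_integral => z _; rewrite -EFinM /gauss_mono; congr EFin; ring.
have vp k : (k <= 2)%N -> 0 <= gauss_var k by case: k => [|[|[|//]]] _ /=.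
have P0 := @std_peak_gt0 R; set P := normal_peak 1 in P0.
have piP : pi * P <= 3 / 2.
  have e : (pi * P) ^+ 2 = pi / 2 by rewrite exprMn expr2 -mulrA std_peak_sqr.
  rewrite -ler_sqr ?nnegrE ?mulr_ge0 ?pi_ge0 ?(ltW P0) // e.
  have := @pihalf_lt2 R; lra.
have ii : mu.-integrable setT (EFin \o gauss_mono i).
  by apply: integrable_gauss_mono; rewrite (leq_trans i2).
have ij : mu.-integrable setT (EFin \o gauss_mono j).
  by apply: integrable_gauss_mono; rewrite (leq_trans j2).
have ix : mu.-integrable setT (EFin \o (fun x => x * gauss_mono i x)).
  rewrite (_ : (fun x => x * gauss_mono i x) = gauss_mono i.+1).
    by apply: integrable_gauss_mono; rewrite ltnS (leq_trans i2).
  by apply/funext => x; rewrite /gauss_mono exprS mulrA.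
have := @slope_bound R psi psi' M dpsi cpsi' psi_le1 psi'_leM a b c p q r
  (gauss_mono i) (gauss_mono' i) (gauss_mono j) (gauss_mono' j) P P (gauss_var i) (gauss_var j)
  c0 det0 f0 (is_derive_gauss_mono i) (@continuous_gauss_mono' i)
  (is_derive_gauss_mono j) (@continuous_gauss_mono' j)
  (fun x => gauss_mono_le x i2) (fun x => gauss_mono_le x j2) (gauss_mono_var i2) (gauss_mono_var j2).
move=> /(_ ii ij ix)/le_trans; apply.
rewrite mulrAC ler_pM2r ?invr_gt0 ?sqrtr_gt0 //.
have -> : pi * (2 * (P * P) + (P * gauss_var j + P * gauss_var i)) =
  2 * (pi * P ^+ 2) + (pi * P) * (gauss_var i + gauss_var j) by ring.
rewrite std_peak_sqr lerD //; first by rewrite mulfV.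
by rewrite ler_wpM2r // addr_ge0 ?vp.
Qed.

End Bound.

End GaussianPlane.

(** * Interpolation between two quadratic functions of a planar Gaussian vector *)

Section PlaneComparison.
Context {R : realType}.
Local Notation gam := (normal_prob (0 : R) 1).
Local Notation gam2 := (gam \x gam)%E.
Variables (psi psi' : R -> R) (M : R).
Hypothesis dpsi : forall t, is_derive t (1 : R) psi (psi' t).
Hypothesis cpsi' : continuous psi'.
Hypothesis psi_le1 : forall t, 0 <= t -> `|psi t| <= 1.
Hypothesis psi'_leM : forall t, 0 <= t -> `|psi' t| <= M.
Variables (a c p q r a' b' c' p' q' r' : R).
Hypothesis a_gt0 : 0 < a.
Hypothesis c_gt0 : 0 < c.
Hypothesis a'_ge : 81 / 100 * a <= a'.
Hypothesis c'_ge0 : 0 <= c'.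
Hypothesis det'_ge0 : 0 <= a' * c' - b' ^+ 2.
Let f (z : R * R) := quad2 a 0 c p q r z.1 z.2.
Let g (z : R * R) := quad2 a' b' c' p' q' r' z.1 z.2.
Hypothesis f_ge0 : forall x y, 0 <= quad2 a 0 c p q r x y.
Hypothesis g_ge0 : forall x y, 0 <= quad2 a' b' c' p' q' r' x y.

Let h (z : R * R) := quad2 (a' - a) b' (c' - c) (p' - p) (q' - q) (r' - r) z.1 z.2.

(** The values of 1 + 3/2 ([gauss_var i] + [gauss_var j]) are 4 for the constant, 11/2 for the
    linear monomials, 17/2 for the squares and 7 for the mixed one; the linear and mixed
    coefficients are doubled in [quad2]. *)
Definition plane_weight : R :=
  4 * `|r' - r| + 11 * (`|p' - p| + `|q' - q|)
  + 17 / 2 * (`|a' - a| + `|c' - c|) + 14 * `|b'|.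

(* The square [(1 - u ^+ 2) ^+ 2] compensates for the possible degeneracy of the
   quadratic form at [u = 1]: its determinant vanishes there at most like
   [(1 - u ^+ 2) ^+ 2], which is the square of the speed of the path. *)
Let w (u : R) := (1 - u ^+ 2) ^+ 2.
Let mix (s t : R) (u : R) := w u * s + (1 - w u) * t.
Let phi (u : R) (z : R * R) :=
  quad2 (mix a a' u) (mix 0 b' u) (mix c c' u) (mix p p' u) (mix q q' u) (mix r r' u) z.1 z.2.

Let phiE u z : phi u z = w u * f z + (1 - w u) * g z.
Proof. by rewrite /phi /f /g /quad2 /mix; ring. Qed.

(** An open neighbourhood of [0, 1], so that two-sided derivatives exist at both ends of the path.
    The bound 5/4 < sqrt 2 keeps w <= 1, so the interpolations are still convex combinations, hence
    nonnegative. *)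
Let I : set R := `](- (5 / 4)), 5 / 4[.

Let w01 u : I u -> 0 <= w u <= 1.
Proof.
rewrite /I /= in_itv /= => /andP[u1 u2]; rewrite /w sqr_ge0 /=.
have : u ^+ 2 <= 2 by nra.
have := sqr_ge0 u; move: (u ^+ 2) => t t0 t2; nra.
Qed.

Let phi_ge0 u z : I u -> 0 <= phi u z.
Proof.
by move=> /w01 /andP[w0 w1]; rewrite phiE addr_ge0 // mulr_ge0 ?subr_ge0 // ?f_ge0 ?g_ge0.
Qed.

Let int_quad2 (a0 b0 c0 p0 q0 r0 : R) :
  gam2.-integrable setT (EFin \o (fun z : R * R => quad2 a0 b0 c0 p0 q0 r0 z.1 z.2)).
Proof.
have mono k i j : (i <= 4)%N -> (j <= 4)%N ->
    gam2.-integrable setT (EFin \o (fun z : R * R => k * (z.1 ^+ i * z.2 ^+ j))).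
  by move=> i4 j4; apply: integrable_mulrl; exact: integrable_normal_prod_mono.
have -> : (fun z : R * R => quad2 a0 b0 c0 p0 q0 r0 z.1 z.2) =
  (fun z => a0 * (z.1 ^+ 2 * z.2 ^+ 0) + 2 * b0 * (z.1 ^+ 1 * z.2 ^+ 1)
    + c0 * (z.1 ^+ 0 * z.2 ^+ 2) + 2 * p0 * (z.1 ^+ 1 * z.2 ^+ 0)
    + 2 * q0 * (z.1 ^+ 0 * z.2 ^+ 1) + r0 * (z.1 ^+ 0 * z.2 ^+ 0)).
  by apply/funext => z; rewrite /quad2 !expr0 !expr1; ring.
by do 5 (apply: integrable_addr; last exact: mono); exact: mono.
Qed.

Let F (u : R) := \int[gam2]_z psi (phi u z).

Let cpsi : continuous psi. Proof. exact: is_derive_continuous dpsi. Qed.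

Let mpsi_phi u : measurable_fun setT (fun z => psi (phi u z)).
Proof.
exact: (measurableT_comp (continuous_measurable_fun cpsi) (measurable_quad2 _ _ _ _ _ _)).
Qed.

Let int_psi_phi u : I u -> gam2.-integrable setT (EFin \o (fun z => psi (phi u z))).
Proof.
move=> Iu; apply: (@bounded_integrable _ _ _ gam2 _ 1 (mpsi_phi u)) => z.
by apply: psi_le1; exact: phi_ge0.
Qed.

Let dpsi_phi u z : is_derive u (1 : R) (fun v => psi (phi v z))
  (4 * u * (1 - u ^+ 2) * (psi' (phi u z) * h z)).
Proof.
have -> : (fun v => psi (phi v z)) =
  psi \o (((cst 1 - id ^+ 2) ^+ 2) * cst (f z) + (cst 1 - ((cst 1 - id ^+ 2) ^+ 2)) * cst (g z)).
  by apply/funext => v; rewrite phiE.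
have dp := dpsi ((((cst 1 - id ^+ 2) ^+ 2) * cst (f z) + (cst 1 - ((cst 1 - id ^+ 2) ^+ 2)) * cst (g z)) u).
apply: is_derive_eq; rewrite /GRing.scale /= /cst !fctE /= -/(w u) -phiE.
have -> : h z = g z - f z by rewrite /h /g /f /quad2; ring.
rewrite /w; set P := psi' _; ring.
Qed.

Let M_ge0 : 0 <= M. Proof. exact: le_trans (normr_ge0 _) (psi'_leM (lexx 0)). Qed.

Let int_psi'_phi u (k : R * R -> R) : I u -> gam2.-integrable setT (EFin \o k) ->
  gam2.-integrable setT (EFin \o (fun z => psi' (phi u z) * k z)).
Proof.
move=> Iu intk; apply: (@le_integrable_real _ _ _ gam2 _ (fun z => M * `|k z|)).
- apply: measurable_funM; last exact: integrable_real_measurable intk.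
  exact: (measurableT_comp (continuous_measurable_fun cpsi') (measurable_quad2 _ _ _ _ _ _)).
- by move=> z; rewrite normrM ler_wpM2r // psi'_leM // phi_ge0.
- by apply: integrable_mulrl; exact: integrable_norm.
Qed.

Let F_derive u : I u ->
  is_derive u (1 : R) F (4 * u * (1 - u ^+ 2) * \int[gam2]_z (psi' (phi u z) * h z)).
Proof.
move=> Iu.
pose k (v : R) (z : R * R) := psi (phi v z).
(* On [I] the speed 4 u (1 - u^2) is at most 5 in absolute value; 10 leaves room. *)
pose G (z : R * R) := 10 * M * `|h z|.
have G0 z : 0 <= G z by rewrite !mulr_ge0.
have intG : gam2.-integrable setT (EFin \o G).
  by apply: integrable_mulrl; apply: integrable_norm; exact: int_quad2.
have pE v z : partial1of2 k v z = 4 * v * (1 - v ^+ 2) * (psi' (phi v z) * h z).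
  by rewrite partial1of2E; have [] := dpsi_phi v z.
have GE v z : I v -> `|partial1of2 k v z| <= G z.
  move=> Iv; rewrite pE /G normrM [in X in _ * X]normrM mulrA ler_wpM2r // ler_pM //.
    move: Iv; rewrite /I /= in_itv /= => /andP[v1 v2].
    have : v ^+ 2 <= 25 / 16 by nra.
    have : `|v| <= 5 / 4 by rewrite ler_norml; lra.
    have : `|1 - v ^+ 2| <= 1 by rewrite ler_norml; nra.
    rewrite !normrM ger0_norm //.
    have := normr_ge0 v; have := normr_ge0 (1 - v ^+ 2); nra.
  by apply: psi'_leM; exact: phi_ge0.
have h1 := @derivable_under_integral _ _ _ gam2 k setT measurableT u _ _ Iu
  (fun v Iv => int_psi_phi Iv) (fun v z _ _ => (let: DeriveDef d _ := dpsi_phi v z in d)) G G0 intG (fun v z Iv _ => GE v z Iv).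
have h2 := @differentiation_under_integral _ _ _ gam2 k setT measurableT u _ _ Iu
  (fun v Iv => int_psi_phi Iv) (fun v z _ _ => (let: DeriveDef d _ := dpsi_phi v z in d)) G G0 intG (fun v z Iv _ => GE v z Iv).
apply: DeriveDef; first exact: h1.
rewrite -derive1E [LHS]h2.
under eq_Rintegral do rewrite pE.
by rewrite RintegralZl //; apply: int_psi'_phi => //; exact: int_quad2.
Qed.

(** Expand the determinant in t = w u. The terms in det' and a c' are nonnegative, and a' >= 81/100
    a leaves at least 81/100 t a c. Only c' >= 0 is used, so [g] may be degenerate. The number
    81/100 is chosen for its rational square root. *)
Let det_mix u : 0 < u < 1 ->
  0 < mix c c' u /\
  (9 / 10 * (1 - u ^+ 2) * Num.sqrt (a * c)) ^+ 2 <= mix a a' u * mix c c' u - mix 0 b' u ^+ 2.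
Proof.
move=> /andP[u0 u1].
have v0 : 0 < 1 - u ^+ 2 by nra.
have v1 : 1 - u ^+ 2 <= 1 by nra.
have w0 : 0 < w u by rewrite /w exprn_gt0.
have w1 : w u <= 1 by rewrite /w; nra.
split; first by rewrite /mix ltr_pwDl ?mulr_gt0 ?mulr_ge0 ?subr_ge0.
rewrite 2!exprMn sqr_sqrtr ?mulr_ge0 ?(ltW a_gt0) ?(ltW c_gt0) // -/(w u).
rewrite /mix; move: (w u) w0 w1 => t t0 t1.
have t1' : 0 <= 1 - t by rewrite subr_ge0.
have h1 : 0 <= (1 - t) ^+ 2 * (a' * c' - b' ^+ 2) by rewrite mulr_ge0 ?sqr_ge0.
have h2 : 0 <= t * (1 - t) * (a * c') by rewrite !mulr_ge0 // ltW.
have h3 : 0 <= t * (1 - t) * (c * (a' - 81 / 100 * a)) by rewrite !mulr_ge0 ?subr_ge0 // ltW.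
have h4 : 0 <= t * t * (a * c) by rewrite !mulr_ge0 // ltW.
have -> : (t * a + (1 - t) * a') * (t * c + (1 - t) * c') - (t * 0 + (1 - t) * b') ^+ 2 =
  (1 - t) ^+ 2 * (a' * c' - b' ^+ 2) + t * (1 - t) * (a * c')
  + t * (1 - t) * (c * (a' - 81 / 100 * a)) + 19 / 100 * (t * t * (a * c)) + 81 / 100 * (t * (a * c)) by field.
have -> : (9 / 10) ^+ 2 * t * (a * c) = 81 / 100 * (t * (a * c)) by field.
lra.
Qed.

Let inner_bound u : 0 < u < 1 ->
  `|\int[gam2]_z (psi' (phi u z) * h z)|
    <= plane_weight / (9 / 10 * (1 - u ^+ 2) * Num.sqrt (a * c)).
Proof.
move=> u01; have [c_u det_u] := det_mix u01; have /andP[u0 u1] := u01.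
have Iu : I u by rewrite /I /= in_itv /=; apply/andP; split; lra.
set e := 9 / 10 * (1 - u ^+ 2) * Num.sqrt (a * c) in det_u *.
have e0 : 0 < e.
  by rewrite /e !mulr_gt0 ?sqrtr_gt0 ?mulr_gt0 ?invr_gt0 // subr_gt0 expr_lt1 // ltW.
have det0 : 0 < mix a a' u * mix c c' u - mix 0 b' u ^+ 2 by apply: lt_le_trans det_u; rewrite exprn_gt0.
pose J i j := \int[gam2]_z (psi' (phi u z) * (z.1 ^+ i * z.2 ^+ j)).
have J_le i j : (i <= 2)%N -> (j <= 2)%N ->
    `|J i j| <= (1 + 3 / 2 * (gauss_var i + gauss_var j)) / e.
  move=> i2 j2.
  have := @mono_bound R psi psi' M dpsi cpsi' psi_le1 psi'_leM (mix a a' u) (mix 0 b' u)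
    (mix c c' u) (mix p p' u) (mix q q' u) (mix r r' u) i j i2 j2 c_u det0
    (fun x y => phi_ge0 (x, y) Iu).
  move=> /le_trans; apply; rewrite ler_wpM2l //.
    rewrite addr_ge0 // mulr_ge0 // addr_ge0 //.
      by case: i i2 => [|[|[|//]]] _ /=.
    by case: j j2 => [|[|[|//]]] _ /=.
  have eD : e <= Num.sqrt (mix a a' u * mix c c' u - mix 0 b' u ^+ 2).
    by rewrite -[e](ger0_norm (ltW e0)) -sqrtr_sqr; exact: ler_wsqrtr.
  by rewrite lef_pV2 ?posrE ?sqrtr_gt0.
have intJ k i j : (i <= 4)%N -> (j <= 4)%N ->
    gam2.-integrable setT (EFin \o (fun z => k * (psi' (phi u z) * (z.1 ^+ i * z.2 ^+ j)))).
  move=> i4 j4; apply: integrable_mulrl; apply: int_psi'_phi => //.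
  exact: integrable_normal_prod_mono.
have -> : \int[gam2]_z (psi' (phi u z) * h z) =
  (a' - a) * J 2 0 + 2 * b' * J 1 1 + (c' - c) * J 0 2 + 2 * (p' - p) * J 1 0
  + 2 * (q' - q) * J 0 1 + (r' - r) * J 0 0.
  rewrite /J.
  have -> : (fun z : R * R => psi' (phi u z) * h z) = (fun z =>
      (a' - a) * (psi' (phi u z) * (z.1 ^+ 2 * z.2 ^+ 0))
    + 2 * b' * (psi' (phi u z) * (z.1 ^+ 1 * z.2 ^+ 1))
    + (c' - c) * (psi' (phi u z) * (z.1 ^+ 0 * z.2 ^+ 2))
    + 2 * (p' - p) * (psi' (phi u z) * (z.1 ^+ 1 * z.2 ^+ 0))
    + 2 * (q' - q) * (psi' (phi u z) * (z.1 ^+ 0 * z.2 ^+ 1))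
    + (r' - r) * (psi' (phi u z) * (z.1 ^+ 0 * z.2 ^+ 0))).
    by apply/funext => z; rewrite /h /quad2 !expr0 !expr1; ring.
  have intD k1 k2 : gam2.-integrable setT (EFin \o k1) -> gam2.-integrable setT (EFin \o k2) ->
    gam2.-integrable setT (EFin \o (fun z => k1 z + k2 z)) := @integrable_addr _ _ _ gam2 k1 k2.
  have I1 := intJ (a' - a) 2%N 0%N isT isT.
  have I2 := intD _ _ I1 (intJ (2 * b') 1%N 1%N isT isT).
  have I3 := intD _ _ I2 (intJ (c' - c) 0%N 2%N isT isT).
  have I4 := intD _ _ I3 (intJ (2 * (p' - p)) 1%N 0%N isT isT).
  have I5 := intD _ _ I4 (intJ (2 * (q' - q)) 0%N 1%N isT isT).
  rewrite RintegralD //; last exact: intJ.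
  rewrite RintegralD //; last exact: intJ.
  rewrite RintegralD //; last exact: intJ.
  rewrite RintegralD //; last exact: intJ.
  rewrite RintegralD //; last exact: intJ.
  have Z k i j : (i <= 4)%N -> (j <= 4)%N ->
    \int[gam2]_z (k * (psi' (phi u z) * (z.1 ^+ i * z.2 ^+ j))) = k * J i j.
    move=> i4 j4; rewrite RintegralZl //; apply: int_psi'_phi => //.
    exact: integrable_normal_prod_mono.
  by rewrite !Z.
have Y k i j (B : R) : (i <= 2)%N -> (j <= 2)%N ->
    1 + 3 / 2 * (gauss_var i + gauss_var j) = B -> `|k * J i j| <= `|k| * (B / e).
  by move=> i2 j2 <-; rewrite normrM ler_wpM2l // J_le.
have h20 := @Y (a' - a) 2%N 0%N (17/2) isT isT ltac:(rewrite /gauss_var /=; field).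
have h02 := @Y (c' - c) 0%N 2%N (17/2) isT isT ltac:(rewrite /gauss_var /=; field).
have h11 := @Y (2 * b') 1%N 1%N 7 isT isT ltac:(rewrite /gauss_var /=; field).
have h10 := @Y (2 * (p' - p)) 1%N 0%N (11/2) isT isT ltac:(rewrite /gauss_var /=; field).
have h01 := @Y (2 * (q' - q)) 0%N 1%N (11/2) isT isT ltac:(rewrite /gauss_var /=; field).
have h00 := @Y (r' - r) 0%N 0%N 4 isT isT ltac:(rewrite /gauss_var /=; field).
apply: (@le_trans _ _ (`|a' - a| * (17/2/e) + `|2 * b'| * (7/e) + `|c' - c| * (17/2/e)
   + `|2 * (p' - p)| * (11/2/e) + `|2 * (q' - q)| * (11/2/e) + `|r' - r| * (4/e))).
  apply: (le_trans (ler_normD _ _)); apply: lerD; last exact: h00.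
  apply: (le_trans (ler_normD _ _)); apply: lerD; last exact: h01.
  apply: (le_trans (ler_normD _ _)); apply: lerD; last exact: h10.
  apply: (le_trans (ler_normD _ _)); apply: lerD; last exact: h02.
  by apply: (le_trans (ler_normD _ _)); apply: lerD; [exact: h20|exact: h11].
have e2 : `|2 : R| = 2 by rewrite ger0_norm.
rewrite !normrM !e2 /plane_weight le_eqVlt; apply/orP; left; apply/eqP.
by field; rewrite gt_eqF.
Qed.

(** The speed 4 u (1 - u^2) cancels the vanishing factor 1 - u^2 of the determinant bound, so |F' u|
    <= 2 K u on the open interval, with integral K. The constant is 20/9 = 4 / (9/10) / 2. *)
Lemma plane_comparison :
  `|\int[gam2]_z psi (quad2 a' b' c' p' q' r' z.1 z.2)
    - \int[gam2]_z psi (quad2 a 0 c p q r z.1 z.2)|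
    <= 20 / 9 * plane_weight / Num.sqrt (a * c).
Proof.
set K := 20 / 9 * plane_weight / Num.sqrt (a * c).
have sac : 0 < Num.sqrt (a * c) by rewrite sqrtr_gt0 mulr_gt0.
have I01 u : 0 <= u <= 1 -> I u.
  by move=> /andP[u0 u1]; rewrite /I /= in_itv /=; apply/andP; split; lra.
pose F' u := 4 * u * (1 - u ^+ 2) * \int[gam2]_z (psi' (phi u z) * h z).
have F'_le u : 0 < u < 1 -> `|F' u| <= 2 * K * u.
  move=> u01; have ib := inner_bound u01; have /andP[u0 u1] := u01.
  have v0 : 0 < 1 - u ^+ 2 by nra.
  rewrite /F' normrM ger0_norm; last by rewrite !mulr_ge0 ?ltW.
  apply: (@le_trans _ _ (4 * u * (1 - u ^+ 2) * (plane_weight / (9 / 10 * (1 - u ^+ 2) * Num.sqrt (a * c))))).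
    by rewrite ler_wpM2l // !mulr_ge0 ?ltW.
  rewrite /K le_eqVlt; apply/orP; left; apply/eqP.
  by field; rewrite !gt_eqF.
have Fend : \int[gam2]_z psi (quad2 a' b' c' p' q' r' z.1 z.2) = F 1.
  by apply: eq_Rintegral => z _; congr psi; rewrite phiE /w /g; ring.
have Fstart : \int[gam2]_z psi (quad2 a 0 c p q r z.1 z.2) = F 0.
  by apply: eq_Rintegral => z _; congr psi; rewrite phiE /w /f; ring.
(* The mean value theorem for s F u - K u^2, whose derivative is nonpositive on the open interval;
   the signs s = 1 and s = -1 give the two sides of the absolute value. *)
have one (s : R) : `|s| = 1 -> s * (F 1 - F 0) <= K.
  move=> s1.
  pose G := (fun u => s * F u - K * u ^+ 2).
  have dG u : I u -> is_derive u (1 : R) G (s * F' u - 2 * K * u).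
    move=> Iu; have dF := F_derive Iu.
    have -> : G = cst s * F - cst K * id ^+ 2 by apply/funext => v; rewrite /G !fctE.
    by apply: is_derive_eq; rewrite /GRing.scale /= !fctE /F' /=; ring.
  have cG : {within `[0, 1], continuous G}.
    apply: continuous_in_subspaceT => u /set_mem; rewrite /= in_itv /= => u01.
    by apply: differentiable_continuous; apply/derivable1_diffP; have [] := dG _ (I01 _ u01).
  have dG' (u : R) : u \in `]0, 1[%R -> is_derive u (1 : R) G (s * F' u - 2 * K * u).
    rewrite in_itv /= => /andP[u0 u1]; apply: dG; apply: I01.
    by rewrite !ltW.
  have [u] := MVT ltr01 dG' cG; rewrite in_itv /= => u01 E.
  have EG : s * (F 1 - F 0) - K = G 1 - G 0 by rewrite /G; ring.
  rewrite -subr_le0 EG E subr0 mulr1 subr_le0.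
  by apply: le_trans (ler_norm _) _; rewrite normrM s1 mul1r F'_le.
rewrite Fend Fstart ler_norml; apply/andP; split.
  by have := one (-1) ltac:(by rewrite normrN normr1); lra.
by have := one 1 (normr1 _); rewrite mul1r.
Qed.

End PlaneComparison.

(** * Gaussian vectors in higher dimension *)

Lemma integrable_Rintegral_prod1 (R : realType) (d1 d2 : measure_display)
    (T1 : measurableType d1) (T2 : measurableType d2)
    (m1 : {sigma_finite_measure set T1 -> \bar R})
    (m2 : {sigma_finite_measure set T2 -> \bar R}) (f : T1 * T2 -> R) :
  (m1 \x m2)%E.-integrable setT (EFin \o f) ->
  (forall x, m2.-integrable setT (EFin \o (fun y => f (x, y)))) ->
  m1.-integrable setT (EFin \o (fun x => \int[m2]_y f (x, y))).
Proof.
move=> intf intf2; have := integrable_fubini_F intf; congr (m1.-integrable setT _).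
apply/funext => x; rewrite /fubini_F /Rintegral /= fineK //.
exact: (integrable_fin_num measurableT (intf2 x)).
Qed.

Lemma Rintegral_prob_cst (R : realType) (d : measure_display) (T : measurableType d)
    (P : probability T R) (M : R) : \int[P]_x M = M.
Proof.
by rewrite Rintegral_cst //; have /= -> := @probability_setT _ _ _ P; rewrite mulr1.
Qed.

Lemma Rintegral_norm_le (R : realType) (d : measure_display) (T : measurableType d)
    (P : probability T R) (f : T -> R) (M : R) :
  measurable_fun setT f -> (forall x, `|f x| <= M) -> `|\int[P]_x f x| <= M.
Proof.
move=> mf fM; have intf := @bounded_integrable _ _ _ P _ _ mf fM.
apply: le_trans (le_normr_Rintegral measurableT intf) _.
apply: (@le_trans _ _ (\int[P]_x M)).
  apply: le_Rintegral => //; first exact: integrable_norm.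
  exact: finite_measure_integrable_cst.
by rewrite Rintegral_prob_cst.
Qed.

(** * Freezing all coordinates but two *)

Section PlaneFibre.
Context {R : realType} {d : measure_display} {T : measurableType d}.
Variables (P : probability T R) (f : (T * R) * R -> R).
Hypothesis mf : measurable_fun setT f.
Hypothesis f_le1 : forall z, `|f z| <= 1.
Local Notation gam := (normal_prob (0 : R) 1).

Local Notation P1 := ((P \x gam)%E : probability _ R).

Let fibre (w : T) (z : R * R) := f ((w, z.2), z.1).

Let mfibre w : measurable_fun setT (fibre w).
Proof.
apply: (measurableT_comp mf).
apply: measurable_fun_pair => //.
by apply: measurable_fun_pair => //; exact: measurable_snd.
Qed.

Let inner (u : T * R) := \int[gam]_x f (u, x).

Let int_section u : gam.-integrable setT (EFin \o (fun x => f (u, x))).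
Proof.
apply: (@bounded_integrable _ _ _ gam _ 1) => [|x]; last exact: f_le1.
exact: (measurableT_comp mf).
Qed.

Let int_inner : (P \x gam)%E.-integrable setT (EFin \o inner).
Proof.
apply: (@integrable_Rintegral_prod1 _ _ _ _ _ P1 gam f) => //.
exact: (@bounded_integrable _ _ _ ((P \x gam) \x gam)%E _ 1 mf).
Qed.

Let inner_le1 u : `|inner u| <= 1.
Proof.
by apply: (@Rintegral_norm_le _ _ _ gam) => //; exact: (measurableT_comp mf).
Qed.

Let int_inner_section w : gam.-integrable setT (EFin \o (fun y => inner (w, y))).
Proof.
apply: (@bounded_integrable _ _ _ gam _ 1) => [|y]; last exact: inner_le1.
exact: (measurableT_comp (integrable_real_measurable int_inner)).
Qed.

Let fibreE w : \int[(gam \x gam)%E]_z fibre w z = \int[gam]_y inner (w, y).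
Proof.
rewrite Rintegral_prod2 //.
  by apply: (@bounded_integrable _ _ _ (gam \x gam)%E _ 1 (mfibre w)) => z; exact: f_le1.
by move=> y; exact: (int_section (w, y)).
Qed.

(** The outermost factor of the product carries the first coordinate, hence the exchange of z.1 and
    z.2 on the right. *)
Lemma Rintegral_plane_fibre :
  \int[((P \x gam) \x gam)%E]_z f z = \int[P]_w \int[(gam \x gam)%E]_z f ((w, z.2), z.1).
Proof.
have intf : (P1 \x gam)%E.-integrable setT (EFin \o f).
  exact: (@bounded_integrable _ _ _ ((P \x gam) \x gam)%E _ 1 mf).
transitivity (\int[P1]_u inner u).
  exact: (@Rintegral_prod1 _ _ _ _ _ P1 gam f intf int_section).
transitivity (\int[P]_w \int[gam]_y inner (w, y)).
  exact: (@Rintegral_prod1 _ _ _ _ _ P gam inner int_inner int_inner_section).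
by apply: eq_Rintegral => w _; rewrite -fibreE.
Qed.

Lemma integrable_plane_fibre :
  P.-integrable setT (EFin \o (fun w => \int[(gam \x gam)%E]_z f ((w, z.2), z.1))).
Proof.
have E : (fun w => \int[gam]_y inner (w, y)) = (fun w => \int[(gam \x gam)%E]_z fibre w z).
  by apply/funext => w; rewrite fibreE.
by have := integrable_Rintegral_prod1 int_inner int_inner_section; rewrite E.
Qed.

End PlaneFibre.

(** Cauchy-Schwarz in the form |f| <= f^2 / (2 c) + c / 2 with c = s + e; the extra e > 0 covers the
    case s = 0. *)
Lemma Rintegral_norm_le_moment2 (R : realType) (d : measure_display)
    (T : measurableType d) (P : probability T R) (f : T -> R) (s : R) :
  measurable_fun setT f -> 0 <= s ->
  (\int[P]_w (f w ^+ 2)%:E <= (s ^+ 2)%:E)%E ->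
  P.-integrable setT (EFin \o f) /\ \int[P]_w `|f w| <= s.
Proof.
move=> mf s0 f2.
have int2 : P.-integrable setT (EFin \o (fun w => f w ^+ 2)).
  apply/integrableP; split; first by apply/measurable_EFinP; exact: measurable_funX.
  under eq_integral do rewrite /= ger0_norm ?sqr_ge0 //.
  exact: le_lt_trans f2 (ltry _).
have int1 c : P.-integrable setT (EFin \o cst c) by exact: finite_measure_integrable_cst.
have intf : P.-integrable setT (EFin \o f).
  apply: (@le_integrable_real _ _ _ P f (fun w => 1 + f w ^+ 2)) => //.
    move=> w; rewrite -[f w ^+ 2]real_normK ?num_real //.
    by have := normr_ge0 (f w); nra.
  by apply: integrable_addr => //; exact: int1.
split=> //; apply/ler_addgt0Pr => e e0.
have se0 : 0 < s + e by rewrite ltr_wpDl.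
apply: (@le_trans _ _ (\int[P]_w ((2 * (s + e))^-1 * f w ^+ 2 + (s + e) / 2))).
  apply: le_Rintegral => //; first exact: integrable_norm.
    by apply: integrable_addr; [exact: integrable_mulrl|exact: int1].
  move=> w _; rewrite -[f w ^+ 2]real_normK ?num_real //.
  have -> : (2 * (s + e))^-1 * `|f w| ^+ 2 + (s + e) / 2 =
      (2 * (s + e))^-1 * (`|f w| - (s + e)) ^+ 2 + `|f w| by field; rewrite gt_eqF.
  by rewrite lerDr mulr_ge0 ?sqr_ge0 // invr_ge0 mulr_ge0 // ltW.
rewrite RintegralD //; last 2 first.
- exact: integrable_mulrl.
- exact: int1.
rewrite [X in _ + X](@Rintegral_prob_cst _ _ _ P) RintegralZl //.
have h : \int[P]_w (f w ^+ 2) <= s ^+ 2.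
  rewrite -lee_fin /Rintegral fineK //.
  by apply: (integrable_fin_num measurableT int2).
rewrite [leRHS](_ : _ = (2 * (s + e))^-1 * (s + e) ^+ 2 + (s + e) / 2); last first.
  by field; rewrite gt_eqF.
rewrite lerD2r ler_wpM2l //.
  by rewrite invr_ge0 mulr_ge0 // ltW.
by apply: le_trans h _; nra.
Qed.

(** The shape of |S z - a|^2 for symmetric S, with C = S S, v = S a and k = |a|^2. *)
Definition aquad (R : pzRingType) (n : nat) (C : 'M[R]_n) (v : 'cV[R]_n) (k : R)
    (z : 'cV[R]_n) : R := quadf C z - 2 * dotv v z + k.

Section Fibre.
Context {R : realType} {m : nat}.
Implicit Types (C : 'M[R]_m.+2) (v : 'cV[R]_m.+2) (k : R) (w : 'cV[R]_m).

Local Notation i1 := (lift ord0 ord0).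

Definition row0_tail C : 'cV[R]_m := tail_col (\col_j C ord0 (lift ord0 j)).
Definition row1_tail C : 'cV[R]_m := \col_j tail_mx C ord0 (lift ord0 j).

Definition fibre_lin0 C v w := dotv (row0_tail C) w - v ord0 0.
Definition fibre_lin1 C v w := dotv (row1_tail C) w - v i1 0.
Definition fibre_cst C v k w :=
  aquad (tail_mx (tail_mx C)) (tail_col (tail_col v)) k w.

Lemma aquad_fibre C v k x y w : C^T = C ->
  aquad C v k (cons_col x (cons_col y w)) =
  quad2 (C ord0 ord0) (C ord0 i1) (C i1 i1)
    (fibre_lin0 C v w) (fibre_lin1 C v w) (fibre_cst C v k w) x y.
Proof.
move=> symC.
have symC' : (tail_mx C)^T = tail_mx C by apply/matrixP => i j; rewrite !mxE -[in LHS]symC mxE.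
rewrite /aquad quadf_cons // dotvZl dotv_cons quadf_cons // !dotvZl !dotv_cons.
rewrite /quad2 /fibre_lin0 /fibre_lin1 /fibre_cst /aquad /row0_tail /row1_tail !mxE.
ring.
Qed.

Lemma dotvBl (n : nat) (u u' v : 'cV[R]_n) : dotv (u - u') v = dotv u v - dotv u' v.
Proof. by rewrite dotvDl -scaleN1r dotvZl mulN1r. Qed.

Lemma quadfB (n : nat) (A B : 'M[R]_n) z : quadf (A - B) z = quadf A z - quadf B z.
Proof.
rewrite /quadf -sumrB; apply: eq_bigr => i _; rewrite -sumrB; apply: eq_bigr => j _.
by rewrite !mxE; ring.
Qed.

Lemma fibre_lin0B C C' v v' w :
  fibre_lin0 (C - C') (v - v') w = fibre_lin0 C v w - fibre_lin0 C' v' w.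
Proof.
rewrite /fibre_lin0.
have -> : row0_tail (C - C') = row0_tail C - row0_tail C' by apply/matrixP => i j; rewrite !mxE.
by rewrite dotvBl !mxE; ring.
Qed.

Lemma fibre_lin1B C C' v v' w :
  fibre_lin1 (C - C') (v - v') w = fibre_lin1 C v w - fibre_lin1 C' v' w.
Proof.
rewrite /fibre_lin1.
have -> : row1_tail (C - C') = row1_tail C - row1_tail C' by apply/matrixP => i j; rewrite !mxE.
by rewrite dotvBl !mxE; ring.
Qed.

Lemma fibre_cstB C C' v v' k k' w :
  fibre_cst (C - C') (v - v') (k - k') w = fibre_cst C v k w - fibre_cst C' v' k' w.
Proof.
rewrite /fibre_cst /aquad.
have -> : tail_mx (tail_mx (C - C')) = tail_mx (tail_mx C) - tail_mx (tail_mx C').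
  by apply/matrixP => i j; rewrite !mxE.
have -> : tail_col (tail_col (v - v')) = tail_col (tail_col v) - tail_col (tail_col v').
  by apply/matrixP => i j; rewrite !mxE.
by rewrite quadfB dotvBl; ring.
Qed.

Lemma dotv_ge0 (n : nat) (u : 'cV[R]_n) : 0 <= dotv u u.
Proof. by apply: sumr_ge0 => i _; rewrite -expr2 sqr_ge0. Qed.

Lemma fibre_sum_sqr C : C^T = C -> \sum_i \sum_j C i j ^+ 2 =
  C ord0 ord0 ^+ 2 + 2 * C ord0 i1 ^+ 2 + C i1 i1 ^+ 2
  + 2 * dotv (row0_tail C) (row0_tail C) + 2 * dotv (row1_tail C) (row1_tail C)
  + \sum_i \sum_j tail_mx (tail_mx C) i j ^+ 2.
Proof.
move=> symC.
have symC' : (tail_mx C)^T = tail_mx C by apply/matrixP => i j; rewrite !mxE -[in LHS]symC mxE.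
by rewrite sum_sqr_recl // dotv_recl sum_sqr_recl // !mxE /row0_tail /row1_tail; ring.
Qed.

End Fibre.

Section GaussianComparison.
Context {R : realType} {d : measure_display} {T : measurableType d} {m : nat}.
Variables (P : probability T R) (W : T -> 'cV[R]_m).
Hypothesis gW : std_gaussian_vector P W.
Local Notation i1 := (lift ord0 ord0).

Section Moments.
Variables (C : 'M[R]_m.+2) (v : 'cV[R]_m.+2) (k D V : R).
Hypothesis symC : C^T = C.
Hypothesis D_ge0 : 0 <= D.
Hypothesis V_ge0 : 0 <= V.
Hypothesis C_le : \sum_i \sum_j C i j ^+ 2 <= D ^+ 2.
Hypothesis v_le : dotv v v <= V ^+ 2.

Let mW i : measurable_fun setT (fun w => W w i 0).
Proof. by case: gW. Qed.

Let S := \sum_i \sum_j tail_mx (tail_mx C) i j ^+ 2.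

Let S_ge0 : 0 <= S.
Proof. by apply: sumr_ge0 => i _; apply: sumr_ge0 => j _; rewrite sqr_ge0. Qed.

Let vE : dotv v v = v ord0 0 ^+ 2 + v i1 0 ^+ 2
  + dotv (tail_col (tail_col v)) (tail_col (tail_col v)).
Proof. by rewrite dotv_recl dotv_recl !mxE; ring. Qed.

Let bounds := (sqr_ge0 (C ord0 ord0), sqr_ge0 (C ord0 i1), sqr_ge0 (C i1 i1),
  dotv_ge0 (row0_tail C), dotv_ge0 (row1_tail C), S_ge0).
Let vbounds := (sqr_ge0 (v ord0 0), sqr_ge0 (v i1 0), dotv_ge0 (tail_col (tail_col v))).

Lemma fibre_corner_le :
  [/\ `|C ord0 ord0| <= D, `|C ord0 i1| <= D & `|C i1 i1| <= D].
Proof.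
have := C_le; rewrite fibre_sum_sqr // -/S => h.
have [[[[[b1 b2] b3] b4] b5] b6] := bounds.
by split; rewrite -[leRHS]ger0_norm // -ler_sqr ?nnegrE // !real_normK ?num_real //; lra.
Qed.

Let moment_lin (u : 'cV[R]_m) (x : R) : dotv u u <= D ^+ 2 -> x ^+ 2 <= V ^+ 2 ->
  P.-integrable setT (EFin \o (fun w => dotv u (W w) - x)) /\
  \int[P]_w `|dotv u (W w) - x| <= D + V.
Proof.
move=> uD xV; apply: Rintegral_norm_le_moment2.
- by apply: measurable_funB => //; exact: measurable_dotv.
- exact: addr_ge0.
have [_ _ sqrW] := gW; have := sqrW 0 u (- x) (trmx0 _ _ _).
rewrite mxtrace0 addr0.
under eq_integral => w _.
  have -> : quadf 0 (W w) = 0.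
    by apply: big1 => i _; apply: big1 => j _; rewrite mxE !mul0r.
  rewrite add0r; over.
move=> ->; rewrite lee_fin.
rewrite big1; last by move=> i _; apply: big1 => j _; rewrite mxE expr0n.
by have := mulr_ge0 D_ge0 V_ge0; nra.
Qed.

Lemma fibre_lin0_moment :
  P.-integrable setT (EFin \o (fun w => fibre_lin0 C v (W w))) /\
  \int[P]_w `|fibre_lin0 C v (W w)| <= D + V.
Proof.
have := C_le; have := v_le; rewrite vE fibre_sum_sqr // -/S => hv hC.
have [[[[[b1 b2] b3] b4] b5] b6] := bounds; have [[b7 b8] b9] := vbounds.
by apply: moment_lin; lra.
Qed.

Lemma fibre_lin1_moment :
  P.-integrable setT (EFin \o (fun w => fibre_lin1 C v (W w))) /\
  \int[P]_w `|fibre_lin1 C v (W w)| <= D + V.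
Proof.
have := C_le; have := v_le; rewrite vE fibre_sum_sqr // -/S => hv hC.
have [[[[[b1 b2] b3] b4] b5] b6] := bounds; have [[b7 b8] b9] := vbounds.
by apply: moment_lin; lra.
Qed.

Lemma fibre_cst_moment :
  P.-integrable setT (EFin \o (fun w => fibre_cst C v k (W w))) /\
  \int[P]_w `|fibre_cst C v k (W w)| <= 7 / 2 * D + 2 * V + `|k| + `|\tr C|.
Proof.
have := C_le; have := v_le; rewrite vE fibre_sum_sqr // -/S => hv hC.
have [[[[[b1 b2] b3] b4] b5] b6] := bounds; have [[b7 b8] b9] := vbounds.
have [c00 _ c11] := fibre_corner_le.
have [_ _ sqrW] := gW.
apply: Rintegral_norm_le_moment2.
- rewrite /fibre_cst /aquad; apply: measurable_funD => //; apply: measurable_funB.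
    exact: measurable_quadf.
  by apply: measurable_funM => //; exact: measurable_dotv.
- by rewrite !addr_ge0 // mulr_ge0.
have symC' : (tail_mx (tail_mx C))^T = tail_mx (tail_mx C).
  by apply/matrixP => i j; rewrite !mxE -[in LHS]symC mxE.
have := sqrW _ (- 2 *: tail_col (tail_col v)) k symC'.
under eq_integral => w _.
  rewrite dotvZl mulNr; over.
move=> ->; rewrite lee_fin -/S dotvZl dotvC dotvZl.
have -> : \tr (tail_mx (tail_mx C)) = \tr C - C ord0 ord0 - C i1 i1.
  by rewrite [\tr C]tr_recl tr_recl !mxE; ring.
set t := \tr C; set x := C ord0 ord0; set y := C i1 i1; rewrite -/x in c00; rewrite -/y in c11.
have k_le : (k + (t - x - y)) ^+ 2 <= (`|k| + `|t| + 2 * D) ^+ 2.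
  rewrite -[leLHS]real_normK ?num_real // ler_sqr ?nnegrE //; last first.
    by rewrite !addr_ge0 // mulr_ge0.
  have e1 := ler_normD k (t - x - y); have e2 := ler_normB (t - x) y.
  have e3 := ler_normB t x; lra.
have := normr_ge0 k; have := normr_ge0 t.
move: (`|k|) (`|t|) k_le => K TT k_le hT hK.
have KT : 0 <= (K + TT + 2 * D) * (3 / 2 * D + 2 * V) by rewrite mulr_ge0 ?addr_ge0 ?mulr_ge0.
have DV := mulr_ge0 D_ge0 V_ge0.
by have := sqr_ge0 D; nra.
Qed.

End Moments.

Variables (psi psi' : R -> R) (M : R).
Hypothesis dpsi : forall t, is_derive t (1 : R) psi (psi' t).
Hypothesis cpsi' : continuous psi'.
Hypothesis psi_le1 : forall t, 0 <= t -> `|psi t| <= 1.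
Hypothesis psi'_leM : forall t, 0 <= t -> `|psi' t| <= M.
Variables (A B : 'M[R]_m.+2) (v v' : 'cV[R]_m.+2) (k k' l1 l2 D V : R).
Hypothesis symA : A^T = A.
Hypothesis symB : B^T = B.
Hypothesis A00 : A ord0 ord0 = l1.
Hypothesis A01 : A ord0 i1 = 0.
Hypothesis A11 : A i1 i1 = l2.
Hypothesis l1_gt0 : 0 < l1.
Hypothesis l2_gt0 : 0 < l2.
Hypothesis B00_ge : 81 / 100 * l1 <= B ord0 ord0.
Hypothesis B11_ge0 : 0 <= B i1 i1.
Hypothesis detB_ge0 : 0 <= B ord0 ord0 * B i1 i1 - B ord0 i1 ^+ 2.
Hypothesis A_ge0 : forall z, 0 <= aquad A v k z.
Hypothesis B_ge0 : forall z, 0 <= aquad B v' k' z.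
Hypothesis D_ge0 : 0 <= D.
Hypothesis V_ge0 : 0 <= V.
Hypothesis BA_le : \sum_i \sum_j (B - A) i j ^+ 2 <= D ^+ 2.
Hypothesis v'v_le : dotv (v' - v) (v' - v) <= V ^+ 2.
Local Notation gam := (normal_prob (0 : R) 1).

Let Z (z : (T * R) * R) : 'cV[R]_m.+2 := cons_col z.2 (cons_col z.1.2 (W z.1.1)).

Let mZ i : measurable_fun setT (fun z => Z z i 0).
Proof.
have mW : forall i, measurable_fun setT (fun w => W w i 0) by case: gW.
apply: measurable_cons_col => //; apply: measurable_cons_col => [|j].
  exact: (measurableT_comp measurable_snd).
exact: (measurableT_comp (mW j) (measurableT_comp measurable_fst measurable_fst)).
Qed.

Let mpsi C u h : measurable_fun setT (fun z => psi (aquad C u h (Z z))).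
Proof.
apply: (measurableT_comp (continuous_measurable_fun (is_derive_continuous dpsi))).
rewrite /aquad; apply: measurable_funD => //; apply: measurable_funB.
  exact: measurable_quadf.
by apply: measurable_funM => //; exact: measurable_dotv.
Qed.

Let weight w := plane_weight (A ord0 ord0) (A i1 i1) (fibre_lin0 A v w) (fibre_lin1 A v w)
  (fibre_cst A v k w) (B ord0 ord0) (B ord0 i1) (B i1 i1) (fibre_lin0 B v' w)
  (fibre_lin1 B v' w) (fibre_cst B v' k' w).

Let symBA : (B - A)^T = B - A.
Proof. by rewrite linearB /= symA symB. Qed.

Let weightE w : weight w =
  4 * `|fibre_cst (B - A) (v' - v) (k' - k) w|
  + (11 * `|fibre_lin0 (B - A) (v' - v) w|
  + (11 * `|fibre_lin1 (B - A) (v' - v) w|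
  + (17 / 2 * (`|(B - A) ord0 ord0| + `|(B - A) i1 i1|) + 14 * `|(B - A) ord0 i1|))).
Proof.
rewrite /weight /plane_weight fibre_lin0B fibre_lin1B fibre_cstB !mxE A01 subr0.
by ring.
Qed.

(** The corner entries are bounded by D and the other coefficients by their mean squares: 67 = 4 *
    7/2 + 2 * 11 + 17 + 14 and 30 = 4 * 2 + 2 * 11. *)
Let weight_moment : P.-integrable setT (EFin \o (fun w => weight (W w))) /\
  \int[P]_w weight (W w) <= 67 * D + 30 * V + 4 * (`|k' - k| + `|\tr (B - A)|).
Proof.
have [j0 m0] := fibre_lin0_moment symBA D_ge0 V_ge0 BA_le v'v_le.
have [j1 m1] := fibre_lin1_moment symBA D_ge0 V_ge0 BA_le v'v_le.
have [jr mr] := fibre_cst_moment (k' - k) symBA D_ge0 V_ge0 BA_le v'v_le.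
have [c00 c01 c11] := fibre_corner_le symBA D_ge0 BA_le.
have -> : (fun w => weight (W w)) = (fun w =>
  4 * `|fibre_cst (B - A) (v' - v) (k' - k) (W w)|
  + (11 * `|fibre_lin0 (B - A) (v' - v) (W w)|
  + (11 * `|fibre_lin1 (B - A) (v' - v) (W w)|
  + (17 / 2 * (`|(B - A) ord0 ord0| + `|(B - A) (lift ord0 ord0) (lift ord0 ord0)|)
     + 14 * `|(B - A) ord0 (lift ord0 ord0)|)))).
  by apply/funext => w; rewrite weightE.
set e := 17 / 2 * _ + _.
have n0 := integrable_mulrl 11 (integrable_norm j0).
have n1 := integrable_mulrl 11 (integrable_norm j1).
have nr := integrable_mulrl 4 (integrable_norm jr).
have ne : P.-integrable setT (EFin \o cst e) by exact: finite_measure_integrable_cst.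
have n2 := integrable_addr n1 ne; have n3 := integrable_addr n0 n2.
split; first exact: integrable_addr nr n3.
rewrite RintegralD // RintegralD // RintegralD //.
rewrite RintegralZl //; last exact: integrable_norm.
rewrite RintegralZl //; last exact: integrable_norm.
rewrite RintegralZl //; last exact: integrable_norm.
rewrite [X in _ + (_ + (_ + X))](@Rintegral_prob_cst _ _ _ P) /e.
lra.
Qed.

Lemma gaussian_comparison :
  `|\int[((P \x gam) \x gam)%E]_z psi (aquad B v' k' (Z z))
    - \int[((P \x gam) \x gam)%E]_z psi (aquad A v k (Z z))|
  <= 20 / 9 * (67 * D + 30 * V + 4 * (`|k' - k| + `|\tr (B - A)|)) / Num.sqrt (l1 * l2).
Proof.
have psiA z : `|psi (aquad A v k (Z z))| <= 1 by exact: psi_le1.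
have psiB z : `|psi (aquad B v' k' (Z z))| <= 1 by exact: psi_le1.
have iA := integrable_plane_fibre P (mpsi A v k) psiA.
have iB := integrable_plane_fibre P (mpsi B v' k') psiB.
have [iw mw] := weight_moment.
rewrite (Rintegral_plane_fibre P (mpsi A v k) psiA) (Rintegral_plane_fibre P (mpsi B v' k') psiB).
rewrite -RintegralB //.
apply: le_trans (le_normr_Rintegral measurableT (integrable_subr iB iA)) _.
apply: (@le_trans _ _ (\int[P]_w ((20 / 9 / Num.sqrt (l1 * l2)) * weight (W w)))).
  apply: le_Rintegral => //.
  - exact: integrable_norm (integrable_subr iB iA).
  - exact: integrable_mulrl.
  move=> w _; rewrite -A00 -A11.
  have fA x y : aquad A v k (Z ((w, y), x)) = quad2 (A ord0 ord0) 0 (A i1 i1)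
      (fibre_lin0 A v (W w)) (fibre_lin1 A v (W w)) (fibre_cst A v k (W w)) x y.
    by rewrite /Z aquad_fibre // A01.
  have fB x y : aquad B v' k' (Z ((w, y), x)) = quad2 (B ord0 ord0) (B ord0 i1) (B i1 i1)
      (fibre_lin0 B v' (W w)) (fibre_lin1 B v' (W w)) (fibre_cst B v' k' (W w)) x y.
    by rewrite /Z aquad_fibre.
  have gA x y := A_ge0 (Z ((w, y), x)); have gB x y := B_ge0 (Z ((w, y), x)).
  have := @plane_comparison R psi psi' M dpsi cpsi' psi_le1 psi'_leM
    (A ord0 ord0) (A i1 i1) (fibre_lin0 A v (W w)) (fibre_lin1 A v (W w))
    (fibre_cst A v k (W w)) (B ord0 ord0) (B ord0 i1) (B i1 i1)
    (fibre_lin0 B v' (W w)) (fibre_lin1 B v' (W w)) (fibre_cst B v' k' (W w)).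
  rewrite {1}A00 {1}A11 => /(_ l1_gt0 l2_gt0).
  rewrite {1}A00 => /(_ B00_ge B11_ge0 detB_ge0) H.
  have gA' x y : 0 <= quad2 (A ord0 ord0) 0 (A i1 i1) (fibre_lin0 A v (W w))
      (fibre_lin1 A v (W w)) (fibre_cst A v k (W w)) x y by rewrite -fA.
  have gB' x y : 0 <= quad2 (B ord0 ord0) (B ord0 i1) (B i1 i1) (fibre_lin0 B v' (W w))
      (fibre_lin1 B v' (W w)) (fibre_cst B v' k' (W w)) x y by rewrite -fB.
  have {H} := H gA' gB'.
  under [X in `|X - _| <= _ -> _]eq_Rintegral do rewrite -fB.
  under [X in `|_ - X| <= _ -> _]eq_Rintegral do rewrite -fA.
  by move=> /le_trans; apply; rewrite -/(weight (W w)) mulrAC.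
rewrite RintegralZl // mulrAC ler_pM2r ?invr_gt0 ?sqrtr_gt0 ?mulr_gt0 //.
by rewrite ler_wpM2l // divr_ge0.
Qed.

End GaussianComparison.

(** * Transfer to a common Gaussian vector *)

Lemma horner_bounded (R : realDomainType) (q : {poly R}) (x : R) : 0 <= x <= 1 ->
  `|q.[x]| <= \sum_(i < size q) `|q`_i|.
Proof.
move=> /andP[x0 x1]; rewrite horner_coef; apply: le_trans (ler_norm_sum _ _ _) _.
apply: ler_sum => i _; rewrite normrM ler_piMr // normrX ger0_norm //.
exact: exprn_ile1.
Qed.

Lemma dotvE (R : comPzRingType) (n : nat) (u v : 'cV[R]_n) : dotv u v = (u^T *m v) 0 0.
Proof. by rewrite mxE; apply: eq_bigr => i _; rewrite mxE. Qed.

Lemma quadfE (R : comPzRingType) (n : nat) (C : 'M[R]_n) (z : 'cV[R]_n) :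
  quadf C z = (z^T *m C *m z) 0 0.
Proof.
rewrite -mulmxA mxE; apply: eq_bigr => i _; rewrite !mxE big_distrr /=.
by apply: eq_bigr => j _; ring.
Qed.

Lemma sum_sqr_tr (R : comPzRingType) (n : nat) (C : 'M[R]_n) :
  \sum_i \sum_j C i j ^+ 2 = \tr (C *m C^T).
Proof.
by apply: eq_bigr => i _; rewrite mxE; apply: eq_bigr => j _; rewrite mxE expr2.
Qed.

Lemma dotv_mulmxl (R : comPzRingType) (n : nat) (M : 'M[R]_n) (u v : 'cV[R]_n) :
  dotv u (M *m v) = dotv (M^T *m u) v.
Proof. by rewrite !dotvE trmx_mul trmxK mulmxA. Qed.

Lemma affine_aquad (R : comPzRingType) (n : nat) (S U : 'M[R]_n) (a z : 'cV[R]_n) :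
  S^T = S ->
  dotv (S *m U^T *m z - a) (S *m U^T *m z - a) =
  aquad (U *m (S *m S) *m U^T) (U *m (S *m a)) (dotv a a) z.
Proof.
move=> symS; set y := S *m U^T *m z.
have -> : dotv (y - a) (y - a) = dotv y y - 2 * dotv a y + dotv a a.
  rewrite /dotv mulr_sumr -sumrB -big_split; apply: eq_bigr => i _ /=.
  by rewrite !mxE; ring.
rewrite /aquad /y; congr (_ - 2 * _ + _).
  by rewrite dotvE quadfE !trmx_mul symS trmxK !mulmxA.
by rewrite dotv_mulmxl trmx_mul symS trmxK mulmxA.
Qed.

Lemma cos_law_mulmx (R : realType) (d : measure_display) (T : measurableType d)
    (P : probability T R) (n : nat) (Z : T -> 'cV[R]_n) (M : 'M[R]_n) :
  cos_law P Z (fun u => dotv u u) -> cos_law P (fun w => M *m Z w) (quadf (M *m M^T)).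
Proof.
move=> lawZ u c; under eq_Rintegral do rewrite dotv_mulmxl.
rewrite lawZ; congr (expR (- (_ / 2)) * _).
by rewrite dotvE quadfE trmx_mul trmxK !mulmxA.
Qed.

Lemma measurable_mulmx (R : realType) (d : measure_display) (T : measurableType d)
    (n : nat) (Z : T -> 'cV[R]_n) (M : 'M[R]_n) :
  (forall i, measurable_fun setT (fun w => Z w i 0)) ->
  forall i, measurable_fun setT (fun w => (M *m Z w) i 0).
Proof.
move=> mZ i; under eq_fun do rewrite mxE.
by apply: measurable_sum => j; apply: measurable_funM.
Qed.

(** The form takes the value a (a c - b^2) at (-b, a). *)
Lemma quad_form_det_ge0 (R : realDomainType) (a b c : R) : 0 < a ->
  (forall x y, 0 <= a * x ^+ 2 + 2 * b * x * y + c * y ^+ 2) ->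
  0 <= c /\ 0 <= a * c - b ^+ 2.
Proof.
move=> a0 f0; split.
  by have := f0 0 1; rewrite expr0n !mulr0 mul0r !add0r expr1n mulr1.
rewrite -(pmulr_rge0 _ a0).
have -> : a * (a * c - b ^+ 2) = a * (- b) ^+ 2 + 2 * b * (- b) * a + c * a ^+ 2 by ring.
exact: f0.
Qed.

Section PolynomialComparison.
Context {R : realType} {dX dY : measure_display} {TX : measurableType dX}
  {TY : measurableType dY} {m : nat}.
Variables (PX : probability TX R) (PY : probability TY R).
Variables (X : TX -> 'cV[R]_m.+2) (Y : TY -> 'cV[R]_m.+2).
Variables (SX SY S T : 'M[R]_m.+2) (a b : 'cV[R]_m.+2) (l1 l2 D V : R) (s : seq R).
Variable p : {poly R}.
Hypothesis mX : forall i, measurable_fun setT (fun w => X w i 0).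
Hypothesis mY : forall i, measurable_fun setT (fun w => Y w i 0).
Hypothesis lawX : cos_law PX X (quadf SX).
Hypothesis lawY : cos_law PY Y (quadf SY).
Hypothesis symS : S^T = S.
Hypothesis symT : T^T = T.
Hypothesis sqrS : S *m S = SX.
Hypothesis sqrT : T *m T = SY.
Hypothesis eigX : char_poly SX = \prod_(x <- [:: l1, l2 & s]) ('X - x%:P).
Hypothesis l2_gt0 : 0 < l2.
Hypothesis l1_gt0 : 0 < l1.
Hypothesis p_le1 : forall x, 0 <= x <= 1 -> `|p.[x]| <= 1.
Hypothesis D_ge0 : 0 <= D.
Hypothesis V_ge0 : 0 <= V.
Hypothesis SXY_le : \sum_i \sum_j (SX - SY) i j ^+ 2 <= D ^+ 2.
Hypothesis SaTb_le : dotv (S *m a - T *m b) (S *m a - T *m b) <= V ^+ 2.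
Hypothesis D_le : 80 * D <= l1.

Let psi (t : R) := p.[expR (- t)].
Let psi' (t : R) := - (p^`().[expR (- t)] * expR (- t)).

Let expR_itv (t : R) : 0 <= t -> 0 <= expR (- t) <= 1.
Proof. by move=> t0; rewrite expR_ge0 /= -[leRHS]expR0 ler_expR oppr_le0. Qed.

Let dpsi t : is_derive t (1 : R) psi (psi' t).
Proof.
pose e := fun u : R => expR (- u).
have de : is_derive t (1 : R) e (- expR (- t)).
  have -> : e = @expR R \o (- id) by apply/funext => u; rewrite /e /= fctE.
  have d1 := is_derive_expR ((- id) t : R).
  by apply: is_derive_eq; rewrite /GRing.scale /= !fctE; ring.
have -> : psi = horner p \o e by [].
have dp' := is_derive_poly p (e t).
by apply: is_derive_eq; rewrite /GRing.scale /= /psi' /e; ring.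
Qed.

Let cpsi' : continuous psi'.
Proof.
have ce : continuous (fun t : R => expR (- t)).
  by move=> t; apply: (@continuous_comp _ _ _ -%R expR); [exact: opp_continuous|exact: continuous_expR].
move=> t; apply: cvgN; apply: cvgM; last exact: ce.
by apply: (continuous_comp (ce t)); exact: continuous_horner.
Qed.

Let psi_le1 t : 0 <= t -> `|psi t| <= 1.
Proof. by move=> /expR_itv/p_le1. Qed.

Let psi'_le t : 0 <= t -> `|psi' t| <= \sum_(i < size p^`()) `|p^`()`_i|.
Proof.
move=> /expR_itv e01; rewrite normrN normrM -[leRHS]mulr1 ler_pM ?horner_bounded //.
by rewrite ger0_norm; case/andP: e01.
Qed.

Lemma polynomial_comparison :
  `|\int[PY]_w p.[expR (- dotv (Y w - b) (Y w - b))]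
    - \int[PX]_w p.[expR (- dotv (X w - a) (X w - a))]|
  <= 20 / 9 * (67 * D + 30 * V + 4 * (`|dotv a a - dotv b b| + `|\tr SX - \tr SY|))
     / Num.sqrt (l1 * l2).
Proof.
have symX : SX^T = SX by rewrite -sqrS trmx_mul symS.
have symY : SY^T = SY by rewrite -sqrT trmx_mul symT.
have [U [UU c00 c01 c11]] := top_corner_diag symX eigX.
have UU' : U^T *m U = 1%:M := mulmx1C UU.
have [d [Om [P [W gW]]]] := std_gaussian_vector_exists R m.
pose P2 : probability _ R := ((P \x normal_prob (0 : R) 1) \x normal_prob (0 : R) 1)%E.
pose Z (z : (Om * R) * R) := cons_col z.2 (cons_col z.1.2 (W z.1.1)).
have [mZ lawZ _] : std_gaussian_vector P2 Z := std_gaussian_cons (std_gaussian_cons gW).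
(* The covariance of Q U^T Z is Q U^T U Q = Q Q. Inserting the rotation U^T is free and makes the
   top corner of the quadratic part on the X side diagonal. *)
have law (Q : 'M[R]_m.+2) : Q^T = Q -> cos_law P2 (fun z => Q *m U^T *m Z z) (quadf (Q *m Q)).
  move=> symQ; have := cos_law_mulmx (Q *m U^T) lawZ.
  by rewrite trmx_mul trmxK symQ -mulmxA (mulmxA U^T) UU' mul1mx.
have lawSZ := law S symS; have lawTZ := law T symT; rewrite sqrS in lawSZ; rewrite sqrT in lawTZ.
rewrite (cos_law_poly a p mX (measurable_mulmx (S *m U^T) mZ) lawX lawSZ).
rewrite (cos_law_poly b p mY (measurable_mulmx (T *m U^T) mZ) lawY lawTZ).
under [X in `|X - _|]eq_Rintegral do rewrite affine_aquad // sqrT.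
under [X in `|_ - X|]eq_Rintegral do rewrite affine_aquad // sqrS.
set A := U *m SX *m U^T; set B := U *m SY *m U^T.
have one : (1 : 'I_m.+2) = lift ord0 ord0 by exact/val_inj.
have zero : (0 : 'I_m.+2) = ord0 by exact/val_inj.
rewrite -/A one zero in c00 c01 c11.
have symA : A^T = A by rewrite /A !trmx_mul trmxK symX mulmxA.
have symB : B^T = B by rewrite /B !trmx_mul trmxK symY mulmxA.
have A_ge0 z : 0 <= aquad A (U *m (S *m a)) (dotv a a) z.
  by rewrite /A -sqrS -affine_aquad // dotv_ge0.
have B_ge0 c z : 0 <= aquad B (U *m (T *m c)) (dotv c c) z.
  by rewrite /B -sqrT -affine_aquad // dotv_ge0.
have BA : B - A = U *m (SY - SX) *m U^T by rewrite mulmxBr mulmxBl.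
have BA_le : \sum_i \sum_j (B - A) i j ^+ 2 <= D ^+ 2.
  apply: le_trans SXY_le; rewrite !sum_sqr_tr BA !trmx_mul trmxK.
  have -> : U *m (SY - SX) *m U^T *m (U *m ((SY - SX)^T *m U^T)) =
      U *m ((SY - SX) *m (SY - SX)^T *m U^T).
    by rewrite -!mulmxA (mulmxA U^T) UU' mul1mx.
  rewrite mxtrace_mulC -!mulmxA UU' mulmx1 -(opprB SX) linearN /= mulNmx mulmxN opprK.
  exact: lexx.
have tr_BA : \tr (B - A) = \tr SY - \tr SX.
  by rewrite BA mxtrace_mulC mulmxA UU' mul1mx linearB.
have v_le : dotv (U *m (T *m b) - U *m (S *m a)) (U *m (T *m b) - U *m (S *m a)) <= V ^+ 2.
  apply: le_trans SaTb_le; rewrite -mulmxBr dotv_mulmxl mulmxA UU' mul1mx.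
  rewrite -(opprB (S *m a)) le_eqVlt; apply/orP; left; apply/eqP.
  by apply: eq_bigr => i _; rewrite mxE mulrNN.
have symBA : (B - A)^T = B - A by rewrite linearB /= symA symB.
have [d00 _ _] := fibre_corner_le symBA D_ge0 BA_le.
(* The corner entry moves by at most D <= l1 / 80, which is well within the allowed loss. *)
have B00 : 81 / 100 * l1 <= B ord0 ord0.
  have : A ord0 ord0 - B ord0 ord0 <= D.
    apply: le_trans d00; rewrite -normrN; apply: le_trans (ler_norm _).
    by rewrite !mxE opprB.
  by rewrite c00; move: (B ord0 ord0) D_le l1_gt0 => x; lra.
(* Nonnegativity of |T U^T z|^2, the case of centre 0, on the span of the first two coordinates. *)
have [B11 detB] : 0 <= B (lift ord0 ord0) (lift ord0 ord0) /\
   0 <= B ord0 ord0 * B (lift ord0 ord0) (lift ord0 ord0) - B ord0 (lift ord0 ord0) ^+ 2.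
  apply: quad_form_det_ge0; first by apply: lt_le_trans B00; rewrite mulr_gt0.
  move=> x y; have := B_ge0 0 (cons_col x (cons_col y 0)).
  rewrite aquad_fibre // /quad2 /fibre_lin0 /fibre_lin1 /fibre_cst /aquad !mulmx0.
  have d0 (n : nat) (u : 'cV[R]_n) : dotv u 0 = 0 by apply: big1 => i _; rewrite mxE mulr0.
  have q0 (n : nat) (C : 'M[R]_n) : quadf C 0 = 0.
    by apply: big1 => i _; apply: big1 => j _; rewrite !mxE !mulr0.
  by rewrite !d0 q0 !mxE !subr0 !mulr0 !mul0r !addr0 subr0 addr0.
have := gaussian_comparison gW dpsi cpsi' psi_le1 psi'_le symA symB c00 c01 c11 l1_gt0 l2_gt0
  B00 B11 detB A_ge0 (B_ge0 b) D_ge0 V_ge0 BA_le v_le.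
by rewrite tr_BA (distrC (dotv b b)) (distrC (\tr SY)).
Qed.

End PolynomialComparison.

(** * From polynomials to test functions, and the final constant *)

(** Dominated convergence needs pointwise convergence only, and only at the points exp(-f w) > 0,
    where [ln] is continuous; the value of the approximated function at 0 does not matter. *)
Lemma cvg_Rintegral_bernstein (R : realType) (d : measure_display) (T : measurableType d)
    (P : probability T R) (phi : R -> R) (f : T -> R) :
  continuous phi -> (forall t, `|phi t| <= 1) ->
  measurable_fun setT f -> (forall w, 0 <= f w) ->
  \int[P]_w (bernstein (fun x => phi (Num.sqrt (- ln x))) n).[expR (- f w)] @[n --> \oo]
    --> \int[P]_w phi (Num.sqrt (f w)).
Proof.
move=> cphi phi1 mf f0.
have e01 w : 0 <= expR (- f w) <= 1.
  by rewrite expR_ge0 /= -[leRHS]expR0 ler_expR oppr_le0.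
apply: (@Rintegral_dominated_cvg _ _ _ P _ _ (cst 1)).
- move=> n; apply: (measurableT_comp (continuous_measurable_fun (@continuous_horner _ _))).
  exact: (measurableT_comp (@measurable_expR R) (measurable_funN mf)).
- move=> w; have -> : phi (Num.sqrt (f w)) = (fun x => phi (Num.sqrt (- ln x))) (expR (- f w)).
    by rewrite expRK opprK.
  apply: bernstein_cvg => //.
  apply: (@continuous_comp _ _ _ (fun x => Num.sqrt (- ln x)) phi); last exact: cphi.
  apply: (@continuous_comp _ _ _ (fun x : R => - ln x) Num.sqrt); last exact: sqrt_continuous.
  by apply: cvgN; apply: continuous_ln; exact: expR_gt0.
- exact: finite_measure_integrable_cst.
- by move=> n w; apply: bernstein_le1.
Qed.

Lemma psd_sqrt_spec (R : realType) (n : nat) (A : 'M[R]_n) :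
  A^T = A -> (forall u, 0 <= quadf A u) ->
  (psd_sqrt A)^T = psd_sqrt A /\ psd_sqrt A *m psd_sqrt A = A.
Proof.
move=> symA A0; have [|B [symB B0 BB]] := psd_sqrt_exists symA.
  by move=> u; rewrite -quadfE.
have [[symS _] SS] : [set B : 'M[R]_n | psdmx B /\ B *m B = A] (psd_sqrt A).
  by rewrite /psd_sqrt; apply: (@xgetPex _ _ [set B : 'M[R]_n | psdmx B /\ B *m B = A]); exists B.
by [].
Qed.

Lemma eucl_normE (R : realType) (n : nat) (v : 'cV[R]_n) : eucl_norm v = Num.sqrt (dotv v v).
Proof. by rewrite /eucl_norm /dotv; under eq_bigr do rewrite expr2. Qed.

Lemma test_function_continuous (R : realType) (phi : R -> R) :
  test_function phi -> continuous phi.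
Proof.
move=> [dphi _] t; apply: differentiable_continuous.
by apply/derivable1_diffP; exact: (dphi 0%N).
Qed.

Lemma sup_norm_le1 (R : realType) (phi : R -> R) : (sup_norm phi <= 1)%E ->
  forall t, `|phi t| <= 1.
Proof.
move=> phi1 t; rewrite -lee_fin; apply: le_trans phi1.
by apply: ereal_sup_ubound; exists t.
Qed.

Lemma bounded_expectation (R : realType) (d : measure_display) (T : measurableType d)
    (P : probability T R) (f : T -> R) (M : R) :
  measurable_fun setT f -> (forall w, `|f w| <= M) ->
  ('E_P[f] = (\int[P]_w f w)%:E)%E.
Proof.
move=> mf fM; rewrite expectation.unlock /Rintegral fineK //.
exact: (integrable_fin_num measurableT (@bounded_integrable _ _ _ P _ _ mf fM)).
Qed.

Theorem corollary3p3 (R : realType) (dX dY : measure_display)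
    (TX : measurableType dX) (TY : measurableType dY)
    (PX : probability TX R) (PY : probability TY R)
    (n : nat) (X : TX -> 'cV[R]_n) (Y : TY -> 'cV[R]_n)
    (SX SY : 'M[R]_n) (a b : 'cV[R]_n) (l1 l2 : R)
    (normalX : normal_vector PX X) (normalY : normal_vector PY Y)
    (centeredX : centered_vector PX X) (centeredY : centered_vector PY Y)
    (covX : is_covariance_mx PX X SX) (covY : is_covariance_mx PY Y SY)
    (eigX : two_largest_eigenvalues SX l1 l2) (l2_gt0 : 0 < l2) :
  (dTV PX PY (fun w => eucl_norm (X w - a)) (fun w => eucl_norm (Y w - b)) <=
   (160 / Num.sqrt (l1 * l2) *
      (hs_norm (SX - SY) + `|\tr SX - \tr SY|
       + `|eucl_norm a ^+ 2 - eucl_norm b ^+ 2|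
       + eucl_norm (psd_sqrt SX *m a - psd_sqrt SY *m b)))%:E)%E.
Proof.
have [s [sorted_s eig]] := eigX.
have l21 : l2 <= l1 by move: sorted_s => /= /andP[].
have l1_gt0 : 0 < l1 by exact: lt_le_trans l2_gt0 l21.
have [mX symX X0 lawX] := normal_vector_cos_law normalX centeredX covX.
have [mY symY Y0 lawY] := normal_vector_cos_law normalY centeredY covY.
have [symS sqrS] := psd_sqrt_spec symX X0; have [symT sqrT] := psd_sqrt_spec symY Y0.
set S := psd_sqrt SX in symS sqrS *; set T := psd_sqrt SY in symT sqrT *.
have sl_gt0 : 0 < Num.sqrt (l1 * l2) by rewrite sqrtr_gt0 mulr_gt0.
set D := hs_norm _; set V := eucl_norm (S *m a - T *m b).
set tau := `|\tr SX - \tr SY|; set kappa := `|_ ^+ 2 - _|.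
have D0 : 0 <= D by exact: sqrtr_ge0.
have V0 : 0 <= V by exact: sqrtr_ge0.
have D2 : \sum_i \sum_j (SX - SY) i j ^+ 2 <= D ^+ 2.
  rewrite sqr_sqrtr //; by do 2 (apply: sumr_ge0 => ? _); rewrite sqr_ge0.
have V2 : dotv (S *m a - T *m b) (S *m a - T *m b) <= V ^+ 2.
  by rewrite /V eucl_normE sqr_sqrtr // dotv_ge0.
have kappaE : kappa = `|dotv a a - dotv b b|.
  by rewrite /kappa !eucl_normE !sqr_sqrtr ?dotv_ge0.
apply: ge_ereal_sup => _ [phi [/test_function_continuous cphi /sup_norm_le1 phi1] <-].
have mdist (d : measure_display) (Om : measurableType d) (Z : Om -> 'cV[R]_n) c :
    (forall i, measurable_fun setT (fun w => Z w i 0)) ->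
    measurable_fun setT (fun w => dotv (Z w - c) (Z w - c)).
  move=> mZ; apply: measurable_sum => i.
  have mZi : measurable_fun setT (fun w => (Z w - c) i 0).
    by under eq_fun do rewrite !mxE; exact: measurable_funB.
  exact: measurable_funM.
have mphi (d : measure_display) (Om : measurableType d) (Z : Om -> 'cV[R]_n) c :
    (forall i, measurable_fun setT (fun w => Z w i 0)) ->
    measurable_fun setT (phi \o (fun w => eucl_norm (Z w - c))).
  move=> mZ; under eq_fun do rewrite eucl_normE.
  apply: (measurableT_comp (continuous_measurable_fun cphi)).
  exact: (measurableT_comp (continuous_measurable_fun (@sqrt_continuous R)) (mdist _ _ _ c mZ)).
rewrite (bounded_expectation PX (mphi _ _ _ a mX) (fun w => phi1 _)).
rewrite (bounded_expectation PY (mphi _ _ _ b mY) (fun w => phi1 _)).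
rewrite lee_fin.
have EX := Rintegral_norm_le PX (mphi _ _ _ a mX) (fun w => phi1 _).
have EY := Rintegral_norm_le PY (mphi _ _ _ b mY) (fun w => phi1 _).
(* In the first case the right-hand side is at least 160 / 80 = 2, which bounds any difference of
   two means of [phi]. In the second one the perturbation is small compared with sqrt(l1 l2) <=
   l1. *)
have [large|small] := leP (Num.sqrt (l1 * l2)) (80 * (D + tau + kappa + V)).
  rewrite mulrAC; apply: (@le_trans _ _ 2).
    by move: EX EY; rewrite !ler_norml => /andP[? ?] /andP[? ?]; lra.
  by rewrite ler_pdivlMr //; lra.
have tau0 : 0 <= tau by exact: normr_ge0. have kappa0 : 0 <= kappa by exact: normr_ge0.
have D_le : 80 * D <= l1.
  have : Num.sqrt (l1 * l2) <= l1.
    by rewrite -[leRHS]ger0_norm ?(ltW l1_gt0) // -sqrtr_sqr ler_wsqrtr // expr2 ler_pM2l.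
  by lra.
(* The degree of the characteristic polynomial shows that the dimension is at least 2. *)
have nE : n = (size s).+2.
  by have := size_char_poly SX; rewrite eig size_prod_XsubC => -[].
subst n.
apply: le_trans (ler_norm _) _; rewrite distrC.
under [X in `|X - _|]eq_Rintegral do rewrite /= eucl_normE.
under [X in `|_ - X|]eq_Rintegral do rewrite /= eucl_normE.
have cX := cvg_Rintegral_bernstein (P := PX) cphi phi1 (mdist _ _ _ a mX) (fun w => dotv_ge0 _).
have cY := cvg_Rintegral_bernstein (P := PY) cphi phi1 (mdist _ _ _ b mY) (fun w => dotv_ge0 _).
apply: (cvgr_to_le (cvg_norm (cvgB cY cX))); apply: nearW => n.
have := polynomial_comparison mX mY lawX lawY symS symT sqrS sqrT eig l2_gt0 l1_gt0
  (fun x x01 => @bernstein_le1 _ (fun x => phi (Num.sqrt (- ln x))) n x x01 (fun t => phi1 _)) D0 V0 D2 V2 D_le.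
(* The largest coefficient is 20/9 * 67 < 149, below 160. *)
move=> /le_trans; apply; rewrite -/tau -kappaE [160 / _ * _]mulrAC ler_pM2r ?invr_gt0 //.
lra.
Qed.
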